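(* Assume that the matrices $\bm{K}_{ij}$ associated with $\bm{u}_h$ are pointwise positive-definite in the sense that, pointwise on $D^k$, $$\sum_{i,j=1}^d\bm{\Theta}_i^T\bm{K}_{ij}\bm{\Theta}_j \ge \lambda_{\min}\sum_{i=1}^d\bm{\Theta}_i^T\bm{\Theta}_i$$ with $\lambda_{\min}>0$ (possibly depending on position). Assume that all integrals in the DG formulation are computed exactly, and that $\tilde{\bm{u}}=\bm{u}(\Pi_N\bm{v}(\bm{u}_h))$ and $\bm{f}_m(\tilde{\bm{u}})$, $m=1,\dots,d$, are differentiable. Then the entropy correction artificial viscosity coefficient $$\epsilon_k(\bm{u}_h) = \frac{-\min(0,\delta_k(\bm{u}_h))}{\int_{D^k}\sum_{i,j=1}^d\bm{\Theta}_i^T\bm{K}_{ij}\bm{\Theta}_j},\qquad \delta_k(\bm{u}_h)=\sum_{i=1}^d\left[\int_{D^k}-\bm{f}_i(\bm{u}_h)^T\frac{\partial \Pi_N\bm{v}(\bm{u}_h)}{\partial x_i}+\int_{\partial D^k}\psi_i(\tilde{\bm{u}})n_i\right],$$ satisfies $$\epsilon_k(\bm{u}_h)\lesssim C(\bm{u}_h)\,h,$$ where $$C(\bm{u}_h)=\|\lambda_{\min}^{-1}\|_{L^\infty}\sqrt{\sum_{i=1}^d\left\|\frac{\partial\bm{f}_i}{\partial\bm{v}}\right\|^2}\ \sqrt{\frac{\|\bm{\delta v}\|_{L^2(D^k)}^2}{\|\Pi_N\bm{\delta v}\|_{L^2(D^k)}^2}-1},$$ $\bar{\bm{v}}$ is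 the integral mean of $\bm{v}(\bm{u}_h)$ over $D^k$, and $\bm{\delta v}=\bm{v}(\bm{u}_h)-\bar{\bm{v}}$.
   Context: Consider a system of conservation laws $\partial_t\bm{u}+\sum_{m=1}^d\partial_{x_m}\bm{f}_m(\bm{u})=0$ with $\bm{u}\in\mathbb{R}^n$, admitting a scalar convex entropy $S(\bm{u})$ with entropy fluxes $F_m$ satisfying $\bm{v}^T\frac{\partial\bm{f}_m}{\partial\bm{u}}=\frac{\partial F_m}{\partial\bm{u}}$, where $\bm{v}(\bm{u})=\partial S/\partial\bm{u}$ are the entropy variables. The map $\bm{u}\mapsto\bm{v}$ is invertible with inverse $\bm{u}(\bm{v})$. The entropy potentials $\psi_m$ are defined by $F_m(\bm{u})=\bm{v}(\bm{u})^T\bm{f}_m(\bm{u})-\psi_m(\bm{u})$, so that $\frac{\partial\psi_m}{\partial\bm{u}}=\left(\frac{\partial\bm{v}}{\partial\bm{u}}\right)^T\bm{f}_m$. The domain is triangulated by affine simplices; $D^k\subset\mathbb{R}^d$ is one of them, with outward unit normal $\bm{n}=(n_1,\dots,n_d)$, and $h$ is the mesh size. $P^N(D^k)$ is the space of polynomials of total degree at most $N$; $\bm{u}_h$ is a discontinuous piecewise polynomial with $\bm{u}_h|_{D^k}\in[P^N(D^k)]^n$; $\Pi_N$ is the (componentwise) $L^2$ projection onto $P^N(D^k)$ on each element; $\tilde{\bm{u}}=\bm{u}(\Pi_N\bm{v}(\bm{u}_h))$ is the entropy projection. With $\bm{v}_h=\Pi_N\bm{v}(\bm{u}_h)$, the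 LDG derivatives $\bm{\Theta}_i\in[P^N(D^k)]^n$, $i=1,\dots,d$, are defined by $$\int_{D^k}\bm{\Theta}_i^T\bm{w}=\int_{D^k}-\bm{v}_h^T\frac{\partial\bm{w}}{\partial x_i}+\int_{\partial D^k}\left(\{\{\bm{v}_h\}\}-\frac{\beta}{2}[\![\bm{v}_h]\!]\right)^T\bm{w}\,n_i\qquad\forall\bm{w}\in[P^N(D^k)]^n,$$ where $[\![u]\!]=u^+-u^-$, $\{\{u\}\}=\frac12(u^++u^-)$, $u^-$ is the interior trace and $u^+$ the exterior (neighboring) trace on each face, and $\beta={\rm sign}(\bm{v}_0\cdot\bm{n})$ for a fixed nonzero $\bm{v}_0\in\mathbb{R}^d$. The $\bm{K}_{ij}\in\mathbb{R}^{n\times n}$ (which may depend on $\bm{u}_h$, hence on position) are the blocks of a symmetric positive semi-definite $nd\times nd$ matrix. $\|\partial\bm{f}_i/\partial\bm{v}\|$ denotes the supremum of the operator norm of the Jacobian of $\bm{f}_i$ regarded as a function of the entropy variables, $\bm{v}\mapsto\bm{f}_i(\bm{u}(\bm{v}))$, over the segments joining $\bm{v}(\bm{u}_h(x))$ and $\Pi_N\bm{v}(\bm{u}_h)(x)$, $x\in D^k$ (these segments are assumed to lie in the domain on which $\bm{u}(\bm{v})$ and $\bm{f}_i(\bm{u}(\bm{v}))$ are smooth). $\|\lambda_{\min}^{-1}\|_{L^\infty}$ is taken over $D^k$. The quantities are considered when the denominators appearing in $\epsilon_k$ and $C(\bm{u}_h)$ are nonzero. The notation $a\lesssim b$ means $a\le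 Cb$ with $C$ independent of the mesh size and of $\bm{u}_h$ (it may depend on shape regularity, dimension and polynomial degree). *)

(* Defs.v *)
From HB Require Import structures.
From mathcomp Require Import all_boot all_order all_algebra.
From mathcomp Require Import all_classical all_reals all_analysis.
From mathcomp Require mpoly.
Import Order.TTheory GRing.Theory Num.Theory.
Import numFieldNormedType.Exports.
Set Implicit Arguments.
Unset Strict Implicit.
Unset Printing Implicit Defensive.

Local Open Scope classical_set_scope.
Local Open Scope ring_scope.

(* Borel sigma-algebra on R^n, generated by the coordinates. *)
Section rV_measurable.
Context (R : realType) (n : nat).

Let coors (i : 'I_n) (x : 'rV[R]_n) : measurableTypeR R := x ord0 i.

Let rV_set0 : g_sigma_preimage coors set0.
Proof. exact: sigma_algebra0. Qed.

Let rV_setC A : g_sigma_preimage coors A -> g_sigma_preimage coors (~` A).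
Proof. exact: sigma_algebraC. Qed.

Let rV_bigcup (F : _^nat) : (forall i, g_sigma_preimage coors (F i)) ->
  g_sigma_preimage coors (\bigcup_i (F i)).
Proof. exact: sigma_algebra_bigcup. Qed.

HB.instance Definition _ := @isMeasurable.Build
  (measure_tuple_display default_measure_display)
  'rV[R]_n (g_sigma_preimage coors) rV_set0 rV_setC rV_bigcup.

End rV_measurable.

Lemma measurable_coord (R : realType) n (i : 'I_n) :
  measurable_fun setT (fun x : 'rV[R]_n => x ord0 i).
Proof.
move=> _ B mB; rewrite setTI; apply: sub_sigma_algebra.
case: n i => [[] []//|m i]; rewrite -bigcup_mkord_ord.
exists i; first exact: ltn_ord.
by exists B => //; rewrite inord_val setTI.
Qed.

Lemma measurable_rVP (R : realType) n d (T : measurableType d)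
    (f : T -> 'rV[R]_n) :
  (forall i, measurable_fun setT (fun t => f t ord0 i)) -> measurable_fun setT f.
Proof.
move=> mf.
suff : g_sigma_preimage
    (fun (i : 'I_n) t => (f t ord0 i : measurableTypeR R)) `<=` measurable.
  rewrite (@g_sigma_preimage_comp _ _ n _
    (fun (i : 'I_n) (x : 'rV[R]_n) => (x ord0 i : measurableTypeR R)) _ f).
  by move=> h _ A mA; apply: h; exists A.
apply: smallest_sub; first exact: sigma_algebra_measurable.
case: n f mf => [|m] f mf; first by rewrite big_ord0.
rewrite -bigcup_mkord_ord; apply: bigcup_sub => i Ii.
by move=> _ [A mA <-]; apply: mf.
Qed.


(* The library's sigma-finite instance on products is shadowed by the one on
   products of subprobabilities. *)
Lemma sigma_finite_product d1 d2 (T1 : measurableType d1)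
    (T2 : measurableType d2) (R : realType)
    (m1 : {sigma_finite_measure set T1 -> \bar R})
    (m2 : {sigma_finite_measure set T2 -> \bar R}) :
  sigma_finite setT (m1 \x m2)%E.
Proof.
have /sigma_finiteP[F [TF ndF Foo]] := sigma_finiteT m1.
have /sigma_finiteP[G [TG ndG Goo]] := sigma_finiteT m2.
exists (fun n => F n `*` G n).
  rewrite -setXTT TF TG predeqE => -[x y]; split.
    move=> [/= [n _ Fnx] [k _ Gky]]; exists (maxn n k) => //; split.
    - by move: x Fnx; exact/subsetPset/ndF/leq_maxl.
    - by move: y Gky; exact/subsetPset/ndG/leq_maxr.
  by move=> [n _ []/= ? ?]; split; exists n.
move=> k; have [? ?] := Foo k; have [? ?] := Goo k.
split; first exact: measurableX.
by rewrite product_measure1E// lte_mul_pinfty// ge0_fin_numE.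
Qed.

Section lebesgue_rV.
Context (R : realType).
Local Open Scope ereal_scope.

Definition row_cons n (p : measurableTypeR R * 'rV[R]_n) : 'rV[R]_n.+1 :=
  row_mx (\row_(_ < 1) p.1) p.2.

Definition row_uncons n (x : 'rV[R]_n.+1) : measurableTypeR R * 'rV[R]_n :=
  (x ord0 ord0, \row_i x ord0 (lift ord0 i)).

Lemma row_unconsK n : cancel (@row_cons n) (@row_uncons n).
Proof.
move=> [a y]; rewrite /row_uncons /row_cons /=; congr (_, _).
  have -> : (ord0 : 'I_n.+1) = lshift n (ord0 : 'I_1) by apply/val_inj.
  by rewrite (@row_mxEl _ 1 1 n) mxE.
apply/rowP => i; rewrite mxE.
have -> : lift ord0 i = rshift 1 i by apply/val_inj.
by rewrite (@row_mxEr _ 1 1 n).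
Qed.

Lemma measurable_row_cons n : measurable_fun setT (@row_cons n).
Proof.
apply: measurable_rVP => i; case: (@splitP 1 n i) => j ij.
  have -> : i = lshift n j by apply/val_inj.
  under eq_fun do rewrite (@row_mxEl _ 1 1 n) mxE.
  exact: measurable_fst.
have -> : i = rshift 1 j by apply/val_inj.
under eq_fun do rewrite (@row_mxEr _ 1 1 n).
by apply: (measurableT_comp (measurable_coord j)); exact: measurable_snd.
Qed.

Lemma measurable_row_uncons n : measurable_fun setT (@row_uncons n).
Proof.
apply: measurable_fun_pair; first exact: measurable_coord.
by apply: measurable_rVP => i; under eq_fun do rewrite mxE;
  exact: measurable_coord.
Qed.

Section step.
Context n (mu : {sigma_finite_measure set 'rV[R]_n -> \bar R}).

Definition lebesgue_step : set 'rV[R]_n.+1 -> \bar R :=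
  pushforward (@lebesgue_measure R \x mu) (@row_cons n).

Let lebesgue_step0 : lebesgue_step set0 = 0.
Proof. by rewrite /lebesgue_step /pushforward preimage_set0 measure0. Qed.

Let lebesgue_step_ge0 A : 0 <= lebesgue_step A.
Proof. by rewrite /lebesgue_step /pushforward measure_ge0. Qed.

Let lebesgue_step_sigma_additive : semi_sigma_additive lebesgue_step.
Proof.
have mpre A : measurable A -> measurable (@row_cons n @^-1` A).
  by move=> mA; rewrite -[X in measurable X]setTI; exact: measurable_row_cons.
move=> F mF tF mUF; rewrite /lebesgue_step /pushforward preimage_bigcup.
apply: measure_semi_sigma_additive.
- by move=> k; exact: mpre.
- apply/trivIsetP => /= i j _ _ ij; rewrite -preimage_setI.
  by move/trivIsetP : tF => /(_ _ _ _ _ ij) ->//; rewrite preimage_set0.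
- by rewrite -preimage_bigcup; exact: mpre.
Qed.

HB.instance Definition _ := isMeasure.Build _ _ _ lebesgue_step
  lebesgue_step0 lebesgue_step_ge0 lebesgue_step_sigma_additive.

Let lebesgue_step_sigma_finite : sigma_finite setT lebesgue_step.
Proof.
have [F FT Foo] := sigma_finite_product (@lebesgue_measure R) mu.
exists (fun k => @row_uncons n @^-1` F k).
  by rewrite -preimage_bigcup -FT preimage_setT.
move=> k; have [mF Fk] := Foo k; split.
  by rewrite -[X in measurable X]setTI; exact: measurable_row_uncons.
rewrite /lebesgue_step /pushforward -comp_preimage.
by rewrite (_ : @row_uncons n \o @row_cons n = id) //; apply/funext => p; exact: row_unconsK.
Qed.

HB.instance Definition _ := Measure_isSigmaFinite.Build _ _ _ lebesgue_step
  lebesgue_step_sigma_finite.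
End step.

(* n-dimensional Lebesgue measure: the n-fold product of the one-dimensional one;
   the Dirac mass for n = 0. *)
Fixpoint lebesgue_rV n : {sigma_finite_measure set 'rV[R]_n -> \bar R} :=
  match n with
  | 0%N => dirac (0%R : 'rV[R]_0)
  | n'.+1 => lebesgue_step (lebesgue_rV n')
  end.

Lemma lebesgue_rVX n (A : set (measurableTypeR R)) (B : set 'rV[R]_n) :
  measurable A -> measurable B ->
  lebesgue_rV n.+1 (@row_cons n @` (A `*` B)) =
  lebesgue_measure A * lebesgue_rV n B.
Proof.
move=> mA mB; rewrite /= /lebesgue_step /pushforward -product_measure1E//.
congr (_ _); apply/seteqP; split=> [p [q qAB pq]|p pAB]; last by exists p.
by rewrite -(row_unconsK p) -pq row_unconsK.
Qed.

End lebesgue_rV.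

Section euclidean.
Context {R : realType}.

(* The norm `|x| of 'rV[R]_n is the max norm; all norms below are Euclidean. *)
Definition dot n (x y : 'rV[R]_n) : R := \sum_i x ord0 i * y ord0 i.

Definition enorm n (x : 'rV[R]_n) : R := Num.sqrt (dot x x).

Definition opnorm n m (A : 'M[R]_(n, m)) : R :=
  sup [set enorm (x *m A) | x in [set x : 'rV[R]_n | enorm x <= 1]].

Definition pderiv n (i : 'I_n) (W : normedModType R) (g : 'rV[R]_n -> W)
    (x : 'rV[R]_n) : W :=
  'D_(delta_mx ord0 i) g x.

Definition gradient n (g : 'rV[R]_n -> R) (x : 'rV[R]_n) : 'rV[R]_n :=
  \row_i pderiv i g x.

Definition C1_on n (W : normedModType R) (U : set 'rV[R]_n)
    (g : 'rV[R]_n -> W) : Prop :=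
  forall x, U x -> differentiable g x /\
    forall y : 'rV[R]_n, {for x, continuous (fun z => 'D_y g z)}.

Definition diam n (A : set 'rV[R]_n) : R :=
  sup [set enorm (xy.1 - xy.2) | xy in A `*` A].

Definition inradius n (A : set 'rV[R]_n) : R :=
  sup [set r | 0 <= r /\
    exists c, [set y : 'rV[R]_n | enorm (y - c) <= r] `<=` A].

Definition vol_int n (A : set 'rV[R]_n) (g : 'rV[R]_n -> R) : R :=
  \int[lebesgue_rV R n]_(x in A) g x.

Definition L2norm n m (A : set 'rV[R]_n) (g : 'rV[R]_n -> 'rV[R]_m) : R :=
  Num.sqrt (vol_int A (fun x => enorm (g x) ^+ 2)).

Definition integral_mean n m (A : set 'rV[R]_n) (g : 'rV[R]_n -> 'rV[R]_m) :
    'rV[R]_m :=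
  (fine (lebesgue_rV R n A))^-1 *: \row_c vol_int A (fun x => g x ord0 c).

Definition Linfnorm n (A : set 'rV[R]_n) (g : 'rV[R]_n -> R) : \bar R :=
  'N[lebesgue_rV R n]_+oo[EFin \o (g \_ A)].

End euclidean.

Section simplices.
Context {R : realType}.

Definition conv_hull n (I : finType) (A : {set I}) (p : I -> 'rV[R]_n) :
    set 'rV[R]_n :=
  [set x | exists c : I -> R, [/\ forall i, 0 <= c i,
    \sum_(i in A) c i = 1 & x = \sum_(i in A) c i *: p i]].

Definition simplex m n (p : 'I_m.+1 -> 'rV[R]_n) : set 'rV[R]_n :=
  conv_hull [set: 'I_m.+1]%SET p.

Definition edges m n (p : 'I_m.+1 -> 'rV[R]_n) : 'M[R]_(m, n) :=
  \matrix_(i < m) (p (lift ord0 i) - p ord0).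

Definition ref_simplex m : set 'rV[R]_m :=
  [set s | (forall i, 0 <= s ord0 i) /\ \sum_i s ord0 i <= 1].

(* Vertices of the facet opposite to vertex j. *)
Definition facet m n (p : 'I_m.+2 -> 'rV[R]_n) (j : 'I_m.+2) :
    'I_m.+1 -> 'rV[R]_n :=
  p \o lift j.

Definition simplex_param m n (q : 'I_m.+1 -> 'rV[R]_n) (s : 'rV[R]_m) :
    'rV[R]_n :=
  q ord0 + s *m edges q.

(* m-dimensional surface integral over the m-simplex with vertices q, with the
   Gram determinant of the affine parametrization as area element. For m = 0 it
   is the value at the point q ord0. *)
Definition surf_int m n (q : 'I_m.+1 -> 'rV[R]_n) (g : 'rV[R]_n -> R) : R :=
  Num.sqrt (\det (edges q *m (edges q)^T)) *
  vol_int (ref_simplex (m:=m)) (g \o simplex_param q).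

Definition surf_integrable m n (q : 'I_m.+1 -> 'rV[R]_n)
    (g : 'rV[R]_n -> R) : Prop :=
  (lebesgue_rV R m).-integrable (ref_simplex (m:=m))
    (EFin \o (g \o simplex_param q)).

Definition outward_unit_normal d (p : 'I_d.+2 -> 'rV[R]_d.+1) (j : 'I_d.+2)
    (nu : 'rV[R]_d.+1) : Prop :=
  [/\ enorm nu = 1,
      forall i, dot nu (row i (edges (facet p j))) = 0
    & dot nu (p j - facet p j ord0) < 0].

Definition bdry_int d (p : 'I_d.+2 -> 'rV[R]_d.+1)
    (g : 'I_d.+2 -> 'rV[R]_d.+1 -> R) : R :=
  \sum_j surf_int (facet p j) (g j).

(* Element k of the mesh is the simplex with vertices vtx k. Two elements
   intersect in the common subsimplex spanned by their common vertices. *)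
Definition triangulation d (M : finType)
    (vtx : M -> 'I_d.+2 -> 'rV[R]_d.+1) : Prop :=
  [/\ forall k, edges (vtx k) \in unitmx,
      injective (fun k => simplex (vtx k))
    & forall k l, simplex (vtx k) `&` simplex (vtx l) =
        conv_hull [set i | [exists j, vtx k i == vtx l j]]%SET (vtx k)].

Definition neighbor d (M : finType) (vtx : M -> 'I_d.+2 -> 'rV[R]_d.+1)
    (k : M) (j : 'I_d.+2) (l : M) : Prop :=
  l <> k /\ forall i, exists i', facet (vtx k) j i = vtx l i'.

Definition mesh_size d (M : finType)
    (vtx : M -> 'I_d.+2 -> 'rV[R]_d.+1) : R :=
  \big[Num.max/0]_k diam (simplex (vtx k)).

Definition shape_regular d (M : finType)
    (vtx : M -> 'I_d.+2 -> 'rV[R]_d.+1) (sigma : R) : Prop :=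
  forall k, diam (simplex (vtx k)) <= sigma * inradius (simplex (vtx k)).

End simplices.

Section polynomials.
(* Notations and factory names of mpoly clash with those of MathComp-Analysis,
   hence the filtered and section-local import. *)
Import -(notations) mpoly.
Context {R : realType}.

(* mmeasure mdeg q is msize q: one plus the total degree, and 0 for q = 0. A
   polynomial on a nondegenerate simplex is identified with its extension to
   R^d. *)
Definition PN d (N : nat) (w : 'rV[R]_d -> R) : Prop :=
  exists2 q : mpoly d R, (mmeasure mdeg q <= N.+1)%N &
    forall x, w x = meval (x ord0) q.

Definition PNvec d n (N : nat) (w : 'rV[R]_d -> 'rV[R]_n) : Prop :=
  forall c, PN N (fun x => w x ord0 c).

Definition L2_projection d n (N : nat) (A : set 'rV[R]_d)
    (g pg : 'rV[R]_d -> 'rV[R]_n) : Prop :=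
  PNvec N pg /\ forall c (q : 'rV[R]_d -> R), PN N q ->
    vol_int A (fun x => (g x ord0 c - pg x ord0 c) * q x) = 0.

End polynomials.

Section conservation_law.
Context {R : realType}.

(* U is the set of admissible states. *)
Record entropy_pair d n (U : set 'rV[R]_n)
    (f : 'I_d -> 'rV[R]_n -> 'rV[R]_n) (S : 'rV[R]_n -> R)
    (F : 'I_d -> 'rV[R]_n -> R) : Prop := EntropyPair {
  entropy_open : open U;
  entropy_convex_dom : convex_set U;
  entropy_convex : convex_function U S;
  entropy_diff : forall u, U u -> differentiable S u;
  entropy_C2 : C1_on U (gradient S);
  flux_C1 : forall m, C1_on U (f m);
  entropy_flux_diff : forall m u, U u -> differentiable (F m) u;
  entropy_compat : forall m u (c : 'I_n), U u ->
    dot (gradient S u) (pderiv c (f m) u) = pderiv c (F m) u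
}.

(* uofv : V -> U is the inverse of the entropy variables v : U -> V. *)
Record entropy_inverse d n (U V : set 'rV[R]_n)
    (f : 'I_d -> 'rV[R]_n -> 'rV[R]_n)
    (v uofv : 'rV[R]_n -> 'rV[R]_n) : Prop := EntropyInverse {
  inverse_open : open V;
  inverse_vK : forall u, U u -> V (v u) /\ uofv (v u) = u;
  inverse_uK : forall w, V w -> U (uofv w) /\ v (uofv w) = w;
  inverse_C1 : C1_on V uofv;
  inverse_flux_C1 : forall m, C1_on V (f m \o uofv)
}.

Definition entropy_potential n (v f : 'rV[R]_n -> 'rV[R]_n)
    (F : 'rV[R]_n -> R) (u : 'rV[R]_n) : R :=
  dot (v u) (f u) - F u.

Definition segments d n (D : set 'rV[R]_d) (a b : 'rV[R]_d -> 'rV[R]_n) :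
    set 'rV[R]_n :=
  [set w | exists x t, [/\ D x, 0 <= t <= 1 & w = (1 - t) *: a x + t *: b x]].

(* The Jacobian 'J g w acts on row vectors: it is the transpose of dg/dv. *)
Definition jacobian_sup n (T : set 'rV[R]_n) (g : 'rV[R]_n -> 'rV[R]_n) : R :=
  sup [set opnorm ('J g w) | w in T].

End conservation_law.

Section dg.
Context {R : realType}.

Definition jump n (up um : 'rV[R]_n) : 'rV[R]_n := up - um.

Definition avg n (up um : 'rV[R]_n) : 'rV[R]_n := 2^-1 *: (up + um).

(* vh is the interior trace, vp j the exterior trace on the facet opposite to
   vertex j. Num.sg 0 = 0. *)
Definition LDG_derivative d n (N : nat) (p : 'I_d.+2 -> 'rV[R]_d.+1)
    (nu : 'I_d.+2 -> 'rV[R]_d.+1) (v0 : 'rV[R]_d.+1)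
    (vh : 'rV[R]_d.+1 -> 'rV[R]_n) (vp : 'I_d.+2 -> 'rV[R]_d.+1 -> 'rV[R]_n)
    (i : 'I_d.+1) (Theta : 'rV[R]_d.+1 -> 'rV[R]_n) : Prop :=
  PNvec N Theta /\ forall w : 'rV[R]_d.+1 -> 'rV[R]_n, PNvec N w ->
    vol_int (simplex p) (fun x => dot (Theta x) (w x)) =
    vol_int (simplex p) (fun x => - dot (vh x) (pderiv i w x)) +
    bdry_int p (fun j x =>
      dot (avg (vp j x) (vh x)
           - (Num.sg (dot v0 (nu j)) / 2) *: jump (vp j x) (vh x)) (w x)
      * nu j ord0 i).

Definition sym_psd m (A : 'M[R]_m) : Prop :=
  A^T = A /\ forall y : 'rV[R]_m, 0 <= dot (y *m A) y.

Definition viscous_form d n (K : 'I_d -> 'I_d -> 'rV[R]_d -> 'M[R]_n)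
    (Theta : 'I_d -> 'rV[R]_d -> 'rV[R]_n) (x : 'rV[R]_d) : R :=
  \sum_i \sum_j dot (Theta i x *m K i j x) (Theta j x).

Definition delta_k d n (p : 'I_d.+2 -> 'rV[R]_d.+1)
    (nu : 'I_d.+2 -> 'rV[R]_d.+1) (f : 'I_d.+1 -> 'rV[R]_n -> 'rV[R]_n)
    (psi : 'I_d.+1 -> 'rV[R]_n -> R)
    (uh vh ut : 'rV[R]_d.+1 -> 'rV[R]_n) : R :=
  \sum_i (vol_int (simplex p) (fun x => - dot (f i (uh x)) (pderiv i vh x)) +
          bdry_int p (fun j x => psi i (ut x) * nu j ord0 i)).

Definition eps_k d n (p : 'I_d.+2 -> 'rV[R]_d.+1)
    (K : 'I_d.+1 -> 'I_d.+1 -> 'rV[R]_d.+1 -> 'M[R]_n)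
    (Theta : 'I_d.+1 -> 'rV[R]_d.+1 -> 'rV[R]_n) (delta : R) : R :=
  - Num.min 0 delta / vol_int (simplex p) (viscous_form K Theta).

(* The constant C(u_h), where L i stands for the norm of df_i/dv; it is +oo only
   if 1 / lambda_min is not essentially bounded. *)
Definition C_uh d n (D : set 'rV[R]_d) (lambda : 'rV[R]_d -> R)
    (L : 'I_d -> R) (dv pdv : 'rV[R]_d -> 'rV[R]_n) : \bar R :=
  (Linfnorm D (fun x => (lambda x)^-1)%R
   * (Num.sqrt (\sum_i L i ^+ 2))%:E
   * (Num.sqrt (L2norm D dv ^+ 2 / L2norm D pdv ^+ 2 - 1))%:E)%E.

End dg.

(* Main.v *)
(* Gauss' theorem and the chain rule for the entropy potentials turn the boundary
   term of delta_k into the integral of f(u~) . grad Pi_N v, so that delta_k is the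
   integral of (f(u~) - f(u_h)) . grad Pi_N v. The mean value inequality along the
   segments in entropy variables and Cauchy-Schwarz bound - delta_k by
   (sum_i L_i^2)^(1/2) |v - Pi_N v| |grad Pi_N v|.
   The denominator is at least |Theta|^2 / |1 / lambda_min|_oo, and |Theta| controls
   |grad Pi_N v|: with upwind sign beta there is a face j0 on which the LDG flux is
   the interior trace. For the vertex p j0 opposite to it and an edge e = p r - p j0,
   the test function phi = bary_coord r * D_e Pi_N v makes all other boundary terms
   vanish, hence the integrals of (e . Theta) phi and of (D_e Pi_N v) phi agree; the
   latter dominates |D_e Pi_N v|^2, all weighted norms of polynomials being equivalent.
   Finally |Pi_N dv| <~ h |grad Pi_N v| by the Poincare inequality for polynomials of
   mean zero, and |dv|^2 = |v - Pi_N v|^2 + |Pi_N dv|^2. *)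
Require Import Defs.
From HB Require Import structures.
From mathcomp Require Import all_boot all_order fingroup perm all_algebra.
From mathcomp Require Import all_classical all_reals all_analysis.
From mathcomp Require Import measurable_realfun ess_sup_inf ring lra.
From mathcomp Require mpoly.
Import Order.TTheory GRing.Theory Num.Theory.
Import numFieldNormedType.Exports.
Local Open Scope classical_set_scope.
Local Open Scope ring_scope.
Set Implicit Arguments.
Unset Strict Implicit.
Unset Printing Implicit Defensive.

(** * Affine images of Lebesgue measure *)

Section affine_change_of_variables.
Context {R : realType}.
Local Open Scope ereal_scope.

(** The constant may see the mesh only through [sigma]. Inequalities between integrals of
    polynomials are therefore proved on the reference simplex, where linear algebra on a finite span
    yields some constant, and are carried over by the affine parametrization, both sides picking up
    the same determinant. The geometry that remains consists of edges and barycentric gradients,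
    dual to each other: an edge is at most the diameter, a gradient at most the inverse inradius,
    and the product is controlled by [sigma]. The exterior traces in the LDG flux cannot be
    controlled by data on the element, so the test functions are chosen to make them drop out. The
    factor [h] arises as follows: the bound on the numerator of the coefficient is linear in the
    norm of the gradient of the projection, the denominator is at least of quadratic order, and
    Poincare turns the inverse of that norm into [h] over the norm of the projected fluctuation. If
    [1 / lambda] is not essentially bounded, the right-hand side is [+oo] or, because [+oo * 0 = 0],
    zero; the second case needs an argument of its own. *)

Lemma measurable_row_cons_preimage n (B : set 'rV[R]_n.+1) :
  measurable B -> measurable (@row_cons R n @^-1` B).
Proof.
by move=> mB; rewrite -[X in measurable X]setTI; exact: measurable_row_cons.
Qed.

Lemma lebesgue_rV_xsection n (B : set 'rV[R]_n.+1) :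
  lebesgue_rV R n.+1 B =
  \int[lebesgue_measure]_a lebesgue_rV R n [set y | B (row_cons (a, y))].
Proof.
rewrite /= /lebesgue_step /pushforward /product_measure1.
by apply: eq_integral => a _ /=; rewrite xsectionE.
Qed.

(** By definition the measure slices at a fixed first coordinate. The opposite order comes from
    uniqueness of the product measure, since both iterated integrals agree on rectangles. *)
Lemma lebesgue_rV_ysection n (B : set 'rV[R]_n.+1) : measurable B ->
  lebesgue_rV R n.+1 B =
  \int[lebesgue_rV R n]_y lebesgue_measure [set a | B (row_cons (a, y))].
Proof.
move=> mB; rewrite /= /lebesgue_step /pushforward.
rewrite (@product_measure_unique _ _ _ _ _ _ _
  (lebesgue_measure \x^ lebesgue_rV R n)).
- by apply: eq_integral => a _ /=; rewrite ysectionE.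
- by move=> A C mA mC; rewrite /= product_measure2E.
- exact: measurable_row_cons_preimage.
Qed.

(** Phrased with preimages, so that composition multiplies the constants and no image has to be
    measured. For an invertible affine map the constant is the inverse of the absolute
    determinant. *)
Definition scales_measure n (c : R) (T : 'rV[R]_n -> 'rV[R]_n) : Prop :=
  measurable_fun setT T /\ forall B, measurable B ->
    lebesgue_rV R n (T @^-1` B) = c%:E * lebesgue_rV R n B.

Lemma scales_measure_comp n (c1 c2 : R) (T1 T2 : 'rV[R]_n -> 'rV[R]_n) :
  scales_measure c1 T1 -> scales_measure c2 T2 ->
  scales_measure (c1 * c2)%R (T2 \o T1).
Proof.
move=> [m1 s1] [m2 s2]; split; first exact: measurableT_comp.
move=> B mB; rewrite comp_preimage s1; last first.
  by rewrite -[X in measurable X]setTI; exact: m2.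
by rewrite s2// EFinM muleA.
Qed.

(** The pushforward of Lebesgue measure by [T] is its multiple by [c]. *)
Lemma ge0_integral_scales n (c : R) (T : 'rV[R]_n -> 'rV[R]_n)
    (D : set 'rV[R]_n) (h : 'rV[R]_n -> \bar R) :
  (0 <= c)%R -> scales_measure c T -> measurable D -> measurable_fun D h ->
  {in D, forall y, 0 <= h y} ->
  \int[lebesgue_rV R n]_(x in T @^-1` D) (h (T x)) =
  c%:E * \int[lebesgue_rV R n]_(x in D) h x.
Proof.
move=> c0 [mT sT] mD mh h0.
rewrite -[LHS](ge0_integral_pushforward mT)//.
rewrite (eq_measure_integral (mscale (NngNum c0) (lebesgue_rV R n))).
  by rewrite ge0_integral_mscale// => x Dx; apply: h0; rewrite inE.
by move=> A mA _; exact: (sT _ mA).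
Qed.

(** [al] times the pushforward agrees with Lebesgue measure on half-open intervals, and these
    determine it. *)
Lemma lebesgue_measure_affine_gt0 (al be : R) (B : set (measurableTypeR R)) :
  (0 < al)%R -> measurable B ->
  lebesgue_measure [set a | B (al * a + be)%R] =
  (al^-1)%:E * lebesgue_measure B.
Proof.
move=> al0 mB.
pose phi : measurableTypeR R -> measurableTypeR R := fun a => (al * a + be)%R.
have mphi : measurable_fun setT phi.
  apply: measurable_funD => //.
pose nu0 := (mscale (NngNum (ltW al0)) (pushforward (@lebesgue_measure R) phi)
  : {measure set _ -> \bar R}).
pose nu := nu0 mphi.
have -> : lebesgue_measure B = nu B.
  apply: lebesgue_measure_unique => // _ [[s t] _ <-].
  rewrite /nu /nu0 /mscale /= /pushforward.
  have pre : phi @^-1` `]s, t] = [set` `](al^-1 * (s - be)), (al^-1 * (t - be))]]%R.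
    apply/seteqP; split => a /=; rewrite !in_itv/= /phi => /andP[h1 h2];
      apply/andP; split.
    - by rewrite mulrC ltr_pdivrMr// mulrC; lra.
    - by rewrite mulrC ler_pdivlMr// mulrC; lra.
    - by move: h1; rewrite mulrC ltr_pdivrMr// mulrC; lra.
    - by move: h2; rewrite mulrC ler_pdivlMr// mulrC; lra.
  rewrite [X in _ = _ * lebesgue_measure X]pre !lebesgue_measure_itv/= !lte_fin.
  rewrite ltr_pM2l ?invr_gt0// ltrD2r.
  case: ifP => _; last by rewrite mule0.
  rewrite -!EFinD -EFinM; congr EFin; field; lra.
rewrite /nu /nu0 /mscale /= /pushforward muleA -EFinM mulVf ?mul1e//; lra.
Qed.

Lemma lebesgue_measure_affine (al be : R) (B : set (measurableTypeR R)) :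
  al != 0%R -> measurable B ->
  lebesgue_measure [set a | B (al * a + be)%R] =
  (`|al|^-1)%:E * lebesgue_measure B.
Proof.
move=> al0 mB; have [alp|alN] := ltP 0%R al.
  by rewrite lebesgue_measure_affine_gt0// gtr0_norm.
have {alN al0}alN : (al < 0)%R by rewrite lt_neqAle al0.
(* A negative slope is a positive one after the reflection [a -> - a], which preserves the
   measure. *)
rewrite ltr0_norm// -(@lebesgue_measure_affine_gt0 (- al) be) ?oppr_gt0//.
rewrite -[RHS]lebesgue_measureN; last first.
  rewrite -[X in measurable X]setTI.
  have mphi : measurable_fun setT (fun a : R => - al * a + be)%R by apply: measurable_funD.
  exact: mphi.
congr lebesgue_measure; apply/seteqP; split => a /=; rewrite /preimage/=; by rewrite mulrNN.
Qed.

Lemma measurable_row_map n (T : 'rV[R]_n.+1 -> 'rV[R]_n.+1)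
    (T1 : measurableTypeR R * 'rV[R]_n -> measurableTypeR R)
    (T2 : measurableTypeR R * 'rV[R]_n -> 'rV[R]_n) :
  measurable_fun setT T1 -> measurable_fun setT T2 ->
  (forall p, T (row_cons p) = row_cons (T1 p, T2 p)) ->
  measurable_fun setT T.
Proof.
move=> m1 m2 TE; rewrite (_ : T =
  @row_cons R n \o ((fun p => (T1 p, T2 p)) \o @row_uncons R n)).
  apply: measurableT_comp; first exact: measurable_row_cons.
  apply: measurableT_comp; last exact: measurable_row_uncons.
  exact: measurable_fun_pair.
apply/funext => x /=; rewrite -TE; congr T.
rewrite /row_uncons /row_cons /=; apply/rowP => i; case: (@splitP 1 n i) => j ij.
  have -> : i = lshift n j by apply/val_inj.
  rewrite (@row_mxEl _ 1 1 n) mxE; congr (x _ _).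
  by apply/val_inj; rewrite /= ord1.
have -> : i = rshift 1 j by apply/val_inj.
rewrite (@row_mxEr _ 1 1 n) mxE; congr (x _ _).
by apply/val_inj.
Qed.

(** For fixed [y] the first coordinate undergoes an affine map of slope [al], which gives [|al|^-1]
    on each slice whatever the offset [l y]; integrating the slices over [y] gives [c]. *)
Lemma scales_measure_lower n (al c : R) (l : 'rV[R]_n -> R)
    (T' : 'rV[R]_n -> 'rV[R]_n) (T : 'rV[R]_n.+1 -> 'rV[R]_n.+1) :
  al != 0%R -> (0 <= c)%R -> measurable_fun setT l -> scales_measure c T' ->
  (forall a y, T (row_cons (a, y)) = row_cons ((al * a + l y)%R, T' y)) ->
  scales_measure (`|al|^-1 * c)%R T.
Proof.
move=> al0 c0 ml sT' TE.
have mT : measurable_fun setT T.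
  apply: (@measurable_row_map n T (fun p => (al * p.1 + l p.2)%R) (T' \o snd)).
  - apply: measurable_funD; first by apply: measurable_funM => //; exact: measurable_fst.
    by apply: (measurableT_comp ml); exact: measurable_snd.
  - by apply: (measurableT_comp sT'.1); exact: measurable_snd.
  - by move=> [a y]; exact: TE.
split=> // B mB.
have mTB : measurable (T @^-1` B) by rewrite -[X in measurable X]setTI; exact: mT.
have mBy y : measurable [set a : measurableTypeR R | B (row_cons (a, y))].
  have := @measurable_ysection _ _ _ _ _ y (measurable_row_cons_preimage mB).
  by rewrite ysectionE.
rewrite !lebesgue_rV_ysection//.
rewrite (eq_integral (fun y => (`|al|^-1)%:E *
    lebesgue_measure [set a : measurableTypeR R | B (row_cons (a, T' y))])); last first.
  move=> y _; rewrite -(@lebesgue_measure_affine al (l y) _ al0 (mBy _)).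
  by congr lebesgue_measure; apply/seteqP; split => a; rewrite /preimage/= TE.
have mh : measurable_fun setT
    (fun y : 'rV[R]_n => lebesgue_measure [set a : measurableTypeR R | B (row_cons (a, y))]).
  rewrite (_ : (fun y => _) =
    lebesgue_measure \o ysection (@row_cons R n @^-1` B)); last first.
    by apply/funext => y /=; rewrite ysectionE.
  apply: (@measurable_fun_ysection _ _ (measurableTypeR R) _ R lebesgue_measure).
  exact: measurable_row_cons_preimage.
rewrite ge0_integralZl//=.
- rewrite EFinM -muleA; congr (_ * _).
  rewrite -(ge0_integral_scales c0 sT')//.
- by apply: (measurableT_comp mh); exact: sT'.1.
Qed.

Lemma scales_measure_id n : scales_measure 1 (@id 'rV[R]_n).
Proof. by split=> // B mB; rewrite mul1e. Qed.

Lemma row_cons_surj n (x : 'rV[R]_n.+1) : exists a y, x = row_cons (a, y).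
Proof.
exists (x ord0 ord0), (\row_i x ord0 (lift ord0 i)).
apply/rowP => i; case: (@splitP 1 n i) => j ij.
  have -> : i = lshift n j by apply/val_inj.
  rewrite /row_cons (@row_mxEl _ 1 1 n) mxE; congr (x _ _).
  by apply/val_inj; rewrite /= ord1.
have -> : i = rshift 1 j by apply/val_inj.
rewrite /row_cons (@row_mxEr _ 1 1 n) mxE; congr (x _ _).
by apply/val_inj.
Qed.

Lemma row_consD n a b (x y : 'rV[R]_n) :
  (row_cons (a, x) + row_cons (b, y))%R = row_cons ((a + b)%R, (x + y)%R).
Proof.
rewrite /row_cons (@add_row_mx _ 1 1 n); congr (@row_mx _ 1 1 n _ _).
by apply/rowP => i; rewrite !mxE.
Qed.

Lemma scales_measure_translation n (b : 'rV[R]_n) :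
  scales_measure 1 (fun x => x + b)%R.
Proof.
elim: n b => [|n IH] b.
  rewrite (_ : (fun x => _) = id); first exact: scales_measure_id.
  by apply/funext => x; apply/rowP => -[].
have [be [b' ->]] := row_cons_surj b.
rewrite (_ : 1%R = `|1|^-1 * 1)%R; last by rewrite normr1 invr1 mulr1.
apply: (@scales_measure_lower n 1 1 (cst be) (fun y => y + b')%R) => //.
by move=> a y; rewrite row_consD mul1r.
Qed.

(** At a fixed first coordinate the map is a translation, so every slice keeps its measure. *)
Lemma scales_measure_shear n (t : R -> 'rV[R]_n)
    (T : 'rV[R]_n.+1 -> 'rV[R]_n.+1) :
  measurable_fun setT T ->
  (forall a y, T (row_cons (a, y)) = row_cons (a, (y + t a)%R)) ->
  scales_measure 1 T.
Proof.
move=> mT TE; split=> // B mB; rewrite mul1e !lebesgue_rV_xsection.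
apply: eq_integral => a _.
have mBa : measurable [set y | B (row_cons (a, y))].
  have := @measurable_xsection _ _ _ _ _ a (measurable_row_cons_preimage mB).
  by rewrite xsectionE.
have /= := (scales_measure_translation (t a)).2 _ mBa.
rewrite mul1e => <-; congr (lebesgue_rV R n _).
by apply/seteqP; split => y; rewrite /preimage/= TE.
Qed.

Lemma measurable_mulmx n m (A : 'M[R]_(n, m)) :
  measurable_fun setT (fun x : 'rV[R]_n => x *m A)%R.
Proof.
apply: measurable_rVP => j; under eq_fun do rewrite mxE.
apply: measurable_sum => i; apply: measurable_funM => //.
exact: measurable_coord.
Qed.

Lemma measurable_mulmx_entry n m (A : 'M[R]_(n, m)) j :
  measurable_fun setT (fun x : 'rV[R]_n => (x *m A) 0 j)%R.
Proof. by apply: (measurableT_comp (measurable_coord j)); exact: measurable_mulmx. Qed.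

Lemma row_cons_mul_block n (a : R) (y : 'rV[R]_n) (al : 'M[R]_1) b c S :
  (row_cons (a, y) *m (block_mx al b c S : 'M[R]_(1 + n)))%R =
  row_cons ((a * al 0 0 + (y *m c) 0 0)%R, (a *: b + y *m S)%R).
Proof.
rewrite /row_cons /= (@mul_row_block _ 1 1 n 1 n).
have -> : (\row_(_ < 1) a)%R = (a%:M : 'M[R]_1)%R.
  by apply/matrixP => i j; rewrite !mxE !ord1.
rewrite !mul_scalar_mx; congr (@row_mx _ 1 1 n _ _).
by apply/matrixP => i j; rewrite !mxE !ord1.
Qed.

(** Gaussian elimination by induction on the size: a matrix with nonzero corner factors into a block
    triangular map, covered by the induction hypothesis for the Schur complement, and a shear. *)
Lemma scales_measure_mulmx n (A : 'M[R]_n) : A \in unitmx ->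
  scales_measure (`|\det A|^-1)%R (fun x => x *m A)%R.
Proof.
elim: n A => [|n IH] A uA.
  rewrite (_ : (fun x => _) = id); last by apply/funext => x; apply/rowP => -[].
  by rewrite det_mx00 normr1 invr1; exact: scales_measure_id.
have pivot (B : 'M[R]_(1 + n)) : B \in unitmx -> B ord0 ord0 != 0%R ->
    scales_measure (`|\det B|^-1)%R (fun x => x *m B)%R.
  move=> uB B0; rewrite -[B](@submxK _ 1 n 1 n).
  move: uB; rewrite -{1}[B](@submxK _ 1 n 1 n).
  set al := ulsubmx B; set b := ursubmx B; set c := dlsubmx B; set S := drsubmx B.
  have al0 : al ord0 ord0 != 0%R.
    by rewrite !mxE; move: B0; congr (B _ _ != _); apply/val_inj.
  move: {B0} al b c S al0 => al b c S al0.
  (* The Schur complement of the pivot. *)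
  pose S' := (S - (al 0 0)^-1 *: (c *m b))%R.
  have alE : al = ((al 0 0)%:M)%R by apply/matrixP => i j; rewrite !mxE !ord1.
  have BE : (block_mx al b c S = block_mx al 0 c S' *m block_mx 1%:M ((al 0 0)^-1 *: b) 0 1%:M)%R.
    rewrite mulmx_block !mulmx1 !mulmx0 !addr0.
    rewrite -!scalemxAr; congr block_mx.
      by rewrite {2}alE mul_scalar_mx scalerA mulVf// scale1r.
    by rewrite /S' addrC subrK.
  rewrite BE unitmx_mul => /andP[uL _].
  rewrite det_mulmx det_lblock det_ublock !det1 !mulr1.
  have dal : \det al = al 0%R 0%R by rewrite {1}alE det_scalar1.
  have uS : S' \in unitmx.
    by move: uL; rewrite !unitmxE det_lblock dal unitrM => /andP[].
  rewrite normrM dal invfM.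
  rewrite -[X in scales_measure X _]mulr1.
  rewrite (_ : (fun x => _) =
    (fun x => x *m (block_mx 1%:M ((al 0 0)^-1 *: b) 0 1%:M : 'M[R]_(1 + n)))%R \o
    (fun x => x *m (block_mx al 0 c S' : 'M[R]_(1 + n)))%R); last first.
    by apply/funext => x /=; rewrite mulmxA.
  apply: scales_measure_comp.
    apply: (@scales_measure_lower n _ _ (fun y => (y *m c) 0 0)%R (fun y => y *m S')%R) => //.
    - exact: measurable_mulmx_entry.
    - exact: IH.
    - by move=> a y; rewrite row_cons_mul_block scaler0 add0r mulrC.
  apply: (@scales_measure_shear n (fun a => a *: ((al 0 0)^-1 *: b))%R).
    exact: measurable_mulmx.
  by move=> a y; rewrite row_cons_mul_block mulmx0 mulmx1 !mxE eqxx mulr1 addr0 addrC.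
have [A0|] := eqVneq (A ord0 ord0) 0%R; last exact: pivot.
have [j Aj] : exists j, A ord0 j != 0%R.
  apply/existsP; rewrite -[X in is_true X]negbK negb_exists; apply/negP => /forallP h.
  have : \det A = 0%R.
    rewrite (expand_det_row _ ord0) big1// => j _.
    by have := h j; rewrite negbK => /eqP ->; rewrite mul0r.
  by move/eqP; apply/negP; rewrite -unitfE -unitmxE.
case: (@splitP 1 n j) => k jk.
  by move: Aj; rewrite (_ : j = ord0) ?A0 ?eqxx//; apply/val_inj; rewrite /= jk ord1.
have {}jk : j = rshift 1 k by apply/val_inj.
(* Right multiplication by [w s] adds [s] times column [j] to column 0 and has determinant 1. With
   [s = 1] it brings the nonzero entry of row 0 into the corner. *)
pose w s : 'M[R]_(1 + n) := (block_mx 1%:M 0 (s *: delta_mx k 0) 1%:M)%R.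
have wE s l : w s (rshift 1 l) ord0 = (s * (l == k)%:R)%R.
  transitivity (w s (rshift 1 l) (lshift n (ord0 : 'I_1))); last first.
    by rewrite /w (@block_mxEdl _ 1 n 1 n) !mxE eqxx andbT.
  by congr (w s _ _); apply/val_inj.
have dw s : \det (w s) = 1%R by rewrite det_lblock !det1 mulr1.
have ww : (w 1 *m w (-1) = 1%:M)%R.
  rewrite /w mulmx_block !mulmx1 !mulmx0 !mul0mx !mul1mx !addr0 !add0r.
  by rewrite scale1r scaleN1r subrr -scalar_mx_block.
have sw s : scales_measure 1 (fun x => x *m w s)%R.
  rewrite (_ : 1%R = `|1|^-1 * 1)%R; last by rewrite normr1 invr1 mulr1.
  apply: (@scales_measure_lower n 1 1 (fun y => (y *m (s *: delta_mx k 0)) 0 0)%R id) => //.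
  - exact: (@measurable_mulmx_entry n 1 (s *: delta_mx k 0)%R 0%R).
  - exact: scales_measure_id.
  - by move=> a y; rewrite row_cons_mul_block scaler0 add0r mulmx1 !mxE eqxx mulrC.
rewrite (_ : (fun x => _) = (fun x => x *m w (-1))%R \o (fun x => x *m (A *m w 1))%R); last first.
  by apply/funext => x /=; rewrite -!mulmxA ww mulmx1.
rewrite -[X in scales_measure X _]mulr1.
apply: scales_measure_comp => //.
rewrite (_ : \det A = \det (A *m w 1))%R; last by rewrite det_mulmx dw mulr1.
apply: pivot.
  by rewrite unitmx_mul uA unitmxE dw unitr1.
rewrite mxE (bigD1 j)//= big1 => [|i ij]; last first.
  case: (@splitP 1 n i) => l il.
    by rewrite (_ : i = ord0) ?A0 ?mul0r//; apply/val_inj; rewrite /= il ord1.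
  have {}il : i = rshift 1 l by apply/val_inj.
  rewrite il wE; case: eqP => [lk|]; last by rewrite !mulr0.
  by move: ij; rewrite il jk lk eqxx.
rewrite jk wE eqxx mulr1.
by rewrite addr0 mulr1 -jk.
Qed.

Lemma scales_measure_affine n (A : 'M[R]_n) (b : 'rV[R]_n) : A \in unitmx ->
  scales_measure (`|\det A|^-1)%R (fun x => b + x *m A)%R.
Proof.
move=> uA; rewrite -[X in scales_measure X]mulr1.
rewrite (_ : (fun x => _) = (fun x => x + b)%R \o (fun x => x *m A)%R); last first.
  by apply/funext => x; rewrite /= addrC.
apply: scales_measure_comp; first exact: scales_measure_mulmx.
exact: scales_measure_translation.
Qed.

End affine_change_of_variables.

(** * Continuous functions on compact sets *)

Section borel_rV.
Context {R : realType}.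

Lemma measurable_box n (q : 'rV[R]_n) (r : R) :
  measurable [set y : 'rV[R]_n | forall i, `|q ord0 i - y ord0 i| < r].
Proof.
rewrite [X in measurable X](_ : _ = \bigcap_(i in [set: 'I_n])
    ((fun y : 'rV[R]_n => y ord0 i) @^-1` ball (q ord0 i) r)); last first.
  apply/seteqP; split => y /= h; first by move=> i _; exact: h.
  by move=> i; exact: (h i I).
apply: fin_bigcap_measurable => // i _.
rewrite -[X in measurable X]setTI; apply: measurable_coord => //.
exact: measurable_ball.
Qed.

(** Boxes with rational centre and radius [1 / (k + 1)] are countably many, and those contained in
    [U] cover it. *)
Lemma open_measurable_rV n (U : set 'rV[R]_n) : open U -> measurable U.
Proof.
move=> oU.
pose box (p : 'rV[rat]_n * nat) :=
  [set y : 'rV[R]_n | forall i, `|ratr (p.1 ord0 i) - y ord0 i| < p.2.+1%:R^-1].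
have -> : U = \bigcup_p (if `[< box p `<=` U >] then box p else set0).
  apply/seteqP; split => [x Ux|x [p _]]; last by case: asboolP => // pU; exact: pU.
  have [e /= e0 xeU] : exists2 e : R, 0 < e & ball x e `<=` U.
    by have /nbhs_ballP[e /= e0 ?] := open_nbhs_nbhs (conj oU Ux); exists e.
  have e20 : 0 < e / 2 by rewrite divr_gt0.
  (* Half of [e], because the point and an arbitrary point of the box are each within [1 / (k + 1)]
     of the rational centre. *)
  have [k ke] : exists k, k.+1%:R^-1 < e / 2.
    exists (Num.bound (e / 2)^-1).
    rewrite invf_plt ?posrE//.
    apply: lt_trans (archi_boundP _) _; first by rewrite invr_ge0 ltW.
    by rewrite ltr_nat.
  have /choice[q qP] : forall i, exists q : rat, `|ratr q - x ord0 i| < k.+1%:R^-1.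
    move=> i; have : x ord0 i < x ord0 i + k.+1%:R^-1 by rewrite ltrDl invr_gt0.
    move=> /rat_in_itvoo[q]; rewrite in_itv/= => /andP[h1 h2]; exists q.
    have k0 : 0 < k.+1%:R^-1 :> R by rewrite invr_gt0.
    by rewrite ltr_distl h2 andbT; apply: lt_trans h1; rewrite ltrBlDr ltrDl.
  exists (\row_i q i, k) => //; case: asboolP => [_ /= i|]; first by rewrite mxE.
  case=> y /= yb.
  apply: xeU; split=> // i j; rewrite ord1 /ball/=.
  have := yb j; have := qP j; rewrite mxE.
  rewrite -[x ord0 j - y ord0 j](subrKA (ratr (q j))) distrC => h1 h2.
  apply: le_lt_trans (ler_normD _ _) _.
  by rewrite [ltRHS]splitr ltrD// (lt_trans _ ke).
apply: countable_bigcupT_measurable => [|p]; first exact: countableP.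
case: asboolP => // _.
have := @measurable_box n (\row_i ratr (p.1 ord0 i)) p.2.+1%:R^-1.
by congr measurable; apply/seteqP; split => y /= h i; have := h i; rewrite mxE.
Qed.

(** [g] is continuous in the whole space at the points of [D], so within [D] the preimage of an open
    half-line coincides with its interior. *)
Lemma measurable_fun_continuous_rV n (D : set 'rV[R]_n) (g : 'rV[R]_n -> R) :
  (forall x, D x -> {for x, continuous g}) -> measurable_fun D g.
Proof.
move=> cg mD.
apply: (@measurability _ _ _ (measurableTypeR R) _ _ _ (RGenOInfty.measurableE R)) => //.
move=> /= _ [_ [a ->] <-].
rewrite (_ : D `&` _ = D `&` (g @^-1` `]a, +oo[)°).
  by apply: measurableI => //; apply: open_measurable_rV; exact: open_interior.
apply/seteqP; split => x [Dx gx]; split => //; last exact: interior_subset gx.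
apply: cg => //; apply: open_nbhs_nbhs; split => //; exact: interval_open.
Qed.

Lemma closed_measurable_rV n (A : set 'rV[R]_n) : closed A -> measurable A.
Proof.
move=> cA; rewrite -[A]setCK; apply: measurableC; apply: open_measurable_rV.
by rewrite openC.
Qed.

Lemma compact_measurable_rV n (A : set 'rV[R]_n) : compact A -> measurable A.
Proof.
move=> cA; apply: closed_measurable_rV.
exact: (compact_closed (@norm_hausdorff R 'rV[R]_n)).
Qed.

(** Cubes calibrate the measure: large ones show that compact sets have finite measure, a small one
    that the reference simplex has positive measure. *)
Lemma lebesgue_rV_cube n (a b : R) : a <= b ->
  lebesgue_rV R n [set x | forall i, x ord0 i \in `[a, b]] = ((b - a) ^+ n)%:E.
Proof.
move=> ab; elim: n => [|n IH].
  by rewrite /= diracE expr0 mem_set// => -[].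
rewrite exprS EFinM -IH.
have <- : lebesgue_measure (`[a, b]%classic : set (measurableTypeR R)) = (b - a)%:E.
  rewrite lebesgue_measure_itv/= lte_fin; have [//|ba] := ltP a b.
  by rewrite (le_anti (introT andP (conj ab ba))) subrr.
rewrite -lebesgue_rVX//; last first.
  by rewrite [X in measurable X](_ : _ = \bigcap_(i in [set: 'I_n])
    ((fun y : 'rV[R]_n => y ord0 i) @^-1` `[a, b])); [|
  apply/seteqP; split => y /= h; [by move=> i _; exact: h|by move=> i; exact: (h i I)]];
  apply: fin_bigcap_measurable => // i _;
  rewrite -[X in measurable X]setTI; exact: measurable_coord.
congr (lebesgue_rV R n.+1 _); apply/seteqP; split => x /=.
  have [c [y ->]] := row_cons_surj x => h; exists (c, y) => //; split => /=.
    have := h ord0; rewrite /row_cons (_ : ord0 = lshift n (ord0 : 'I_1)) ?(@row_mxEl _ 1 1 n) ?mxE//.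
    by apply/val_inj.
  move=> i; have := h (rshift 1 i).
  by rewrite /row_cons (@row_mxEr _ 1 1 n).
move=> [[c y] [/= cab yab] <-] i; case: (@splitP 1 n i) => j ij.
  have -> : i = lshift n j by apply/val_inj.
  by rewrite /row_cons (@row_mxEl _ 1 1 n) mxE.
have -> : i = rshift 1 j by apply/val_inj.
by rewrite /row_cons (@row_mxEr _ 1 1 n).
Qed.

Lemma coord_le_norm n (x : 'rV[R]_n) i : `|x ord0 i| <= `|x|.
Proof.
rewrite [leRHS]/Num.Def.normr /= mx_normrE.
by apply/bigmax_geP; right => /=; exists (ord0, i).
Qed.

Lemma compact_fin_measure_rV n (A : set 'rV[R]_n) :
  compact A -> (lebesgue_rV R n A < +oo)%E.
Proof.
move=> cA; have mA := compact_measurable_rV cA.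
have [M [Mreal hM]] := compact_bounded cA.
have M1 : `|M| + 1 > M by apply: le_lt_trans (ler_norm M) _; rewrite ltrDl.
have M0 : - (`|M| + 1) <= `|M| + 1.
  by have := normr_ge0 M; lra.
apply: (@le_lt_trans _ _ (lebesgue_rV R n
   [set x | forall i, x ord0 i \in `[- (`|M| + 1), `|M| + 1]])).
  apply: le_measure; rewrite ?inE//.
    rewrite [X in measurable X](_ : _ = \bigcap_(i in [set: 'I_n])
    ((fun y : 'rV[R]_n => y ord0 i) @^-1` `[- (`|M| + 1), `|M| + 1])).
      apply: fin_bigcap_measurable => // i _.
      by rewrite -[X in measurable X]setTI; exact: measurable_coord.
    by apply/seteqP; split => y /= h; [move=> i _; exact: h|move=> i; exact: (h i I)].
  move=> x Ax i; rewrite in_itv/= -ler_norml.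
  exact: le_trans (coord_le_norm _ _) (hM _ M1 _ Ax).
by rewrite lebesgue_rV_cube// ltry.
Qed.

Lemma continuous_bounded_rV n (A : set 'rV[R]_n) (g : 'rV[R]_n -> R) :
  compact A -> (forall x, A x -> {for x, continuous g}) ->
  [bounded g x | x in A].
Proof.
move=> cA cg; have : compact (g @` A).
  apply: continuous_compact => //; apply: continuous_in_subspaceT => x.
  by rewrite inE => /cg.
move/compact_bounded => [M [Mr hM]]; exists M; split => // y My x Ax.
by apply: (hM y My); exists x.
Qed.

Lemma continuous_integrable_rV n (A : set 'rV[R]_n) (g : 'rV[R]_n -> R) :
  compact A -> (forall x, A x -> {for x, continuous g}) ->
  (lebesgue_rV R n).-integrable A (EFin \o g).
Proof.
move=> cA cg; apply: measurable_bounded_integrable.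
- exact: compact_measurable_rV.
- exact: compact_fin_measure_rV.
- exact: measurable_fun_continuous_rV.
- exact: continuous_bounded_rV.
Qed.

End borel_rV.

(** * Continuity and directional derivatives at a point *)

Section pointwise_continuity.
Context {R : realType} {T : topologicalType}.
Implicit Types (f g : T -> R) (x : T).

Lemma continuous_forD f g x : {for x, continuous f} -> {for x, continuous g} ->
  {for x, continuous (fun y => f y + g y)}.
Proof. exact: continuousD. Qed.

Lemma continuous_forB f g x : {for x, continuous f} -> {for x, continuous g} ->
  {for x, continuous (fun y => f y - g y)}.
Proof. exact: continuousB. Qed.

Lemma continuous_forN f x : {for x, continuous f} ->
  {for x, continuous (fun y => - f y)}.
Proof. exact: continuousN. Qed.

Lemma continuous_forM f g x : {for x, continuous f} -> {for x, continuous g} ->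
  {for x, continuous (fun y => f y * g y)}.
Proof. exact: continuousM. Qed.

Lemma continuous_for_cst (a : R) x : {for x, continuous (fun _ : T => a)}.
Proof. exact: cst_continuous. Qed.

Lemma continuous_for_sum (I : Type) (r : seq I) (P : pred I) (F : I -> T -> R) x :
  (forall i, {for x, continuous (F i)}) ->
  {for x, continuous (fun y => \sum_(i <- r | P i) F i y)}.
Proof.
move=> cF; elim: r => [|i r IH].
  rewrite (_ : (fun y => _) = fun=> 0); first exact: continuous_for_cst.
  by apply/funext => y; rewrite big_nil.
rewrite (_ : (fun y => _) = fun y => (if P i then F i y else 0) +
    \sum_(j <- r | P j) F j y).
  apply: continuous_forD => //; case: (P i) => //; exact: continuous_for_cst.
by apply/funext => y; rewrite big_cons; case: (P i) => //; rewrite add0r.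
Qed.

End pointwise_continuity.

Lemma continuous_for_comp (T U W : topologicalType) (f : T -> U) (g : U -> W) x :
  {for x, continuous f} -> {for f x, continuous g} ->
  {for x, continuous (fun y => g (f y))}.
Proof. exact: continuous_comp. Qed.

Section affine_calculus.
Context {R : realType}.

Lemma differentiable_rV (V : normedModType R) n (f : V -> 'rV[R]_n) x :
  (forall j, differentiable (fun y => f y ord0 j) x) -> differentiable f x.
Proof.
move=> df.
rewrite (_ : f = \sum_(j < n) (fun y => f y ord0 j *: (delta_mx ord0 j : 'rV[R]_n))).
  by apply: differentiable_sum => j; exact: differentiableZl.
by apply/funext => y; rewrite [LHS]row_sum_delta fct_sumE.
Qed.

Lemma differentiable_rV_coord (V : normedModType R) n (f : V -> 'rV[R]_n) x j :
  differentiable f x -> differentiable (fun y => f y ord0 j) x.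
Proof.
move=> df; apply: (differentiable_comp (g := fun N : 'rV[R]_n => N ord0 j)) => //.
exact: differentiable_coord.
Qed.

Lemma differentiable_mulmx n m (A : 'M[R]_(n, m)) x :
  differentiable (fun y : 'rV[R]_n => y *m A) x.
Proof.
apply: differentiable_rV => j.
rewrite (_ : (fun y => _) = \sum_(i < n) (fun y : 'rV[R]_n => y ord0 i * A i j)).
  apply: differentiable_sum => i; apply: differentiableM => //.
  exact: differentiable_coord.
by apply/funext => y; rewrite mxE fct_sumE.
Qed.

Lemma differentiable_affine n m (b : 'rV[R]_m) (A : 'M[R]_(n, m)) x :
  differentiable (fun y : 'rV[R]_n => b + y *m A) x.
Proof.
by apply: differentiableD => //; exact: differentiable_mulmx.
Qed.

Lemma continuous_affine n m (b : 'rV[R]_m) (A : 'M[R]_(n, m)) :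
  continuous (fun y : 'rV[R]_n => b + y *m A).
Proof.
by move=> x; apply: differentiable_continuous; exact: differentiable_affine.
Qed.

(** The two difference quotients coincide as functions, since the increment enters the affine map
    linearly. *)
Lemma derive_comp_affine n m (W : normedModType R) (b : 'rV[R]_m)
    (A : 'M[R]_(n, m)) (g : 'rV[R]_m -> W) v :
  'D_v (fun y : 'rV[R]_n => g (b + y *m A)) = (fun x => 'D_(v *m A) g (b + x *m A)).
Proof.
apply/funext => x; rewrite /derive.
rewrite (_ : (fun h : R => h^-1 *: (((fun y => g (b + y *m A)) \o shift x) (h *: v) - _)) =
  (fun h : R => h^-1 *: ((g \o shift (b + x *m A)) (h *: (v *m A)) - g (b + x *m A))))//.
by apply/funext => h /=; rewrite mulmxDl -scalemxAl addrCA.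
Qed.

Lemma derive_pderiv n (g : 'rV[R]_n -> R) x v : differentiable g x ->
  'D_v g x = \sum_i v ord0 i * pderiv i g x.
Proof.
move=> dg; rewrite deriveE// [in LHS](row_sum_delta v) linear_sum.
by apply: eq_bigr => i _; rewrite linearZ /pderiv deriveE.
Qed.

Lemma pderiv_coord n m (f : 'rV[R]_n -> 'rV[R]_m) i x j : differentiable f x ->
  pderiv i f x ord0 j = pderiv i (fun y => f y ord0 j) x.
Proof.
by move=> df; rewrite /pderiv derive_mx ?mxE//; exact: diff_derivable.
Qed.

End affine_calculus.

(** * The reference simplex *)

Section reference_simplex.
Context {R : realType}.

(** Barycentric coordinates on the reference simplex: index [ord0] belongs to the origin,
    [lift ord0 i] to the unit vector [i]. *)
Definition bary m (s : 'rV[R]_m) (j : 'I_m.+1) : R :=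
  if unlift ord0 j is Some i then s ord0 i else 1 - \sum_i s ord0 i.

Lemma bary0 m (s : 'rV[R]_m) : bary s ord0 = 1 - \sum_i s ord0 i.
Proof. by rewrite /bary unlift_none. Qed.

Lemma bary_lift m (s : 'rV[R]_m) i : bary s (lift ord0 i) = s ord0 i.
Proof. by rewrite /bary liftK. Qed.

Lemma sum_bary m (s : 'rV[R]_m) : \sum_j bary s j = 1.
Proof.
rewrite big_ord_recl; under eq_bigr do rewrite bary_lift.
by rewrite bary0 subrK.
Qed.

Lemma bary_inj m (s t : 'rV[R]_m) : bary s =1 bary t -> s = t.
Proof. by move=> st; apply/rowP => i; rewrite -!bary_lift st. Qed.

Lemma ref_simplexP m (s : 'rV[R]_m) :
  ref_simplex s <-> forall j, 0 <= bary s j.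
Proof.
split=> [[s0 s1] j|h].
  by rewrite /bary; case: unliftP => [i _|_] //; rewrite subr_ge0.
split=> [i|]; first by rewrite -bary_lift.
by rewrite -subr_ge0 -bary0.
Qed.

Lemma bary_le1 m (s : 'rV[R]_m) j : ref_simplex s -> bary s j <= 1.
Proof.
move=> /ref_simplexP h; rewrite -(sum_bary s) (bigD1 j)//= lerDl.
by apply: sumr_ge0.
Qed.

(** [bary _ j] is affine with value [(j == ord0)%:R] at the origin; subtracting it from the values
    at the rows of [M] leaves the linear part. *)
Lemma bary_affine m (s : 'rV[R]_m) (b : 'rV[R]_m) (M : 'M[R]_m) j :
  bary (b + s *m M) j =
  bary b j + \sum_i s ord0 i * (bary (row i M) j - (j == ord0)%:R).
Proof.
rewrite /bary; case: unliftP => [k ->|->].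
  rewrite !mxE; congr (_ + _); apply: eq_bigr => i _.
  by rewrite !mxE subr0.
rewrite -addrA; congr (_ + _).
under eq_bigr do rewrite mxE.
rewrite big_split/= opprD; congr (_ + _).
under [in LHS]eq_bigr do rewrite mxE.
rewrite exchange_big/= -sumrN; apply: eq_bigr => i _.
rewrite addrAC subrr add0r mulrN -mulr_sumr; congr (- (_ * _)).
by apply: eq_bigr => k _; rewrite mxE.
Qed.

Lemma simplex_paramE m n (q : 'I_m.+1 -> 'rV[R]_n) s :
  simplex_param q s = \sum_j bary s j *: q j.
Proof.
rewrite big_ord_recl bary0 scalerBl scale1r /simplex_param -addrA; congr (_ + _).
rewrite scaler_suml -sumrN mulmx_sum_row -big_split/=; apply: eq_bigr => i _.
by rewrite bary_lift rowK scalerBr addrC.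
Qed.

Lemma big_setT (V : nmodType) (I : finType) (F : I -> V) :
  \sum_(i in [set: I]%SET) F i = \sum_i F i.
Proof. by apply: eq_bigl => i; rewrite finset.in_setT. Qed.

Lemma simplex_param_image m n (p : 'I_m.+1 -> 'rV[R]_n) :
  simplex p = simplex_param p @` ref_simplex (m := m).
Proof.
apply/seteqP; split=> [x [c [c0 c1 ->]]|_ [s /ref_simplexP s0 <-]]; last first.
  exists (bary s); split => //; rewrite big_setT.
    exact: sum_bary.
  exact: simplex_paramE.
have sE : bary (\row_i c (lift ord0 i)) =1 c.
  move=> j; rewrite /bary; case: unliftP => [i ->|->]; first by rewrite mxE.
  under eq_bigr do rewrite mxE.
  by rewrite -c1 big_setT big_ord_recl addrK.
exists (\row_i c (lift ord0 i)).
  by apply/ref_simplexP => j; rewrite sE.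
by rewrite simplex_paramE big_setT; apply: eq_bigr => j _; rewrite sE.
Qed.

Lemma ref_simplex_sub_cube m (s : 'rV[R]_m) i : ref_simplex s -> 0 <= s ord0 i <= 1.
Proof.
move=> rs; have /ref_simplexP/(_ (lift ord0 i)) := rs; rewrite bary_lift => ->.
by have := bary_le1 (lift ord0 i) rs; rewrite bary_lift.
Qed.

Lemma continuous_bary m (j : 'I_m.+1) : continuous (fun s : 'rV[R]_m => bary s j).
Proof.
move=> x; rewrite /bary; case: unliftP => [i _|_]; first exact: coord_continuous.
apply: continuous_forB; first exact: continuous_for_cst.
by apply: continuous_for_sum => i; exact: coord_continuous.
Qed.

Lemma ref_simplex_compact m : compact (ref_simplex (R := R) (m := m)).
Proof.
apply: bounded_closed_compact.
  exists 1; split => // M M1 s rs; apply: le_trans (ltW M1).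
  rewrite [leLHS]/Num.Def.normr /= mx_normrE; apply/bigmax_leP; split => //.
  move=> [i j] _ /=; rewrite (ord1 i).
  by have /andP[s0 s1] := ref_simplex_sub_cube j rs; rewrite ger0_norm.
rewrite (_ : ref_simplex (m := m) = \bigcap_(j in [set: 'I_m.+1])
    ((fun s => bary s j) @^-1` [set x | 0 <= x])).
  apply: closed_bigI => j _; apply: closed_comp => [x _|].
    exact: continuous_bary.
  exact: closed_ge.
apply/seteqP; split => s /= => [/ref_simplexP h j _|h]; first exact: h.
by apply/ref_simplexP => j; exact: h.
Qed.

(** The cube of side [1 / (m + 1)] lies in the reference simplex. *)
Lemma vol_ref_simplex_gt0 m : 0 < fine (lebesgue_rV R m (ref_simplex (m := m))).
Proof.
have h : (((m.+1%:R^-1 : R) ^+ m)%:E <= lebesgue_rV R m (ref_simplex (m := m)))%E.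
  rewrite -[X in X ^+ m]subr0 -lebesgue_rV_cube ?invr_ge0//.
  apply: le_measure; rewrite ?inE.
  - rewrite [X in measurable X](_ : _ = \bigcap_(i in [set: 'I_m])
    ((fun y : 'rV[R]_m => y ord0 i) @^-1` `[0, m.+1%:R^-1])).
      apply: fin_bigcap_measurable => // i _.
      by rewrite -[X in measurable X]setTI; exact: measurable_coord.
    by apply/seteqP; split => y /= h; [move=> i _; exact: h|move=> i; exact: (h i I)].
  - by apply: compact_measurable_rV; exact: ref_simplex_compact.
  - move=> s /= sc; split => [i|]; first by have := sc i; rewrite in_itv/= => /andP[].
    apply: (@le_trans _ _ (\sum_(i < m) m.+1%:R^-1)).
      by apply: ler_sum => i _; have := sc i; rewrite in_itv/= => /andP[].
    rewrite sumr_const card_ord -[leLHS]mulr_natr mulrC ler_pdivrMr//.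
    by rewrite mul1r ler_nat.
rewrite -lte_fin fineK; last first.
  by rewrite ge0_fin_numE// compact_fin_measure_rV//; exact: ref_simplex_compact.
by apply: lt_le_trans h; rewrite lte_fin exprn_gt0// invr_gt0.
Qed.

(** Positive and negative parts are scaled separately. Integrability keeps both finite, so that
    [fine] commutes with their difference. *)
Lemma vol_int_scales n (c : R) (T : 'rV[R]_n -> 'rV[R]_n) (D : set 'rV[R]_n)
    (g : 'rV[R]_n -> R) :
  0 <= c -> scales_measure c T -> measurable D ->
  (lebesgue_rV R n).-integrable D (EFin \o g) ->
  vol_int (T @^-1` D) (g \o T) = c * vol_int D g.
Proof.
move=> c0 sT mD ig; have mg := measurable_int _ ig.
rewrite /vol_int /Rintegral.
rewrite [X in fine X]integralE [X in _ * fine X]integralE.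
have E (h : 'rV[R]_n -> \bar R) : measurable_fun D h -> (forall x, 0 <= h x)%E ->
    (\int[lebesgue_rV R n]_(x in T @^-1` D) h (T x) =
     c%:E * \int[lebesgue_rV R n]_(x in D) h x)%E.
  by move=> mh h0; apply: ge0_integral_scales => //.
have Ep := E (EFin \o g)^\+%E (measurable_funepos mg) (fun=> funepos_ge0 _ _).
have En := E (EFin \o g)^\-%E (measurable_funeneg mg) (fun=> funeneg_ge0 _ _).
have fp := integrable_fin_num mD (integrable_funepos mD ig).
have fn := integrable_fin_num mD (integrable_funeneg mD ig).
transitivity (fine (c%:E * \int[lebesgue_rV R n]_(x in D) (EFin \o g)^\+ x -
                    c%:E * \int[lebesgue_rV R n]_(x in D) (EFin \o g)^\- x)%E).
  rewrite -Ep -En; congr (fine (_ - _)%E); apply: eq_integral => x _.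
    by rewrite !funeposE.
  by rewrite !funenegE.
by rewrite -muleBr ?fin_num_adde_defl ?fin_numN// fineM// fin_numB fp fn.
Qed.

(** The affine self-map of the reference simplex that sends vertex [k] to vertex [pi k]; hence the
    inverse permutation on coordinates. *)
Definition bary_perm m (pi : 'S_m.+1) (s : 'rV[R]_m) : 'rV[R]_m :=
  \row_i bary s ((pi^-1)%g (lift ord0 i)).

Lemma bary_bary_perm m (pi : 'S_m.+1) (s : 'rV[R]_m) j :
  bary (bary_perm pi s) j = bary s ((pi^-1)%g j).
Proof.
rewrite {1}/bary; case: unliftP => [i ->|->]; first by rewrite mxE.
under eq_bigr do rewrite mxE.
have := sum_bary s; rewrite (reindex_inj (@perm_inj _ pi^-1%g))/= big_ord_recl.
by move=> <-; rewrite addrK.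
Qed.

Lemma bary_permK m (pi : 'S_m.+1) : cancel (@bary_perm m pi) (bary_perm pi^-1).
Proof.
by move=> s; apply: bary_inj => j; rewrite !bary_bary_perm invgK permK.
Qed.

Lemma simplex_param_perm m n (q : 'I_m.+1 -> 'rV[R]_n) (pi : 'S_m.+1) s :
  simplex_param (q \o pi) s = simplex_param q (bary_perm pi s).
Proof.
rewrite !simplex_paramE (reindex_inj (@perm_inj _ pi^-1%g))/=.
by apply: eq_bigr => j _; rewrite bary_bary_perm permKV.
Qed.

Lemma ref_simplex_bary_perm m (pi : 'S_m.+1) :
  @bary_perm m pi @^-1` ref_simplex (m := m) = ref_simplex (m := m).
Proof.
apply/seteqP; split => s /=.
  move=> /ref_simplexP h; apply/ref_simplexP => j.
  by have := h (pi j); rewrite bary_bary_perm permK.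
by move=> /ref_simplexP h; apply/ref_simplexP => j; rewrite bary_bary_perm.
Qed.

(** The matrix is read off from the images of the unit vectors, and the matrix of the inverse
    permutation inverts it. *)
Lemma bary_perm_affine m (pi : 'S_m.+1) : exists2 M : 'M[R]_m,
  M \in unitmx & forall s, bary_perm pi s = bary_perm pi 0 + s *m M.
Proof.
pose M (p : 'S_m.+1) : 'M[R]_m := \matrix_i (bary_perm p (delta_mx ord0 i) - bary_perm p 0).
have ME p s : bary_perm p s = bary_perm p 0 + s *m M p.
  apply/rowP => i; rewrite !mxE; set j := (p^-1)%g (lift ord0 i).
  have -> : bary s j = bary (0 + s *m 1%:M) j by rewrite mulmx1 add0r.
  rewrite bary_affine; congr (_ + _).
  apply: eq_bigr => k _; rewrite /M !mxE -/j; congr (_ * (bary _ _ - _)).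
    by rewrite rowE mulmx1.
  rewrite /bary; case: unliftP => [l ->|->]; first by rewrite mxE.
  by rewrite big1 ?subr0// => l _; rewrite mxE.
exists (M pi); last exact: ME.
suff /mulmx1_unit[] : M pi *m M pi^-1%g = 1%:M by [].
apply/row_matrixP => i; rewrite !rowE mulmx1 mulmxA.
have E s : s = bary_perm pi^-1%g 0 + (bary_perm pi 0 + s *m M pi) *m M pi^-1%g.
  by rewrite -ME -ME bary_permK.
have E0 := E 0; rewrite mul0mx addr0 in E0.
by rewrite [RHS]E mulmxDl addrA -E0 add0r.
Qed.

(* A bary_perm maps the reference simplex onto itself, hence preserves volume. *)
Lemma bary_perm_affine_det m (pi : 'S_m.+1) : exists2 M : 'M[R]_m,
  `|\det M| = 1 & forall s, bary_perm pi s = bary_perm pi 0 + s *m M.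
Proof.
have [M uM ME] := bary_perm_affine pi; exists M => //.
have sT : scales_measure `|\det M|^-1 (@bary_perm m pi).
  rewrite (_ : @bary_perm m pi = fun x => bary_perm pi 0 + x *m M); last exact/funext.
  exact: scales_measure_affine.
apply: invr_inj; rewrite invr1.
have := sT.2 _ (compact_measurable_rV (@ref_simplex_compact m)).
rewrite ref_simplex_bary_perm => /(congr1 fine).
rewrite fineM//; last first.
  by rewrite ge0_fin_numE// compact_fin_measure_rV//; exact: ref_simplex_compact.
rewrite -[LHS]mul1r => /mulIf h; apply/esym/h.
by rewrite gt_eqF// vol_ref_simplex_gt0.
Qed.

Lemma scales_measure_bary_perm m (pi : 'S_m.+1) : scales_measure 1 (@bary_perm m pi).
Proof.
have [M M1 ME] := bary_perm_affine_det pi.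
rewrite (_ : @bary_perm m pi = fun x => bary_perm pi 0 + x *m M); last exact/funext.
rewrite -invr1 -M1; apply: scales_measure_affine.
by rewrite unitmxE unitfE -normr_eq0 M1 oner_neq0.
Qed.

(** Renumbering the vertices amounts to composing with a volume-preserving self-map of the reference
    simplex. *)
Lemma vol_int_param_perm m n (q : 'I_m.+1 -> 'rV[R]_n) (pi : 'S_m.+1) g :
  (lebesgue_rV R m).-integrable (ref_simplex (m := m)) (EFin \o (g \o simplex_param q)) ->
  vol_int (ref_simplex (m := m)) (g \o simplex_param (q \o pi)) =
  vol_int (ref_simplex (m := m)) (g \o simplex_param q).
Proof.
move=> ig.
have mref := compact_measurable_rV (@ref_simplex_compact m).
have := vol_int_scales ler01 (scales_measure_bary_perm pi) mref ig.
rewrite ref_simplex_bary_perm mul1r => <-; apply: eq_Rintegral => s _.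
by rewrite /comp simplex_param_perm.
Qed.

End reference_simplex.

Section lines.
Context {R : realType} {V W : normedModType R}.

(** On a line the one-variable difference quotient is the directional one, so derivability and
    derivatives transfer together. *)
Lemma line_quotient (g : V -> W) (x v : V) (t : R) :
  (fun h : R => h^-1 *: (((fun s : R => g (x + s *: v)) \o shift t) (h *: 1) - g (x + t *: v))) =
  (fun h : R => h^-1 *: ((g \o shift (x + t *: v)) (h *: v) - g (x + t *: v))).
Proof.
apply/funext => h /=; congr (_ *: (g _ - _)).
by rewrite scalerDl addrCA /GRing.scale /= mulr1.
Qed.

Lemma derive_line (g : V -> W) (x v : V) (t : R) :
  'D_1 (fun s : R => g (x + s *: v)) t = 'D_v g (x + t *: v).
Proof. by rewrite /derive line_quotient. Qed.

Lemma derivable_line (g : V -> W) (x v : V) (t : R) :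
  derivable g (x + t *: v) v -> derivable (fun s : R => g (x + s *: v)) t 1.
Proof. by rewrite /derivable line_quotient. Qed.

Lemma continuous_line (x v : V) : continuous (fun s : R => x + s *: v).
Proof.
move=> s; apply: cvgD; first exact: cvg_cst.
by apply: cvgZr_tmp; exact: cvg_id.
Qed.

End lines.

(** * Gauss' theorem on a simplex *)

Section gauss_reference.
Context {R : realType}.

(** The first coordinate is integrated innermost, because the fundamental theorem of calculus is to
    be applied along it. *)
Lemma integral_rV_fubini n (D : set 'rV[R]_n.+1) (h : 'rV[R]_n.+1 -> R) :
  measurable D -> (lebesgue_rV R n.+1).-integrable D (EFin \o h) ->
  (\int[lebesgue_rV R n.+1]_(x in D) (h x)%:E =
   \int[lebesgue_rV R n]_y \int[lebesgue_measure]_a ((h \_ D) (row_cons (a, y)))%:E)%E.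
Proof.
move=> mD ih.
have := ih; rewrite (integrable_mkcond _ mD) => ihD.
have mhD : measurable_fun setT ((EFin \o h) \_ D) by exact: measurable_int ihD.
have rE x : ((EFin \o h) \_ D) x = ((h \_ D) x)%:E.
  by rewrite /patch; case: ifP.
have mrc := @measurable_row_cons R n.
have mcomp : measurable_fun setT (((EFin \o h) \_ D) \o @row_cons R n).
  exact: measurableT_comp.
have icomp : (@lebesgue_measure R \x lebesgue_rV R n)%E.-integrable setT
    (((EFin \o h) \_ D) \o @row_cons R n).
  apply/integrableP; split => //.
  move/integrableP : ihD => [_]; rewrite /= /lebesgue_step.
  rewrite (ge0_integral_pushforward mrc)//.
  exact: measurableT_comp.
rewrite integral_mkcond.
transitivity (\int[@lebesgue_measure R \x lebesgue_rV R n]_z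
    (((EFin \o h) \_ D) \o @row_cons R n) z)%E.
  rewrite /= /lebesgue_step (integral_pushforward mrc)//.
rewrite -integral21_prod_meas1//.
apply: eq_integral => y _; apply: eq_integral => a _.
by rewrite -rE.
Qed.

Lemma row_cons0 n (a : R) (y : 'rV[R]_n) : row_cons (a, y) ord0 ord0 = a.
Proof.
rewrite /row_cons (_ : (ord0 : 'I_n.+1) = lshift n (ord0 : 'I_1)); last exact/val_inj.
by rewrite (@row_mxEl _ 1 1 n) mxE.
Qed.

Lemma row_cons_lift n (a : R) (y : 'rV[R]_n) i :
  row_cons (a, y) ord0 (lift ord0 i) = y ord0 i.
Proof.
rewrite /row_cons (_ : lift ord0 i = rshift 1 i); last exact/val_inj.
by rewrite (@row_mxEr _ 1 1 n).
Qed.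

Lemma row_cons_eqP n (a : R) (y : 'rV[R]_n) (x : 'rV[R]_n.+1) :
  x ord0 ord0 = a -> (forall i, x ord0 (lift ord0 i) = y ord0 i) ->
  x = row_cons (a, y).
Proof.
move=> xa xy; apply/rowP => i; case: (unliftP ord0 i) => [j ->|->].
  by rewrite row_cons_lift.
by rewrite row_cons0.
Qed.

Lemma row_cons_line n (a : R) (y : 'rV[R]_n) :
  row_cons (a, y) = row_cons (0, y) + a *: delta_mx ord0 ord0.
Proof.
apply/esym/row_cons_eqP => [|i]; rewrite mxE ?row_cons0 ?row_cons_lift !mxE.
  by rewrite eqxx add0r mulr1.
by rewrite mulr0 addr0.
Qed.

Lemma ref_simplex_row_cons n (a : R) (y : 'rV[R]_n) :
  ref_simplex (row_cons (a, y)) <-> ref_simplex y /\ 0 <= a <= 1 - \sum_i y ord0 i.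
Proof.
have E : \sum_i row_cons (a, y) ord0 i = a + \sum_i y ord0 i.
  rewrite big_ord_recl row_cons0; congr (_ + _).
  by apply: eq_bigr => i _; rewrite row_cons_lift.
rewrite /ref_simplex /= E.
split=> [[h s1]|[[h s1] /andP[a0 a1]]].
  have a0 : 0 <= a by have := h ord0; rewrite row_cons0.
  have h' i : 0 <= y ord0 i by have := h (lift ord0 i); rewrite row_cons_lift.
  by split; [split=> //; lra|apply/andP; split=> //; lra].
split; last lra.
move=> i; case: (unliftP ord0 i) => [j ->|->].
  by rewrite row_cons_lift.
by rewrite row_cons0.
Qed.

Definition ref_vertex m (j : 'I_m.+1) : 'rV[R]_m :=
  if unlift ord0 j is Some i then delta_mx ord0 i else 0.

(** The upper end of the fibre over [y] lies on the oblique face, opposite to the origin. *)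
Lemma facet_ref_vertex0 n (y : 'rV[R]_n) :
  row_cons (1 - \sum_i y ord0 i, y) = simplex_param (facet (@ref_vertex n.+1) ord0) y.
Proof.
have E k : simplex_param (facet (@ref_vertex n.+1) ord0) y ord0 k = bary y k.
  rewrite simplex_paramE summxE (bigD1 k)//= big1 ?addr0 => [|j jk];
    rewrite mxE /facet /= /ref_vertex liftK mxE eqxx/= ?eqxx ?mulr1//.
  by rewrite eq_sym (negbTE jk) mulr0.
by apply/esym/row_cons_eqP => [|i]; rewrite E ?bary0 ?bary_lift.
Qed.

(** The lower end of the fibre over [y] lies on a coordinate face, opposite to the first unit
    vector. *)
Lemma facet_ref_vertex1 n (y : 'rV[R]_n) :
  row_cons (0, y) = simplex_param (facet (@ref_vertex n.+1) (lift ord0 ord0)) y.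
Proof.
have l0 : lift (lift ord0 ord0 : 'I_n.+2) (ord0 : 'I_n.+1) = ord0 by exact/val_inj.
have lS (i : 'I_n) : lift (lift ord0 ord0 : 'I_n.+2) (lift ord0 i) = lift ord0 (lift ord0 i).
  exact/val_inj.
have E k : simplex_param (facet (@ref_vertex n.+1) (lift ord0 ord0)) y ord0 k =
    \sum_(i < n) y ord0 i * (k == lift ord0 i)%:R.
  rewrite simplex_paramE summxE big_ord_recl mxE /facet /= l0.
  rewrite {1}/ref_vertex unlift_none mxE mulr0 add0r; apply: eq_bigr => i _.
  by rewrite mxE /= bary_lift lS /ref_vertex liftK mxE eqxx.
apply/esym/row_cons_eqP => [|i]; rewrite E.
  by rewrite big1// => i _; rewrite mulr0.
rewrite (bigD1 i)//= eqxx mulr1 big1 ?addr0// => j ji.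
by rewrite (inj_eq lift_inj) eq_sym (negbTE ji) mulr0.
Qed.

Lemma integral_derive_line n (g : 'rV[R]_n.+1 -> R) (y : 'rV[R]_n) (L : R) :
  0 <= L ->
  (forall a, 0 <= a <= L -> differentiable g (row_cons (a, y)) /\
     {for row_cons (a, y), continuous (pderiv ord0 g)}) ->
  (\int[lebesgue_measure]_(a in `[0%R, L]) (pderiv ord0 g (row_cons (a, y)))%:E =
   (g (row_cons (L, y)) - g (row_cons (0, y)))%:E)%E.
Proof.
(* For [L = 0] the fibre is a single point, which the fundamental theorem on a proper interval does
   not cover. *)
rewrite le_eqVlt => /predU1P[<- _|L0 dg].
  by rewrite set_itv1 integral_set1 subrr.
pose F a := g (row_cons (0, y) + a *: delta_mx ord0 ord0).
have FE a : F a = g (row_cons (a, y)) by rewrite /F -row_cons_line.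
have cF a : 0 <= a <= L -> {for a, continuous F}.
  move=> aL.
  apply: (@continuous_for_comp _ _ _ (fun a : R => row_cons (0, y) + a *: delta_mx ord0 ord0) g).
    exact: continuous_line.
  apply: differentiable_continuous; rewrite -row_cons_line.
  by have [] := dg a aL.
rewrite -FE -(FE 0) EFinB; apply: continuous_FTC2 => //.
- apply: continuous_in_subspaceT => a; rewrite inE/= in_itv/= => aL.
  apply: (@continuous_for_comp _ _ _ (fun a : R => row_cons (a, y)) (pderiv ord0 g)).
    rewrite (_ : (fun a => _) = fun a => row_cons (0, y) + a *: delta_mx ord0 ord0).
      exact: continuous_line.
    by apply/funext => b; rewrite -row_cons_line.
  by have [] := dg a aL.
- split.
  + move=> a; rewrite in_itv/= => /andP[a0 aL].
    apply: derivable_line; rewrite -row_cons_line.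
    apply: diff_derivable.
    by have [] := dg a; first by rewrite !ltW.
  + apply: cvg_at_right_filter; apply: cF; rewrite lexx ltW//.
  + apply: cvg_at_left_filter; apply: cF; rewrite lexx ltW//.
- move=> a; rewrite in_itv/= => /andP[a0 aL].
  by rewrite derive1E derive_line -row_cons_line.
Qed.

(** Fubini and the fundamental theorem along the first coordinate. Both end faces are parametrized
    by the same [y], so no area element appears; [surface_normal] restores it later. *)
Lemma gauss_ref_simplex0 n (g : 'rV[R]_n.+1 -> R) :
  C1_on (ref_simplex (m := n.+1)) g ->
  vol_int (ref_simplex (m := n.+1)) (pderiv ord0 g) =
  vol_int (ref_simplex (m := n)) (g \o simplex_param (facet (@ref_vertex n.+1) ord0)) -
  vol_int (ref_simplex (m := n)) (g \o simplex_param (facet (@ref_vertex n.+1) (lift ord0 ord0))).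
Proof.
move=> dg.
have mref k := compact_measurable_rV (@ref_simplex_compact R k).
have face j y : ref_simplex y -> ref_simplex (simplex_param (facet (@ref_vertex n.+1) j) y) ->
    {for y, continuous (g \o simplex_param (facet (@ref_vertex n.+1) j))}.
  move=> ry rx; apply: continuous_for_comp; first exact: continuous_affine.
  by apply: differentiable_continuous; have [] := dg _ rx.
have f0 y : ref_simplex y -> ref_simplex (simplex_param (facet (@ref_vertex n.+1) ord0) y).
  move=> ry; rewrite -facet_ref_vertex0; apply/ref_simplex_row_cons; split=> //.
  by rewrite lexx andbT; case: ry => _; rewrite subr_ge0.
have f1 y : ref_simplex y -> ref_simplex (simplex_param (facet (@ref_vertex n.+1) (lift ord0 ord0)) y).
  move=> ry; rewrite -facet_ref_vertex1; apply/ref_simplex_row_cons; split=> //.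
  by rewrite lexx; case: ry => _; rewrite subr_ge0.
rewrite -RintegralB; last 3 first.
- exact: mref.
- apply: continuous_integrable_rV; first exact: ref_simplex_compact.
  by move=> y ry; apply: face => //; exact: f0.
- apply: continuous_integrable_rV; first exact: ref_simplex_compact.
  by move=> y ry; apply: face => //; exact: f1.
congr fine; rewrite integral_rV_fubini//; last first.
  apply: continuous_integrable_rV; first exact: ref_simplex_compact.
  by move=> x rx; have [_] := dg _ rx; exact.
rewrite [RHS]integral_mkcond; apply: eq_integral => y _.
rewrite /patch; case: ifPn => [/set_mem ry|/negP ry].
  rewrite /= -facet_ref_vertex0 -facet_ref_vertex1.
  rewrite -integral_derive_line; last 2 first.
  - by case: ry => _; rewrite subr_ge0.
  - move=> a aL; have [//|dga cga] := dg (row_cons (a, y)); last by split=> //; exact: cga.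
    by apply/ref_simplex_row_cons.
  rewrite [RHS]integral_mkcond; apply: eq_integral => a _; rewrite /patch.
  have -> : (row_cons (a, y) \in ref_simplex (m := n.+1)) =
            (a \in `[0, 1 - \sum_i y ord0 i]%classic).
    apply/idP/idP; rewrite !inE => /=.
      by move=> /ref_simplex_row_cons[_]; rewrite in_itv.
    by rewrite in_itv /= => aL; apply/ref_simplex_row_cons.
  by case: ifP.
apply: integral0_eq => a _; case: ifPn => // /set_mem /ref_simplex_row_cons[ry' _].
by case: ry; apply/mem_set.
Qed.

End gauss_reference.

Section gauss_simplex.
Context {R : realType}.

Lemma simplex_param_comp m n k (p : 'I_m.+1 -> 'rV[R]_n) (q : 'I_k.+1 -> 'rV[R]_m) s :
  simplex_param p (simplex_param q s) = simplex_param (simplex_param p \o q) s.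
Proof.
rewrite [RHS]simplex_paramE /= /simplex_param; under [RHS]eq_bigr do rewrite scalerDr.
rewrite big_split/= -scaler_suml sum_bary scale1r; congr (_ + _).
rewrite -/(simplex_param q s) simplex_paramE mulmx_suml.
by apply: eq_bigr => j _; rewrite scalemxAl.
Qed.

Lemma simplex_param_vertex m n (p : 'I_m.+1 -> 'rV[R]_n) j :
  simplex_param p (ref_vertex j) = p j.
Proof.
rewrite /simplex_param /ref_vertex; case: unliftP => [i ->|->].
  by rewrite -rowE rowK addrC subrK.
by rewrite mul0mx addr0.
Qed.

Lemma simplex_param_facet m n (p : 'I_m.+2 -> 'rV[R]_n) j s :
  simplex_param (facet p j) s = simplex_param p (simplex_param (facet (@ref_vertex R m.+1) j) s).
Proof.
rewrite simplex_param_comp; congr (simplex_param _ s).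
by apply/funext => i; rewrite /facet /= simplex_param_vertex.
Qed.

Lemma bary_conv m (c : 'I_m.+1 -> R) : \sum_k c k = 1 ->
  bary (\sum_k c k *: @ref_vertex R m k) =1 c.
Proof.
move=> c1.
have E i : (\sum_k c k *: @ref_vertex R m k) ord0 i = c (lift ord0 i).
  rewrite summxE big_ord_recl /ref_vertex unlift_none !mxE mulr0 add0r.
  rewrite (bigD1 i)//= liftK !mxE !eqxx mulr1 big1 ?addr0// => k ki.
  by rewrite liftK !mxE eq_sym (negbTE ki) andbF mulr0.
move=> j; case: (unliftP ord0 j) => [i ->|->]; first by rewrite bary_lift E.
rewrite bary0; under eq_bigr do rewrite E.
by rewrite -c1 big_ord_recl addrK.
Qed.

Lemma bary_facet m (j : 'I_m.+2) (s : 'rV[R]_m) k :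
  bary (simplex_param (facet (@ref_vertex R m.+1) j) s) k =
  if unlift j k is Some i then bary s i else 0.
Proof.
pose c k := if unlift j k is Some i then bary s i else 0.
have c1 : \sum_k c k = 1.
  rewrite (bigD1_ord j)//= /c unlift_none add0r -(sum_bary s).
  by apply: eq_bigr => i _; rewrite liftK.
rewrite -[RHS](bary_conv c1); congr (bary _ k).
rewrite simplex_paramE (bigD1_ord j)//= /c unlift_none scale0r add0r.
by apply: eq_bigr => i _; rewrite liftK.
Qed.

Lemma ref_simplex_facet m (j : 'I_m.+2) (s : 'rV[R]_m) : ref_simplex s ->
  ref_simplex (simplex_param (facet (@ref_vertex R m.+1) j) s).
Proof.
move=> /ref_simplexP s0; apply/ref_simplexP => k; rewrite bary_facet.
by case: unliftP.
Qed.

Lemma simplex_param_in m n (p : 'I_m.+1 -> 'rV[R]_n) s :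
  ref_simplex s -> simplex p (simplex_param p s).
Proof. by move=> rs; rewrite simplex_param_image; exists s. Qed.

Lemma simplex_facet m n (p : 'I_m.+2 -> 'rV[R]_n) j s : ref_simplex s ->
  simplex p (simplex_param (facet p j) s).
Proof.
by move=> rs; rewrite simplex_param_facet; apply: simplex_param_in; exact: ref_simplex_facet.
Qed.

Lemma continuous_simplex_param m n (p : 'I_m.+1 -> 'rV[R]_n) :
  continuous (simplex_param p).
Proof. by move=> x; exact: continuous_affine. Qed.

Lemma simplex_compact m n (p : 'I_m.+1 -> 'rV[R]_n) : compact (simplex p).
Proof.
rewrite simplex_param_image; apply: continuous_compact; last exact: ref_simplex_compact.
apply: continuous_subspaceT => x; exact: continuous_simplex_param.
Qed.

Lemma edges_perm m n (p : 'I_m.+1 -> 'rV[R]_n) (pi : 'S_m.+1) :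
  exists2 M : 'M[R]_m, `|\det M| = 1 & edges (p \o pi) = M *m edges p.
Proof.
have [M M1 ME] := @bary_perm_affine_det R m pi; exists M => //.
have E s : simplex_param (p \o pi) s = simplex_param (p \o pi) 0 + s *m (M *m edges p).
  rewrite !simplex_param_perm [in LHS]ME /simplex_param mulmxDl mulmxA.
  by rewrite addrA.
apply/row_matrixP => i; rewrite !rowE.
have := E (delta_mx ord0 i); rewrite /simplex_param mul0mx addr0.
by move/addrI.
Qed.

(** The bijection that [pi] induces between the complements of [i] and [pi i], that is, its action
    on the vertices of the facet opposite to [i]. *)
Lemma perm_lift m (pi : 'S_m.+1) (i : 'I_m.+1) :
  exists sg : 'S_m, forall j, pi (lift i j) = lift (pi i) (sg j).
Proof.
have /choice[sg sgE] : forall j, exists k, pi (lift i j) = lift (pi i) k.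
  move=> j.
  case: (unliftP (pi i) (pi (lift i j))) => [k ->|]; first by exists k.
  by move/perm_inj/eqP; rewrite eq_sym (negbTE (neq_lift _ _)).
have sgi : injective sg.
  move=> j k jk; apply: (@lift_inj _ i); apply: (@perm_inj _ pi).
  by rewrite !sgE jk.
by exists (perm sgi) => j; rewrite permE.
Qed.

Lemma vol_int_facet_perm m n (p : 'I_m.+2 -> 'rV[R]_n) (pi : 'S_m.+2) j g :
  (forall x, simplex p x -> {for x, continuous g}) ->
  vol_int (ref_simplex (m := m)) (g \o simplex_param (facet (p \o pi) j)) =
  vol_int (ref_simplex (m := m)) (g \o simplex_param (facet p (pi j))).
Proof.
move=> cg; have [sg sgE] := perm_lift pi j.
rewrite (_ : facet (p \o pi) j = facet p (pi j) \o sg); last first.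
  by apply/funext => i; rewrite /facet /= sgE.
suff ig : (lebesgue_rV R m).-integrable (ref_simplex (m := m))
    (EFin \o (g \o simplex_param (facet p (pi j)))).
  exact: (vol_int_param_perm sg ig).
apply: continuous_integrable_rV; first exact: ref_simplex_compact.
move=> s rs; apply: continuous_for_comp; first exact: continuous_simplex_param.
by apply: cg; exact: simplex_facet.
Qed.

Lemma derive_simplex_param m n (p : 'I_m.+1 -> 'rV[R]_n) (g : 'rV[R]_n -> R) v :
  'D_v (g \o simplex_param p) = 'D_(v *m edges p) g \o simplex_param p.
Proof. exact: derive_comp_affine. Qed.

Lemma pderiv_simplex_param m n (p : 'I_m.+1 -> 'rV[R]_n) (g : 'rV[R]_n -> R) k :
  pderiv k (g \o simplex_param p) = 'D_(row k (edges p)) g \o simplex_param p.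
Proof. by rewrite /pderiv rowE -derive_simplex_param. Qed.

Lemma C1_on_simplex_param m n (p : 'I_m.+1 -> 'rV[R]_n) (g : 'rV[R]_n -> R) :
  C1_on (simplex p) g -> C1_on (ref_simplex (m := m)) (g \o simplex_param p).
Proof.
move=> dg s rs; have [|dgs cgs] := dg (simplex_param p s); first exact: simplex_param_in.
split=> [|y]; first by apply: differentiable_comp => //; exact: differentiable_affine.
rewrite (_ : (fun z => _) = 'D_(y *m edges p) g \o simplex_param p).
  by apply: continuous_for_comp; [exact: continuous_simplex_param|exact: cgs].
by rewrite -derive_simplex_param.
Qed.

Lemma simplex_perm m n (p : 'I_m.+1 -> 'rV[R]_n) (pi : 'S_m.+1) :
  simplex (p \o pi) = simplex p.
Proof.
rewrite !simplex_param_image; apply/seteqP; split=> _ [s rs <-].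
  exists (bary_perm pi s); last by rewrite simplex_param_perm.
  by move: rs; rewrite -{1}(@ref_simplex_bary_perm R m pi).
exists (bary_perm pi^-1%g s).
  by move: rs; rewrite -{1}(@ref_simplex_bary_perm R m pi^-1%g).
by rewrite simplex_param_perm -{1}[pi]invgK bary_permK.
Qed.

(** A transposition of vertices turns edge [k] into the first one, and the parametrization turns
    that one into the first coordinate direction. Neither the volume integral nor the facet
    integrals notice the renumbering. *)
Lemma gauss_simplex_edge n m (p : 'I_n.+2 -> 'rV[R]_m) (g : 'rV[R]_m -> R) (k : 'I_n.+1) :
  C1_on (simplex p) g ->
  vol_int (ref_simplex (m := n.+1)) ('D_(row k (edges p)) g \o simplex_param p) =
  vol_int (ref_simplex (m := n)) (g \o simplex_param (facet p ord0)) -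
  vol_int (ref_simplex (m := n)) (g \o simplex_param (facet p (lift ord0 k))).
Proof.
move=> dg.
have cg x : simplex p x -> {for x, continuous g}.
  by move=> Dx; apply: differentiable_continuous; have [] := dg _ Dx.
pose pi : 'S_n.+2 := tperm (lift ord0 ord0) (lift ord0 k).
have pi0 : pi ord0 = ord0 by rewrite tpermD// eq_sym neq_lift.
have pi1 : pi (lift ord0 ord0) = lift ord0 k by rewrite tpermL.
have dgp : C1_on (simplex (p \o pi)) g by rewrite simplex_perm.
have := gauss_ref_simplex0 (C1_on_simplex_param dgp).
rewrite pderiv_simplex_param.
have rE : row ord0 (edges (p \o pi)) = row k (edges p).
  by apply/rowP => i; rewrite !mxE /= pi0 pi1.
rewrite rE.
have iD : (lebesgue_rV R n.+1).-integrable (ref_simplex (m := n.+1))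
    (EFin \o ('D_(row k (edges p)) g \o simplex_param p)).
  apply: continuous_integrable_rV; first exact: ref_simplex_compact.
  move=> s rs; apply: continuous_for_comp; first exact: continuous_simplex_param.
  by have [|_ cgs] := dg (simplex_param p s); [exact: simplex_param_in|exact: cgs].
rewrite (vol_int_param_perm pi iD) => ->.
have E j : (g \o simplex_param (p \o pi)) \o simplex_param (facet (@ref_vertex R n.+1) j) =
    g \o simplex_param (facet (p \o pi) j).
  by apply/funext => s /=; rewrite -simplex_param_facet.
rewrite (E ord0) (E (lift ord0 ord0)).
have V := @vol_int_facet_perm n m p pi _ g cg.
by have := V ord0; have := V (lift ord0 ord0); rewrite pi0 pi1 => <- <-.
Qed.

Lemma vol_int_simplex n (p : 'I_n.+1 -> 'rV[R]_n) (g : 'rV[R]_n -> R) :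
  edges p \in unitmx -> (lebesgue_rV R n).-integrable (simplex p) (EFin \o g) ->
  vol_int (simplex p) g =
  `|\det (edges p)| * vol_int (ref_simplex (m := n)) (g \o simplex_param p).
Proof.
move=> uE ig; have sT := scales_measure_affine (p ord0) uE.
have d0 : `|\det (edges p)| != 0 by rewrite normr_eq0 -unitfE -unitmxE.
have mS := compact_measurable_rV (@simplex_compact n n p).
have := vol_int_scales _ sT mS ig; rewrite invr_ge0 => /(_ (normr_ge0 _)).
rewrite (_ : _ @^-1` _ = ref_simplex (m := n)).
  by move=> ->; rewrite mulrA divff// mul1r.
rewrite simplex_param_image; apply/seteqP; split=> [s [t rt]|s rs]; last by exists s.
by rewrite /simplex_param => /addrI/(can_inj (mulmxK uE)) <-.
Qed.

End gauss_simplex.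

(** * Euclidean inner product and norm *)

Section dot_lemmas.
Context {R : realType} {n : nat}.
Implicit Types x y z : 'rV[R]_n.

Lemma dotC x y : dot x y = dot y x.
Proof. by apply: eq_bigr => i _; rewrite mulrC. Qed.

Lemma dotDl x y z : dot (x + y) z = dot x z + dot y z.
Proof. by rewrite /dot -big_split; apply: eq_bigr => i _; rewrite mxE mulrDl. Qed.

Lemma dotZl a x y : dot (a *: x) y = a * dot x y.
Proof. by rewrite /dot mulr_sumr; apply: eq_bigr => i _; rewrite mxE mulrA. Qed.

Lemma dotDr x y z : dot x (y + z) = dot x y + dot x z.
Proof. by rewrite dotC dotDl !(dotC _ x). Qed.

Lemma dotZr a x y : dot x (a *: y) = a * dot x y.
Proof. by rewrite dotC dotZl dotC. Qed.

Lemma dotNl x y : dot (- x) y = - dot x y.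
Proof. by rewrite -scaleN1r dotZl mulN1r. Qed.

Lemma dotNr x y : dot x (- y) = - dot x y.
Proof. by rewrite dotC dotNl dotC. Qed.

Lemma dotBl x y z : dot (x - y) z = dot x z - dot y z.
Proof. by rewrite dotDl dotNl. Qed.

Lemma dotBr x y z : dot x (y - z) = dot x y - dot x z.
Proof. by rewrite dotDr dotNr. Qed.

Lemma dot0l x : dot 0 x = 0.
Proof. by rewrite -(scale0r 0) dotZl mul0r. Qed.

Lemma dot0r x : dot x 0 = 0.
Proof. by rewrite dotC dot0l. Qed.

Lemma dot_suml (I : Type) (r : seq I) (P : pred I) (F : I -> 'rV[R]_n) x :
  dot (\sum_(i <- r | P i) F i) x = \sum_(i <- r | P i) dot (F i) x.
Proof.
by elim/big_rec2: _ => [|i a y _ <-]; rewrite ?dot0l// dotDl.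
Qed.

Lemma dot_sumr (I : Type) (r : seq I) (P : pred I) (F : I -> 'rV[R]_n) x :
  dot x (\sum_(i <- r | P i) F i) = \sum_(i <- r | P i) dot x (F i).
Proof. by rewrite dotC dot_suml; apply: eq_bigr => i _; rewrite dotC. Qed.

Lemma dot_mulmx x y : dot x y = (x *m y^T) 0 0.
Proof. by rewrite mxE; apply: eq_bigr => i _; rewrite mxE. Qed.

Lemma dot_delta x i : dot x (delta_mx ord0 i) = x ord0 i.
Proof.
rewrite /dot (bigD1 i)//= mxE !eqxx mulr1 big1 ?addr0// => j ji.
by rewrite mxE (negbTE ji) andbF mulr0.
Qed.

Lemma dot_ge0 x : 0 <= dot x x.
Proof. by apply: sumr_ge0 => i _; rewrite -expr2 sqr_ge0. Qed.

Lemma sqr_enorm x : enorm x ^+ 2 = dot x x.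
Proof. by rewrite sqr_sqrtr// dot_ge0. Qed.

Lemma dot_eq0 x : (dot x x == 0) = (x == 0).
Proof.
apply/idP/eqP => [|->]; last by rewrite dot0l.
rewrite psumr_eq0 => [/allP h|i _]; last by rewrite -expr2 sqr_ge0.
apply/rowP => i; have := h i (mem_index_enum _); rewrite /= -expr2 sqrf_eq0 mxE.
by move/eqP.
Qed.

Lemma cauchy_schwarz x y : dot x y ^+ 2 <= dot x x * dot y y.
Proof.
have [->|y0] := eqVneq y 0; first by rewrite !dot0r mulr0 expr0n.
have yy : 0 < dot y y by rewrite lt_neqAle eq_sym dot_eq0 y0 dot_ge0.
(* The squared norm of this vector is [dot y y] times the gap in the Cauchy-Schwarz inequality. *)
have := dot_ge0 (dot y y *: x - dot x y *: y).
rewrite dotBl !dotBr !dotZl !dotZr (dotC y x) => h.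
rewrite -subr_ge0 -(pmulr_rge0 _ yy).
by apply: le_trans h _; rewrite le_eqVlt; apply/orP; left; apply/eqP; ring.
Qed.

Lemma enorm_ge0 x : 0 <= enorm x.
Proof. exact: sqrtr_ge0. Qed.

Lemma dot_le_enorm x y : `|dot x y| <= enorm x * enorm y.
Proof.
rewrite -(@ler_pXn2r _ 2)// ?nnegrE ?mulr_ge0 ?enorm_ge0//.
by rewrite real_normK ?num_real// exprMn !sqr_enorm cauchy_schwarz.
Qed.

Lemma enormZ a x : enorm (a *: x) = `|a| * enorm x.
Proof. by rewrite /enorm dotZl dotZr mulrA -expr2 sqrtrM ?sqr_ge0// sqrtr_sqr. Qed.

Lemma enormN x : enorm (- x) = enorm x.
Proof. by rewrite /enorm dotNl dotNr opprK. Qed.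

Lemma enorm0 : enorm (0 : 'rV[R]_n) = 0.
Proof. by rewrite /enorm dot0l sqrtr0. Qed.

End dot_lemmas.

(** * Integrals over compact sets *)

Section compact_integrals.
Context {R : realType} {n : nat}.
Implicit Types (K : set 'rV[R]_n) (f g : 'rV[R]_n -> R).

(** Continuity in the whole space at each point of [K], which is more than continuity of the
    restriction; for compact [K] it yields integrability. *)
Definition continuous_at_points K f : Prop :=
  forall x, K x -> {for x, continuous f}.

Lemma eq_vol_int K f g : (forall x, K x -> f x = g x) -> vol_int K f = vol_int K g.
Proof. by move=> fg; apply: eq_Rintegral => x /set_mem /fg. Qed.

Lemma vol_intD K f g : compact K ->
  continuous_at_points K f -> continuous_at_points K g ->
  vol_int K (fun x => f x + g x) = vol_int K f + vol_int K g.
Proof.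
move=> cK cf cg; apply: RintegralD; first exact: compact_measurable_rV.
  exact: continuous_integrable_rV.
exact: continuous_integrable_rV.
Qed.

Lemma vol_intB K f g : compact K ->
  continuous_at_points K f -> continuous_at_points K g ->
  vol_int K (fun x => f x - g x) = vol_int K f - vol_int K g.
Proof.
move=> cK cf cg; apply: RintegralB; first exact: compact_measurable_rV.
  exact: continuous_integrable_rV.
exact: continuous_integrable_rV.
Qed.

Lemma vol_intZ K a f : compact K -> continuous_at_points K f ->
  vol_int K (fun x => a * f x) = a * vol_int K f.
Proof.
move=> cK cf; apply: RintegralZl; first exact: compact_measurable_rV.
exact: continuous_integrable_rV.
Qed.

Lemma vol_int0 K : vol_int K (fun=> 0) = 0.
Proof. by rewrite /vol_int /Rintegral integral0. Qed.

Lemma vol_int_cst K a : compact K ->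
  vol_int K (fun=> a) = a * fine (lebesgue_rV R n K).
Proof. by move=> cK; apply: Rintegral_cst; exact: compact_measurable_rV. Qed.

Lemma vol_int_sum K (I : Type) (r : seq I) (P : pred I) (F : I -> 'rV[R]_n -> R) :
  compact K -> (forall i, continuous_at_points K (F i)) ->
  vol_int K (fun x => \sum_(i <- r | P i) F i x) = \sum_(i <- r | P i) vol_int K (F i).
Proof.
move=> cK cF; elim: r => [|i r IH].
  rewrite big_nil -[RHS](vol_int0 K); apply: eq_vol_int => x _.
  by rewrite big_nil.
rewrite big_cons -IH; case: ifPn => Pi.
  rewrite -vol_intD//; last by move=> x Kx; apply: continuous_for_sum => j; exact: cF.
  by apply: eq_vol_int => x _; rewrite big_cons Pi.
by apply: eq_vol_int => x _; rewrite big_cons (negbTE Pi).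
Qed.

Lemma vol_int_ge0 K f : (forall x, K x -> 0 <= f x) -> 0 <= vol_int K f.
Proof. exact: Rintegral_ge0. Qed.

Lemma vol_int_le K f g : compact K ->
  continuous_at_points K f -> continuous_at_points K g ->
  (forall x, K x -> f x <= g x) -> vol_int K f <= vol_int K g.
Proof.
move=> cK cf cg fg; apply: le_Rintegral => //; first exact: compact_measurable_rV.
  exact: continuous_integrable_rV.
exact: continuous_integrable_rV.
Qed.

End compact_integrals.

(** * Barycentric coordinates of a nondegenerate simplex *)

Section barycentric.
Context {R : realType} {n : nat} (p : 'I_n.+1 -> 'rV[R]_n).
Hypothesis uE : edges p \in unitmx.

Definition bary_coord (j : 'I_n.+1) (x : 'rV[R]_n) : R :=
  bary ((x - p ord0) *m invmx (edges p)) j.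

(** The linear part of [bary]. *)
Definition bary_lin (v : 'rV[R]_n) (j : 'I_n.+1) : R :=
  if unlift ord0 j is Some i then v ord0 i else - \sum_i v ord0 i.

(** The gradient of [bary_coord j], constant because that function is affine. *)
Definition bary_grad (j : 'I_n.+1) : 'rV[R]_n :=
  \row_i bary_lin (delta_mx ord0 i *m invmx (edges p)) j.

Lemma baryD (s v : 'rV[R]_n) j : bary (s + v) j = bary s j + bary_lin v j.
Proof.
rewrite /bary /bary_lin; case: unliftP => [i _|_]; first by rewrite mxE.
under eq_bigr do rewrite mxE.
by rewrite big_split/= opprD addrA.
Qed.

Lemma bary_lin_sum (I : finType) (c : I -> R) (v : I -> 'rV[R]_n) j :
  bary_lin (\sum_i c i *: v i) j = \sum_i c i * bary_lin (v i) j.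
Proof.
rewrite /bary_lin; case: unliftP => [k _|_].
  by rewrite summxE; apply: eq_bigr => i _; rewrite mxE.
under eq_bigr do rewrite summxE.
rewrite exchange_big/= -sumrN; apply: eq_bigr => i _.
by rewrite mulrN mulr_sumr; congr (- _); apply: eq_bigr => k _; rewrite mxE.
Qed.

Lemma dot_bary_grad j v : dot (bary_grad j) v = bary_lin (v *m invmx (edges p)) j.
Proof.
rewrite {2}(row_sum_delta v) mulmx_suml.
under [in RHS]eq_bigr do rewrite -scalemxAl.
rewrite bary_lin_sum; apply: eq_bigr => i _.
by rewrite mxE mulrC.
Qed.

Lemma bary_coordD j x v : bary_coord j (x + v) = bary_coord j x + dot (bary_grad j) v.
Proof. by rewrite /bary_coord addrAC mulmxDl baryD dot_bary_grad. Qed.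

Lemma bary_coord_param j s : bary_coord j (simplex_param p s) = bary s j.
Proof. by rewrite /bary_coord /simplex_param addrAC subrr add0r mulmxK. Qed.

Lemma bary_coord_vertex j k : bary_coord j (p k) = (j == k)%:R.
Proof.
rewrite -simplex_param_vertex bary_coord_param /bary /ref_vertex.
case: (unliftP ord0 j) => [j' ->|->]; case: (unliftP ord0 k) => [k' ->|->].
- by rewrite mxE eqxx (inj_eq lift_inj).
- by rewrite mxE.
- rewrite (bigD1 k')//= mxE !eqxx big1 ?addr0 ?subrr//= => l li.
  by rewrite mxE (negbTE li) andbF.
- by rewrite big1 ?subr0 ?eqxx// => l _; rewrite mxE.
Qed.

Lemma dot_bary_grad_edge j a b :
  dot (bary_grad j) (p a - p b) = (j == a)%:R - (j == b)%:R.
Proof.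
have := bary_coordD j (p b) (p a - p b); rewrite addrC subrK !bary_coord_vertex => ->.
by rewrite addrAC subrr add0r.
Qed.

Lemma sum_bary_coord x : \sum_j bary_coord j x = 1.
Proof. exact: sum_bary. Qed.

Lemma bary_coord_simplex j x : simplex p x -> 0 <= bary_coord j x <= 1.
Proof.
rewrite simplex_param_image => -[s rs <-]; rewrite bary_coord_param bary_le1// andbT.
by have /ref_simplexP := rs.
Qed.

Lemma bary_coord_affine j : bary_coord j = fun x => bary_coord j 0 + dot (bary_grad j) x.
Proof. by apply/funext => x; rewrite -bary_coordD add0r. Qed.

Lemma continuous_bary_coord j x : {for x, continuous (bary_coord j)}.
Proof.
rewrite bary_coord_affine; apply: continuous_forD; first exact: continuous_for_cst.
apply: continuous_for_sum => i; apply: continuous_forM; first exact: continuous_for_cst.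
exact: coord_continuous.
Qed.

Lemma sum_bary_grad : \sum_j bary_grad j = 0.
Proof.
apply/rowP => i; rewrite summxE mxE.
have := sum_bary_coord (delta_mx ord0 i).
under eq_bigr do rewrite -[delta_mx _ _]add0r bary_coordD dot_delta.
by rewrite big_split/= sum_bary_coord => /(canRL (addKr _)); rewrite addNr.
Qed.

(** Edges from [p j0] and barycentric gradients are dual families. Differencing the expansion of a
    point in the vertices gives one of [v] in the vertices; [p j0] may be subtracted because the
    gradients sum to zero. *)
Lemma bary_grad_expand j0 v : v = \sum_j dot (bary_grad j) v *: (p j - p j0).
Proof.
under eq_bigr do rewrite scalerBr.
rewrite sumrB -scaler_suml -dot_suml sum_bary_grad dot0l scale0r subr0.
have E x : x = \sum_j bary_coord j x *: p j.
  by rewrite -simplex_paramE /simplex_param mulmxKV// addrC subrK.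
rewrite -[LHS]add0r [LHS]E.
under eq_bigr do rewrite bary_coordD scalerDl.
by rewrite big_split/= -E add0r.
Qed.

End barycentric.

(** * Gauss' theorem with outward unit normals *)

Section gauss_physical.
Context {R : realType} {n : nat} (p : 'I_n.+2 -> 'rV[R]_n.+1).
Hypothesis uE : edges p \in unitmx.

(** A numbering in which the edge matrix splits into the edges of the facet and the edge towards the
    opposite vertex. *)
Lemma edges_facet_last j : exists pi : 'S_n.+2,
  edges (p \o pi) = col_mx (p j - facet p j ord0) (edges (facet p j)) :> 'M[R]_(1 + n, n.+1).
Proof.
pose l0 : 'I_n.+2 := lift ord0 ord0.
exists (lift_perm l0 j 1).
have p0 : lift_perm l0 j 1 ord0 = lift j ord0.
  by rewrite (_ : ord0 = lift l0 ord0) ?lift_perm_lift ?perm1//; exact/val_inj.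
apply/row_matrixP => i; rewrite rowK /= p0.
case: (@splitP 1 n i) => k ik.
  have -> : i = lshift n k by exact/val_inj.
  rewrite rowKu (_ : lift ord0 (lshift n k) = l0); last by apply/val_inj; rewrite /= ord1.
  by rewrite lift_perm_id; apply/rowP => c; rewrite !mxE ord1.
have -> : i = rshift 1 k by exact/val_inj.
rewrite (_ : lift ord0 (rshift 1 k) = lift l0 (lift ord0 k)); last exact/val_inj.
rewrite lift_perm_lift perm1 rowKd.
by apply/rowP => c; rewrite !mxE.
Qed.

(** The area vector of a facet. Both sides are orthogonal to the facet edges and have the same
    product with the edge towards the opposite vertex, and these vectors form a basis. *)
Lemma surface_normal j nu : outward_unit_normal p j nu ->
  Num.sqrt (\det (edges (facet p j) *m (edges (facet p j))^T)) *: nu =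
  - `|\det (edges p)| *: bary_grad p j.
Proof.
move=> [nu1 nuE nuy]; set A := edges (facet p j); set y := p j - facet p j ord0.
have [pi piE] := edges_facet_last j.
set N : 'M[R]_(1 + n) := col_mx y A.
have dN : `|\det N| = `|\det (edges p)|.
  have [M M1 ME] := edges_perm p pi.
  by rewrite /N -piE ME det_mulmx normrM M1 mul1r.
have uN : N \in unitmx.
  by rewrite unitmxE unitfE -normr_eq0 dN normr_eq0 -unitfE -unitmxE.
(* The facet edges completed by the unit normal: [\det N' ^+ 2] is the Gram determinant of the
   facet, and [\det N] is the signed height [dot nu y] times [\det N']. *)
pose N' : 'M[R]_(1 + n) := col_mx nu A.
have nuA : A *m nu^T = 0.
  apply/colP => i; rewrite [RHS]mxE -(nuE i) dotC dot_mulmx.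
  by rewrite -row_mul [RHS]mxE.
have nunu : nu *m nu^T = 1%:M.
  apply/matrixP => a b; rewrite !ord1 -dot_mulmx -sqr_enorm nu1 expr1n.
  by rewrite mxE.
have ynu : y *m nu^T = (dot nu y)%:M.
  by apply/matrixP => a b; rewrite !ord1 -dot_mulmx dotC mxE.
have nuA' : nu *m A^T = 0 by rewrite -[nu]trmxK -trmx_mul nuA trmx0.
have detN'2 : \det N' ^+ 2 = \det (A *m A^T).
  rewrite expr2 -{2}(det_tr N') -det_mulmx /N' tr_col_mx mul_col_row.
  by rewrite nunu nuA nuA' det_ublock det1 mul1r.
have detNN' : \det N * \det N' = dot nu y * \det (A *m A^T).
  rewrite -(det_tr N') -det_mulmx /N /N' tr_col_mx mul_col_row.
  by rewrite ynu nuA det_ublock det_scalar1.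
have N'0 : \det N' != 0.
  apply/negP => /det0P[w w0 wN'].
  move: w0; rewrite -[w](@hsubmxK _ 1 1 n) in wN' *.
  move: (lsubmx w) (rsubmx w) wN' => a b.
  rewrite /N' mul_row_col => h.
  have a0 : a = 0.
    have := congr1 (fun z => z *m nu^T) h.
    by rewrite mulmxDl -!mulmxA nunu nuA mulmx0 addr0 mulmx1 mul0mx.
  move: h; rewrite a0 mul0mx add0r => h.
  have : row_mx 0 b *m N = 0 by rewrite /N mul_row_col mul0mx add0r h.
  move/(congr1 (fun z => z *m invmx N)); rewrite mulmxK// mul0mx => ->.
  by rewrite eqxx.
have detNE : \det N = dot nu y * \det N'.
  by apply: (mulIf N'0); rewrite detNN' -detN'2 expr2 mulrA.
have sE : Num.sqrt (\det (A *m A^T)) = `|\det N'| by rewrite -detN'2 sqrtr_sqr.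
have JE : `|\det (edges p)| = - (dot nu y) * `|\det N'|.
  by rewrite -dN detNE normrM ltr0_norm.
rewrite sE JE; set s := `|\det N'|.
apply/eqP; rewrite -subr_eq0; apply/eqP; set z := (_ - _).
suff zN : z *m N^T = 0.
  have := congr1 (fun w => w *m invmx N^T) zN.
  by rewrite mulmxK ?unitmx_tr// mul0mx.
have zy : dot z y = 0.
  rewrite /z dotBl !dotZl /y /facet /= dot_bary_grad_edge// eqxx.
  rewrite (negbTE (neq_lift _ _)) subr0 mulr1 mulNr opprK.
  by rewrite -/y mulrC -mulrBr; rewrite mulrC subrr mul0r.
have zA i : dot z (row i A) = 0.
  rewrite /z dotBl !dotZl nuE mulr0 sub0r rowK /facet /= dot_bary_grad_edge//.
  by rewrite !(negbTE (neq_lift _ _)) subrr mulr0 oppr0.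
have zyT : z *m y^T = 0.
  by apply/matrixP => a b; rewrite !ord1 -dot_mulmx zy mxE.
have zAT : z *m A^T = 0.
  apply/rowP => i; rewrite [RHS]mxE -(zA i) dot_mulmx tr_row.
  by rewrite colE mulmxA -colE [RHS]mxE.
by rewrite /N tr_col_mx mul_mx_row zyT zAT row_mx0.
Qed.

Lemma vol_int_derive (g : 'rV[R]_n.+1 -> R) v : C1_on (simplex p) g ->
  vol_int (simplex p) ('D_v g) =
  \sum_j dot (bary_grad p j) v * vol_int (simplex p) ('D_(p j - p ord0) g).
Proof.
move=> dg; have cS := @simplex_compact R _ _ p.
have cD w : continuous_at_points (simplex p) ('D_w g).
  by move=> x Dx; have [_ h] := dg x Dx; exact: h.
under eq_bigr do rewrite -vol_intZ//.
rewrite -(vol_int_sum _ _ (F := fun j x => dot (bary_grad p j) v * 'D_(p j - p ord0) g x))//.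
  apply: eq_vol_int => x Dx; have [dgx _] := dg x Dx.
  rewrite deriveE// {1}(bary_grad_expand uE ord0 v) linear_sum.
  by apply: eq_bigr => j _; rewrite linearZ deriveE.
by move=> j x Dx; apply: continuous_forM; [exact: continuous_for_cst|exact: cD].
Qed.

(** Expanding [v] in the edges from [p ord0] gives differences of facet integrals. Their common term
    [Q ord0] drops out because the barycentric gradients sum to zero, and [surface_normal] supplies
    the area element. *)
Lemma gauss_simplex (nu : 'I_n.+2 -> 'rV[R]_n.+1) (g : 'rV[R]_n.+1 -> R) v :
  (forall j, outward_unit_normal p j (nu j)) -> C1_on (simplex p) g ->
  vol_int (simplex p) ('D_v g) =
  \sum_j dot (nu j) v * surf_int (facet p j) g.
Proof.
move=> hnu dg; have cS := @simplex_compact R _ _ p.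
have cD w : continuous_at_points (simplex p) ('D_w g).
  by move=> x Dx; have [_ h] := dg x Dx; exact: h.
pose Q j := vol_int (ref_simplex (m := n)) (g \o simplex_param (facet p j)).
have sE j : dot (nu j) v * surf_int (facet p j) g =
    - `|\det (edges p)| * (dot (bary_grad p j) v * Q j).
  rewrite /surf_int -/(Q j) mulrCA mulrA -dotZl surface_normal// dotZl.
  by rewrite mulrA.
under [RHS]eq_bigr do rewrite sE.
rewrite -mulr_sumr vol_int_derive//.
rewrite (eq_bigr (fun j => dot (bary_grad p j) v * (`|\det (edges p)| * (Q ord0 - Q j)))); last first.
  move=> j _; congr (_ * _); case: (unliftP ord0 j) => [k ->|->]; last first.
    rewrite !subrr mulr0 -[RHS](vol_int0 (simplex p)); apply: eq_vol_int => x Dx.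
    exact: derive0.
  rewrite vol_int_simplex//; last exact: (continuous_integrable_rV cS (cD _)).
  have := gauss_simplex_edge k dg; rewrite rowK => G.
  exact: (congr1 (fun z => `|\det (edges p)| * z) G).
transitivity (`|\det (edges p)| * (Q ord0 * dot (\sum_j bary_grad p j) v
    - \sum_j dot (bary_grad p j) v * Q j)); last first.
  by rewrite sum_bary_grad// dot0l mulr0 sub0r mulrN mulNr.
rewrite dot_suml mulr_sumr -sumrB mulr_sumr; apply: eq_bigr => j _; ring.
Qed.

End gauss_physical.

(** * Comparison of quadratic forms on polynomials *)

Section psd_forms.
Context {R : realFieldType} {V : lmodType R} (U : V -> Prop).
Hypothesis U0 : U 0.
Hypothesis U_lin : forall a u v, U u -> U v -> U (a *: u + v).

Fixpoint in_span (l : seq V) (v : V) : Prop :=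
  if l is w :: l' then exists a v', in_span l' v' /\ v = a *: w + v' else v = 0.

(** Bilinearity is asked on [U] only: the integral forms are linear on polynomials, not on arbitrary
    functions. *)
Definition psd_form (B : V -> V -> R) : Prop :=
  [/\ forall a u v w, U u -> U v -> U w -> B (a *: u + v) w = a * B u w + B v w,
      forall u v, U u -> U v -> B u v = B v u
    & forall u, U u -> 0 <= B u u].

Fixpoint all_in (l : seq V) : Prop := if l is w :: l' then U w /\ all_in l' else True.

Lemma in_span0 l : in_span l 0.
Proof.
by elim: l => //= w l IH; exists 0, 0; split => //; rewrite scale0r addr0.
Qed.

Lemma in_span_sub l v : all_in l -> in_span l v -> U v.
Proof.
elim: l v => [|w l IH] v /=; first by move=> _ ->.
by move=> [Uw Ul] [a [v' [v'l ->]]]; apply: U_lin => //; exact: IH.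
Qed.

Lemma psd_form_expand B a u v : psd_form B -> U u -> U v ->
  B (a *: u + v) (a *: u + v) = a ^+ 2 * B u u + 2 * a * B u v + B v v.
Proof.
move=> [Bl Bs _] Uu Uv; have Uuv := U_lin a Uu Uv.
rewrite Bl// (Bs u)// (Bs v)// !Bl// (Bs v u)//; ring.
Qed.

Lemma psd_form_isotropic B u v : psd_form B -> U u -> U v -> B u u = 0 -> B u v = 0.
Proof.
move=> pB Uu Uv uu0; apply/eqP/negP => /negP uv0.
(* With [B u u = 0], this multiple of [u] added to [v] would give the form the value -1. *)
have := psd_form_expand (- (B v v + 1) / (2 * B u v)) pB Uu Uv.
have [_ _ Bp] := pB; move=> E; have := Bp _ (U_lin (- (B v v + 1) / (2 * B u v)) Uu Uv).
rewrite E uu0 mulr0 add0r.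
have -> : 2 * (- (B v v + 1) / (2 * B u v)) * B u v = - (B v v + 1) by field.
lra.
Qed.

(* Gram-Schmidt for B2: the head of the list is split off orthogonally. *)
Lemma psd_form_bound B1 B2 l : psd_form B1 -> psd_form B2 -> all_in l ->
  (forall v, in_span l v -> B2 v v = 0 -> B1 v v = 0) ->
  exists2 C, 0 < C & forall v, in_span l v -> B1 v v <= C * B2 v v.
Proof.
move=> p1 p2; have [B1l B1s B1p] := p1; have [B2l B2s B2p] := p2.
have [n] := ubnP (size l); elim: n l => // n IH [|u l] /= sl.
  move=> _ _; exists 1 => // v ->.
  have z B : psd_form B -> B 0 0 = 0.
    move=> [Bl _ _]; have := Bl 1 0 0 0 U0 U0 U0.
    rewrite scale1r addr0; lra.
  by rewrite !z// mulr0.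
move=> [Uu Ul] ker.
(* A head that is isotropic for [B2] is isotropic for [B1] by the kernel condition, and then drops
   out of both forms. *)
have [uu0|uu0] := eqVneq (B2 u u) 0.
  have u1 : B1 u u = 0.
    by apply: ker => //; exists 1, 0; split; [exact: in_span0|rewrite scale1r addr0].
  have E B a v : psd_form B -> U v -> B u u = 0 -> B (a *: u + v) (a *: u + v) = B v v.
    move=> pB Uv h; rewrite psd_form_expand// h (psd_form_isotropic pB Uu Uv h).
    by rewrite !mulr0 !add0r.
  have [//|//|v vl h|C C0 CP] := IH l.
    apply: ker => //; exists 0, v; split => //.
    by rewrite scale0r add0r.
  exists C => // v [a [v' [v'l ->]]]; have Uv' := in_span_sub Ul v'l.
  by rewrite !E//; exact: CP.
have b0 : 0 < B2 u u by rewrite lt_neqAle eq_sym uu0 B2p.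
(* Projection along [u] onto its [B2]-orthogonal complement. *)
pose T w := - (B2 w u / B2 u u) *: u + w.
have UT w : U w -> U (T w) by move=> Uw; exact: U_lin.
have TP w : U w -> B2 u (T w) = 0.
  by move=> Uw; rewrite (B2s _ _ Uu (UT _ Uw)) /T B2l// mulNr divfK// addNr.
have TlP m w : all_in m -> in_span m w -> in_span (map T m) (T w).
  elim: m w => [|x m IHm] w /=.
    move=> _ ->; rewrite /T (_ : B2 0 u = 0) ?mul0r ?oppr0 ?scale0r ?addr0//.
    have := B2l 1 0 0 u U0 U0 Uu; rewrite scale1r addr0; lra.
  move=> [Ux Um] [a [v' [v'm ->]]]; exists a, (T v'); split; first exact: IHm.
  have Uv' := in_span_sub Um v'm.
  rewrite /T B2l// scalerDr addrACA scalerA -scalerDl; congr (_ *: _ + _).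
  by rewrite mulrDl opprD mulrN mulrA.
have UTl m : all_in m -> all_in (map T m).
  by elim: m => //= x m IHm [Ux Um]; split; [exact: UT|exact: IHm].
have TlK m w : all_in m -> in_span (map T m) w ->
    exists a w', in_span m w' /\ w = a *: u + w'.
  elim: m w => [|x m IHm] w /=; first by move=> _ ->; exists 0, 0; rewrite scale0r addr0.
  move=> [Ux Um] [a [v' [v'm ->]]]; have [b [w' [w'm ->]]] := IHm _ Um v'm.
  exists (a * (- (B2 x u / B2 u u)) + b), (a *: x + w').
  split; first by exists a, w'.
  by rewrite /T scalerDr scalerA addrACA -scalerDl.
have [||v vl h|C C0 CP] := IH (map T l).
- by rewrite size_map.
- exact: UTl.
- by have [a [w' [w'l E]]] := TlK _ _ Ul vl; apply: ker => //; exists a, w'.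
(* [B2] splits orthogonally over [u] and [T w], whereas for [B1] the square of a sum is bounded by
   twice the sum of the squares; hence the two factors 2. *)
exists (2 * (B1 u u / B2 u u) + 2 * C).
  by rewrite ltr_wpDl ?mulr_gt0// mulr_ge0// divr_ge0// ?B1p// ltW.
move=> v [a [w [wl ->]]]; have Uw := in_span_sub Ul wl.
pose c := a + B2 w u / B2 u u.
have -> : a *: u + w = c *: u + T w.
  by rewrite /T addrA -scalerDl /c addrK.
have UTw := UT _ Uw.
have := CP _ (TlP _ _ Ul wl); rewrite (psd_form_expand c p2)// TP// mulr0 addr0 => h.
have B2T : 0 <= B2 (T w) (T w) by exact: B2p.
have h1 : B1 (c *: u + T w) (c *: u + T w) <= 2 * (c ^+ 2 * B1 u u) + 2 * B1 (T w) (T w).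
  have := B1p _ (U_lin (- c) Uu UTw).
  rewrite !psd_form_expand// sqrrN; lra.
apply: le_trans h1 _.
have c2 : 0 <= c ^+ 2 * B2 u u by rewrite mulr_ge0 ?sqr_ge0// ltW.
have : 0 <= B1 u u / B2 u u by rewrite divr_ge0 ?B1p// ltW.
have : B1 u u = B1 u u / B2 u u * B2 u u by rewrite divfK.
set q := B1 u u / B2 u u => {1}-> q0.
have := mulr_ge0 q0 B2T; have := mulr_ge0 (ltW C0) c2; lra.
Qed.

End psd_forms.

(** * Polynomials of bounded total degree as functions *)

Section polynomial_functions.
Context {R : realType} {m : nat}.
Notation X := ('rV[R]_m).
Notation coord i := (fun x : X => x ord0 i).

(* The functions in PN N (see PN_polN), by a Horner-like recursion on the degree. *)
Fixpoint polN (N : nat) (g : X -> R) : Prop :=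
  if N is N'.+1 then
    exists h0 (h : 'I_m -> X -> R), [/\ polN N' h0, forall i, polN N' (h i) &
      g = fun x => h0 x + \sum_i x ord0 i * h i x]
  else exists c, g = fun=> c.

Lemma polN_cst N c : polN N (fun=> c).
Proof.
elim: N c => [|N IH] c /=; first by exists c.
exists (fun=> c), (fun _ _ => 0); split=> //.
by apply/funext => x; rewrite big1 ?addr0// => i _; rewrite mulr0.
Qed.

Lemma polN_lin N a f g : polN N f -> polN N g -> polN N (fun x => a * f x + g x).
Proof.
elim: N f g => [|N IH] f g /=.
  by move=> [c ->] [c' ->]; exists (a * c + c').
move=> [f0 [fi [pf0 pfi ->]]] [g0 [gi [pg0 pgi ->]]].
exists (fun x => a * f0 x + g0 x), (fun i x => a * fi i x + gi i x).
split=> [|i|]; [exact: IH|exact: IH|].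
apply/funext => x; rewrite mulrDr addrACA mulr_sumr -big_split/=; congr (_ + _).
by apply: eq_bigr => i _; ring.
Qed.

Lemma polND N f g : polN N f -> polN N g -> polN N (fun x => f x + g x).
Proof.
move=> pf pg; have := polN_lin 1 pf pg.
by congr polN; apply/funext => x; rewrite mul1r.
Qed.

Lemma polNZ N a f : polN N f -> polN N (fun x => a * f x).
Proof.
move=> pf; have := polN_lin a pf (polN_cst N 0).
by congr polN; apply/funext => x; rewrite addr0.
Qed.

Lemma polN_sum N (I : Type) (r : seq I) (P : pred I) (F : I -> X -> R) :
  (forall i, polN N (F i)) -> polN N (fun x => \sum_(i <- r | P i) F i x).
Proof.
move=> pF; elim: r => [|i r IH].
  rewrite (_ : (fun x => _) = fun=> 0); first exact: polN_cst.
  by apply/funext => x; rewrite big_nil.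
rewrite (_ : (fun x => _) = fun x => (if P i then F i x else 0) +
    \sum_(j <- r | P j) F j x).
  by apply: polND => //; case: (P i) => //; exact: polN_cst.
by apply/funext => x; rewrite big_cons; case: (P i) => //; rewrite add0r.
Qed.

Lemma polNS N f : polN N f -> polN N.+1 f.
Proof.
move=> pf; exists f, (fun _ _ => 0); split=> // [i|]; first exact: polN_cst.
by apply/funext => x; rewrite big1 ?addr0// => i _; rewrite mulr0.
Qed.

Lemma polN_coordM N i f : polN N f -> polN N.+1 (fun x : X => x ord0 i * f x).
Proof.
move=> pf; exists (fun=> 0), (fun j x => (j == i)%:R * f x); split.
- exact: polN_cst.
- by move=> j; exact: polNZ.
- apply/funext => x; rewrite add0r (bigD1 i)//= eqxx mul1r big1 ?addr0// => j ji.
  by rewrite (negbTE ji) mul0r mulr0.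
Qed.

Lemma polN_differentiable N f : polN N f -> forall x, differentiable f x.
Proof.
elim: N f => [|N IH] f /=; first by move=> [c ->] x; exact: differentiable_cst.
move=> [f0 [fi [pf0 pfi ->]]] x.
rewrite (_ : (fun y => _) = f0 + \sum_i (coord i * fi i)).
  apply: differentiableD; first exact: IH.
  apply: differentiable_sum => i; apply: differentiableM; last exact: IH.
  exact: differentiable_coord.
by apply/funext => y; rewrite /GRing.add /= fct_sumE.
Qed.

Lemma polN_continuous N f : polN N f -> forall x, {for x, continuous f}.
Proof.
by move=> pf x; apply: differentiable_continuous; exact: polN_differentiable pf _.
Qed.

Lemma pderiv_polNS N f0 (fi : 'I_m -> X -> R) k :
  polN N f0 -> (forall i, polN N (fi i)) ->
  pderiv k (fun x => f0 x + \sum_i x ord0 i * fi i x) =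
  fun x => (pderiv k f0 x + fi k x) + \sum_i x ord0 i * pderiv k (fi i) x.
Proof.
move=> pf0 pfi; apply/funext => x.
have D0 v : derivable f0 x v by apply/diff_derivable/polN_differentiable; exact: pf0.
have Di i v : derivable (fi i) x v by apply/diff_derivable/polN_differentiable; exact: pfi.
have Dc i v : derivable (coord i) x v by apply/diff_derivable; exact: differentiable_coord.
rewrite /pderiv (_ : (fun y => _) = f0 + \sum_i (coord i * fi i)); last first.
  by apply/funext => y; rewrite /GRing.add /= fct_sumE.
rewrite deriveD//; last first.
  by apply: derivable_sum => i; exact: derivableM.
rewrite derive_sum => [|i]; last exact: derivableM.
rewrite -addrA; congr (_ + _).
under eq_bigr do rewrite deriveM//.
rewrite big_split/= addrC; congr (_ + _).
rewrite (bigD1 k)//= big1 ?addr0 => [|i ik].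
  rewrite -/(pderiv k (coord k) x) -(pderiv_coord k k (f := id))//.
  by rewrite /pderiv derive_id mxE !eqxx /GRing.scale /= mulr1.
rewrite -/(pderiv k (coord i) x) -(pderiv_coord k i (f := id))//.
by rewrite /pderiv derive_id mxE (negbTE ik) andbF scaler0.
Qed.

Lemma pderiv_cst (c : R) k : pderiv k (fun _ : X => c) = fun=> 0.
Proof. by apply/funext => x; exact: derive_cst. Qed.

Lemma polN_pderiv N f k : polN N f -> polN N (pderiv k f).
Proof.
elim: N f => [|N IH] f /=; first by move=> [c ->]; exists 0; exact: pderiv_cst.
move=> [f0 [fi [pf0 pfi ->]]]; rewrite (pderiv_polNS _ pf0 pfi).
exists (fun x => pderiv k f0 x + fi k x), (fun i => pderiv k (fi i)); split=> //.
- by apply: polND => //; exact: IH.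
- by move=> i; exact: IH.
Qed.

(** The derivative pays for the coordinate, so the degree does not rise. This keeps a barycentric
    coordinate times a derivative among the test functions. *)
Lemma polN_coord_pderiv N f i k : polN N f -> polN N (fun x : X => x ord0 i * pderiv k f x).
Proof.
elim: N f => [|N IH] f.
  by move=> [c ->]; exists 0; apply/funext => x; rewrite pderiv_cst mulr0.
move=> [f0 [fi [pf0 pfi ->]]].
have {}pf0 : polN N f0 := pf0.
have {}pfi : forall j, polN N (fi j) := pfi.
rewrite (pderiv_polNS _ pf0 pfi).
rewrite (_ : (fun x : X => x ord0 i * _) = fun x : X => x ord0 i * (pderiv k f0 x + fi k x) +
   \sum_j x ord0 j * (x ord0 i * pderiv k (fi j) x)).
  apply: polND; first by apply: polN_coordM; apply: polND => //; exact: polN_pderiv.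
  by apply: polN_sum => j; apply: polN_coordM; exact: IH.
apply/funext => x; rewrite mulrDr mulr_sumr; congr (_ + _).
by apply: eq_bigr => j _; rewrite mulrCA.
Qed.

Lemma polN_derive N f v : polN N f -> polN N ('D_v f).
Proof.
move=> pf; rewrite (_ : 'D_v f = fun x => \sum_k v ord0 k * pderiv k f x).
  by apply: polN_sum => k; apply: polNZ; exact: polN_pderiv.
by apply/funext => x; rewrite derive_pderiv//; exact: polN_differentiable pf _.
Qed.

(** A finite generating list, with repetitions since each monomial is reached by several orders of
    its factors; [psd_form_bound] asks for a span, not for a basis. *)
Fixpoint polN_gen (N : nat) : seq (X -> R) :=
  if N is N'.+1 then
    polN_gen N' ++
    flatten [seq [seq (fun x : X => x ord0 i * f x) | f <- polN_gen N'] | i <- index_enum 'I_m]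
  else [:: fun=> 1].

Lemma in_span_cat (l1 l2 : seq (X -> R)) f g :
  in_span l1 f -> in_span l2 g -> in_span (l1 ++ l2) (f + g).
Proof.
elim: l1 f => [|h l1 IH] f /=; first by move=> ->; rewrite add0r.
move=> [a [f' [f'l ->]]] gl; exists a, (f' + g); split; first exact: IH.
by rewrite addrA.
Qed.

Lemma in_span_map i (l : seq (X -> R)) f : in_span l f ->
  in_span [seq (fun x : X => x ord0 i * h x) | h <- l] (fun x : X => x ord0 i * f x).
Proof.
elim: l f => [|h l IH] f /=.
  by move=> ->; apply/funext => x; rewrite mulr0.
move=> [a [f' [f'l ->]]]; exists a, (fun x : X => x ord0 i * f' x); split; first exact: IH.
by apply/funext => x; rewrite /GRing.add /= /GRing.scale /= mulrDr mulrCA.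
Qed.

Lemma polN_in_span N f : polN N f -> in_span (polN_gen N) f.
Proof.
elim: N f => [|N IH] f /=.
  move=> [c ->]; exists c, 0; split => //; rewrite addr0.
  by apply/funext => x; exact/esym/mulr1.
move=> [f0 [fi [pf0 pfi ->]]].
have -> : (fun x => f0 x + \sum_i x ord0 i * fi i x) =
    f0 + (fun x : X => \sum_(i <- index_enum 'I_m) x ord0 i * fi i x).
  by [].
apply: in_span_cat; first exact: IH.
elim: (index_enum 'I_m) => [|i r IHr] /=.
  by apply/funext => x; rewrite big_nil.
rewrite (_ : (fun x => _) = (fun x : X => x ord0 i * fi i x) +
   (fun x : X => \sum_(j <- r) x ord0 j * fi j x)).
  by apply: in_span_cat => //; apply: in_span_map; exact: IH.
by apply/funext => x; rewrite big_cons.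
Qed.

Lemma all_in_cat (U : (X -> R) -> Prop) l1 l2 :
  all_in U l1 -> all_in U l2 -> all_in U (l1 ++ l2).
Proof. by elim: l1 => //= h l1 IH [Uh Ul] Ul2; split => //; exact: IH. Qed.

Lemma all_in_imp (U U' : (X -> R) -> Prop) l : (forall f, U f -> U' f) ->
  all_in U l -> all_in U' l.
Proof. by move=> UU'; elim: l => //= h l IH [Uh Ul]; split; [exact: UU'|exact: IH]. Qed.

Lemma polN_gen_polN N : all_in (polN N) (polN_gen N).
Proof.
elim: N => [|N IH]; first by split => //; exists 1.
rewrite /polN_gen -/polN_gen; apply: all_in_cat.
  by apply: all_in_imp IH => f; exact: polNS.
elim: (index_enum 'I_m) => //= i r IHr; apply: all_in_cat => //.
elim: (polN_gen N) IH => //= f l IHl [pf pl]; split; last exact: IHl.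
exact: polN_coordM.
Qed.

End polynomial_functions.

Lemma polN_affine (R : realType) m m' N (b : 'rV[R]_m') (A : 'M[R]_(m, m')) f :
  polN N f -> polN N (fun x => f (b + x *m A)).
Proof.
elim: N f => [|N IH] f /=; first by move=> [c ->]; exists c.
move=> [f0 [fi [pf0 pfi ->]]].
apply: (@polND _ _ N.+1); first by apply: (@polNS _ _ N); exact: IH.
apply: (@polN_sum _ _ N.+1) => i.
rewrite (_ : (fun x => _) = fun x => b ord0 i * fi i (b + x *m A) +
   \sum_j A j i * (x ord0 j * fi i (b + x *m A))).
  apply: (@polND _ _ N.+1).
    by apply: (@polNZ _ _ N.+1); apply: (@polNS _ _ N); exact: IH.
  apply: (@polN_sum _ _ N.+1) => j; apply: (@polNZ _ _ N.+1).
  by apply: (@polN_coordM _ _ N); exact: IH.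
apply/funext => x; rewrite !mxE mulrDl mulr_suml; congr (_ + _).
by apply: eq_bigr => j _; ring.
Qed.

(** * Norm equivalence and Poincare inequality on the reference simplex *)

Section reference_inequalities.
Context {R : realType}.

Lemma ref_simplex_convex m (s t : 'rV[R]_m) (a : R) : 0 <= a <= 1 ->
  ref_simplex s -> ref_simplex t -> ref_simplex ((1 - a) *: s + a *: t).
Proof.
move=> /andP[a0 a1] [s0 s1] [t0 t1]; split=> [i|].
  by rewrite !mxE addr_ge0// mulr_ge0// ?subr_ge0.
under eq_bigr do rewrite !mxE.
rewrite big_split/= -!mulr_sumr.
have h1 : (1 - a) * \sum_i s ord0 i <= (1 - a) * 1 by rewrite ler_wpM2l ?subr_ge0.
have h2 : a * \sum_i t ord0 i <= a * 1 by rewrite ler_wpM2l.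
by apply: le_trans (lerD h1 h2) _; rewrite !mulr1 subrK.
Qed.

Lemma ref_simplex_dist m (s t : 'rV[R]_m) : ref_simplex s -> ref_simplex t -> `|s - t| <= 1.
Proof.
move=> rs rt; rewrite [leLHS]/Num.Def.normr /= mx_normrE; apply/bigmax_leP; split => //.
move=> [i j] _ /=; rewrite !mxE (ord1 i) ler_norml.
have /andP[s0 s1] := ref_simplex_sub_cube j rs.
have /andP[t0 t1] := ref_simplex_sub_cube j rt.
by apply/andP; split; lra.
Qed.

(* A small homothetic copy of the reference simplex fits near any of its points. *)
Lemma vol_int_ref_eq0 m (f : 'rV[R]_m -> R) :
  continuous_at_points (ref_simplex (m := m)) f ->
  (forall x, ref_simplex x -> 0 <= f x) ->
  vol_int (ref_simplex (m := m)) f = 0 -> forall x, ref_simplex x -> f x = 0.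
Proof.
move=> cf f0 If x rx; apply/eqP; rewrite eq_le f0// andbT leNgt; apply/negP => fx0.
have cref := @ref_simplex_compact R m.
have fx2 : 0 < f x / 2 by rewrite divr_gt0.
have [e /= e0 He] : exists2 e : R, 0 < e & forall y, `|x - y| < e -> f x / 2 <= f y.
  have /cvgrPdist_lt/(_ _ fx2)/nbhs_ballP[e /= e0 He] := cf x rx.
  exists e => // y xy; have := He y; rewrite -ball_normE /= => /(_ xy).
  by rewrite ltr_distl => /andP[_ h]; lra.
pose t := Num.min 1 (e / 2).
have t0 : 0 < t by rewrite lt_min ltr01 divr_gt0.
have t1 : t <= 1 by rewrite ge_min lexx.
have te : t < e.
  apply: (@le_lt_trans _ _ (e / 2)); first by rewrite ge_min lexx orbT.
  by rewrite ltr_pdivrMr// ltr_pMr// ltr1n.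
(* The contraction towards [x] by the factor [t], written as an affine map so that its effect on the
   measure is known. *)
pose Phi (s : 'rV[R]_m) : 'rV[R]_m := (1 - t) *: x + s *m (t%:M).
have PhiE s : Phi s = (1 - t) *: x + t *: s by rewrite /Phi mul_mx_scalar.
have sPhi : scales_measure `|\det (t%:M : 'M[R]_m)|^-1 Phi.
  by apply: scales_measure_affine; rewrite unitmxE det_scalar unitrX// unitfE gt_eqF.
pose B : set 'rV[R]_m := Phi @` ref_simplex (m := m).
have cB : compact B.
  by apply: continuous_compact => //; apply: continuous_subspaceT => z; exact: continuous_affine.
have Bref : B `<=` ref_simplex (m := m).
  by move=> _ [s rs <-]; rewrite PhiE; apply: ref_simplex_convex => //; rewrite ltW.
have PB : Phi @^-1` B = ref_simplex (m := m).
  apply/seteqP; split => [s [s' rs']|s rs]; last by exists s.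
  by rewrite !PhiE => /addrI/scalerI <-//; rewrite gt_eqF.
have mB := compact_measurable_rV cB; have mref := compact_measurable_rV cref.
have muB : 0 < fine (lebesgue_rV R m B).
  have := sPhi.2 _ mB; rewrite PB => /(congr1 fine).
  rewrite fineM//; last by rewrite ge0_fin_numE// compact_fin_measure_rV.
  move=> E; have := @vol_ref_simplex_gt0 R m; rewrite E.
  by rewrite pmulr_rgt0// invr_gt0 normr_gt0 det_scalar expf_neq0// gt_eqF.
have : f x / 2 * fine (lebesgue_rV R m B) <= vol_int (ref_simplex (m := m)) f.
  rewrite -vol_int_cst//; apply: (@le_trans _ _ (vol_int B f)).
    apply: vol_int_le => //.
    - by move=> y _; exact: continuous_for_cst.
    - by move=> y /Bref; exact: cf.
    - move=> _ [s rs <-]; apply: He; rewrite PhiE.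
      rewrite scalerBl scale1r opprD addrA opprB addrCA subrr addr0 -scalerBr.
      rewrite normrZ gtr0_norm//; apply: le_lt_trans te.
      by rewrite -[leRHS]mulr1 ler_wpM2l ?(ltW t0)//; exact: ref_simplex_dist.
  have icf A : compact A -> A `<=` ref_simplex (m := m) ->
      (\int[lebesgue_rV R m]_(y in A) (f y)%:E)%E \is a fin_num.
    move=> cA Ar; apply: integrable_fin_num; first exact: compact_measurable_rV.
    by apply: continuous_integrable_rV => // y /Ar; exact: cf.
  apply: fine_le; [exact: icf|exact: icf|].
  apply: ge0_subset_integral => //.
  by apply/measurable_EFinP; apply: measurable_fun_continuous_rV.
by rewrite If leNgt mulr_gt0.
Qed.

Lemma ref_simplex_center m : exists2 c : 'rV[R]_m, ref_simplex c &
  forall j, 0 < bary c j.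
Proof.
have c0 j : 0 < bary (const_mx m.+1%:R^-1 : 'rV[R]_m) j.
  rewrite /bary; case: unliftP => [i _|_]; first by rewrite mxE invr_gt0.
  under eq_bigr do rewrite mxE.
  rewrite sumr_const card_ord -[_ *+ m]mulr_natl subr_gt0 ltr_pdivrMr// mul1r.
  by rewrite ltr_nat.
exists (const_mx m.+1%:R^-1) => //.
by apply/ref_simplexP => j; exact/ltW.
Qed.

(** The segment from [x] to an interior point lies, except possibly for [x] itself, where [bary _ j]
    is positive; the value at [x] is a limit along it. *)
Lemma continuous_eq0_ref m (j : 'I_m.+1) (f : 'rV[R]_m -> R) :
  continuous_at_points (ref_simplex (m := m)) f ->
  (forall x, ref_simplex x -> 0 < bary x j -> f x = 0) ->
  forall x, ref_simplex x -> f x = 0.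
Proof.
move=> cf f0 x rx; have [c rc c0] := ref_simplex_center m.
have line : continuous (fun t : R => x + t *: (c - x)) by exact: continuous_line.
have cg : {for 0, continuous (fun t : R => f (x + t *: (c - x)))}.
  by apply: continuous_for_comp; [exact: line|rewrite scale0r addr0; exact: cf].
have g0 : \forall t \near 0^'+, f (x + t *: (c - x)) = 0.
  near=> t.
  have t0 : 0 < t by [].
  have t1 : t < 1 by near: t; exact: nbhs_right_lt.
  have E : x + t *: (c - x) = (1 - t) *: x + t *: c.
    by rewrite scalerBr scalerBl scale1r addrA addrAC.
  apply: f0; rewrite E; first by apply: ref_simplex_convex => //; rewrite (ltW t0) ltW.
  have -> : bary ((1 - t) *: x + t *: c) j = (1 - t) * bary x j + t * bary c j.
    rewrite /bary; case: unliftP => [i _|_]; first by rewrite !mxE.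
    under eq_bigr do rewrite !mxE.
    rewrite big_split/= -!mulr_sumr; ring.
  rewrite ltr_wpDl ?mulr_gt0// mulr_ge0 ?subr_ge0 ?(ltW t1)//.
  by have /ref_simplexP := rx; apply.
have /cvg_at_right_filter h := cg.
have : f (x + t *: (c - x)) @[t --> 0^'+] --> (0 : R).
  by apply: cvg_near_cst.
move/cvg_unique => /(_ _ _ h); rewrite scale0r addr0 => <- //.
Unshelve. all: by end_near. Qed.

Notation ref := (ref_simplex (m := _)).

(** Common source of the forms below: masses when [T] is the identity, stiffness when [T] is a
    partial derivative. *)
Lemma polN_psd_form m N (w : 'rV[R]_m -> R) (T : ('rV[R]_m -> R) -> 'rV[R]_m -> R) :
  continuous_at_points ref w -> (forall x, ref_simplex x -> 0 <= w x) ->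
  (forall f, polN N f -> polN N (T f)) ->
  (forall a f g, polN N f -> polN N g -> T (a *: f + g) = a *: T f + T g) ->
  psd_form (polN N) (fun f g => vol_int ref (fun x => w x * (T f x * T g x))).
Proof.
move=> cw w0 pT linT; have cref := @ref_simplex_compact R m.
have cT f x : polN N f -> {for x, continuous (T f)}.
  by move=> pf; exact: polN_continuous (pT _ pf) x.
have cwTT f g : polN N f -> polN N g ->
    continuous_at_points ref (fun x => w x * (T f x * T g x)).
  by move=> pf pg x rx; apply: continuous_forM; [exact: cw|apply: continuous_forM; exact: cT].
split=> [a f g h pf pg ph|f g pf pg|f pf].
- rewrite -vol_intZ//; last exact: cwTT.
  rewrite -vol_intD//; last 2 first.
  + by move=> x rx; apply: continuous_forM; [exact: continuous_for_cst|exact: cwTT].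
  + exact: cwTT.
  apply: eq_vol_int => x _; rewrite linT//.
  rewrite (_ : (a *: T f + T g) x = a * T f x + T g x)//; ring.
- by apply: eq_vol_int => x _; rewrite (mulrC (T f x)).
- by apply: vol_int_ge0 => x rx; rewrite mulr_ge0 ?w0// -expr2 sqr_ge0.
Qed.

Lemma polN_zero m N : polN N (0 : 'rV[R]_m -> R).
Proof. exact: polN_cst. Qed.

Lemma polN_addZ m N a (f g : 'rV[R]_m -> R) : polN N f -> polN N g -> polN N (a *: f + g).
Proof. exact: polN_lin. Qed.

(** Comparison of two forms on a finite span. If the weighted one vanishes, the polynomial is zero
    where the weight is positive, hence by continuity on the whole simplex. *)
Lemma weighted_mass m N (j : 'I_m.+1) : exists2 C : R, 0 < C &
  forall q, polN N q ->
    vol_int ref (fun x => q x ^+ 2) <= C * vol_int ref (fun x => bary x j * q x ^+ 2).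
Proof.
have p1 := @polN_psd_form m N (fun=> 1) id (fun x _ => @continuous_for_cst R 'rV[R]_m 1 x)
  (fun _ _ => ler01) (fun _ => id) (fun _ _ _ _ _ => erefl).
have p2 := @polN_psd_form m N (fun x => bary x j) id (fun x _ => @continuous_bary R m j x)
  (fun x rx => (ref_simplexP x).1 rx j) (fun _ => id) (fun _ _ _ _ _ => erefl).
have [|C C0 CP] := psd_form_bound (@polN_zero m N) (@polN_addZ m N) p1 p2 (polN_gen_polN N).
  move=> v vl /= v0; have pv := in_span_sub (@polN_zero m N) (@polN_addZ m N) (polN_gen_polN N) vl.
  have cv x : {for x, continuous v} by exact: polN_continuous pv x.
  have bv0 : forall x, ref_simplex x -> bary x j * (v x * v x) = 0.
    apply: vol_int_ref_eq0 => // [x _|x rx].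
      by apply: continuous_forM; [exact: continuous_bary|exact: continuous_forM].
    by rewrite mulr_ge0// ?(ref_simplexP x).1// -expr2 sqr_ge0.
  rewrite -[RHS](@vol_int0 R m ref); apply: eq_vol_int => x rx; rewrite mul1r.
  apply: (continuous_eq0_ref (j := j) (f := fun x => v x * v x)) x rx.
    by move=> x _; exact: continuous_forM.
  move=> x rx bx0; have /eqP := bv0 x rx.
  by rewrite mulf_eq0 gt_eqF//= => /eqP.
exists C => // q /polN_in_span /CP /=.
by under eq_vol_int do rewrite mul1r -expr2; under [X in _ * X]eq_vol_int do rewrite -expr2.
Qed.

Lemma derive_zero_ref_const m (f : 'rV[R]_m -> R) :
  (forall x, ref_simplex x -> differentiable f x) ->
  (forall x k, ref_simplex x -> pderiv k f x = 0) ->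
  forall x y, ref_simplex x -> ref_simplex y -> f x = f y.
Proof.
move=> df d0 x y rx ry.
pose g t := f (x + t *: (y - x)).
have rg t : 0 <= t <= 1 -> ref_simplex (x + t *: (y - x)).
  move=> t01; have -> : x + t *: (y - x) = (1 - t) *: x + t *: y.
    by rewrite scalerBr scalerBl scale1r addrA addrAC.
  exact: ref_simplex_convex.
have [||c _] := @MVT_segment R g (fun=> 0) 0 1 ler01.
- move=> t; rewrite in_itv/= => /andP[t0 t1].
  have rt : ref_simplex (x + t *: (y - x)) by apply: rg; rewrite !ltW.
  have E : 'D_1 g t = 0.
    rewrite /g derive_line derive_pderiv; last exact: df.
    by rewrite big1// => k _; rewrite d0// mulr0.
  rewrite -E; apply: derivableP; apply: derivable_line.
  by apply: diff_derivable; exact: df.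
- apply: continuous_in_subspaceT => t; rewrite inE/= in_itv/= => t01.
  apply: (@continuous_for_comp _ _ _ (fun t : R => x + t *: (y - x)) f).
    exact: continuous_line.
  by apply: differentiable_continuous; apply: df; exact: rg.
rewrite mul0r /g scale0r addr0 scale1r [x + _]addrC subrK => /eqP.
by rewrite subr_eq0 eq_sym => /eqP.
Qed.

Lemma psd_formD (V : lmodType R) (U : V -> Prop) B1 B2 : psd_form U B1 -> psd_form U B2 ->
  psd_form U (fun u v => B1 u v + B2 u v).
Proof.
move=> [l1 s1 p1] [l2 s2 p2]; split=> [a u v w Uu Uv Uw|u v Uu Uv|u Uu].
- by rewrite l1// l2//; ring.
- by rewrite s1// s2.
- by rewrite addr_ge0 ?p1 ?p2.
Qed.

Lemma psd_form_sum (V : lmodType R) (U : V -> Prop) (I : Type) (r : seq I)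
    (B : I -> V -> V -> R) : (forall i, psd_form U (B i)) ->
  psd_form U (fun u v => \sum_(i <- r) B i u v).
Proof.
move=> pB; elim: r => [|i r IH].
  by split=> [a u v w _ _ _|u v _ _|u _]; rewrite !big_nil// mulr0 addr0.
have := psd_formD (pB i) IH; congr psd_form.
by apply/funext => u; apply/funext => v; rewrite big_cons.
Qed.

(** The rank-one form [M], a product of two integrals, is added to the stiffness form to remove the
    constants from its kernel. On polynomials of mean zero it contributes nothing. *)
Lemma poincare_ref m N : exists2 C : R, 0 < C &
  forall q : 'rV[R]_m -> R, polN N q -> vol_int ref q = 0 ->
    vol_int ref (fun x => q x ^+ 2) <= C * \sum_k vol_int ref (fun x => pderiv k q x ^+ 2).
Proof.
have cref := @ref_simplex_compact R m.
have p1 := @polN_psd_form m N (fun=> 1) id (fun x _ => @continuous_for_cst R 'rV[R]_m 1 x)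
  (fun _ _ => ler01) (fun _ => id) (fun _ _ _ _ _ => erefl).
have pd (k : 'I_m) := @polN_psd_form m N (fun=> 1) (fun f => pderiv k f)
  (fun x _ => @continuous_for_cst R 'rV[R]_m 1 x)
  (fun _ _ => ler01) (fun f => @polN_pderiv R m N f k).
have lin_pd (k : 'I_m) (a : R) (f g : 'rV[R]_m -> R) : polN N f -> polN N g ->
    pderiv k (a *: f + g) = a *: pderiv k f + pderiv k g.
  move=> pf pg; apply/funext => x.
  have df : derivable f x (delta_mx ord0 k).
    by apply: diff_derivable; exact: polN_differentiable pf x.
  have dg : derivable g x (delta_mx ord0 k).
    by apply: diff_derivable; exact: polN_differentiable pg x.
  by rewrite /pderiv deriveD ?deriveZ//; exact: derivableZ.
have pS := psd_form_sum (index_enum 'I_m) (fun k => pd k (lin_pd k)).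
pose M (f g : 'rV[R]_m -> R) := vol_int ref f * vol_int ref g.
have pM : psd_form (polN N) M.
  have cp f : polN N f -> continuous_at_points (ref : set 'rV[R]_m) f.
    by move=> pf x _; exact: polN_continuous pf x.
  split=> [a f g h pf pg ph|f g _ _|f _]; rewrite /M.
  - rewrite mulrA -mulrDl -(vol_intZ a cref (cp _ pf)).
    rewrite -(vol_intD cref (f := fun x => a * f x) (g := g))//; last exact: cp.
    by apply: (cp (fun x => a * f x)); exact: polNZ.
  - exact: mulrC.
  - by rewrite -expr2 sqr_ge0.
have p2 := psd_formD pS pM.
have [|C C0 CP] := psd_form_bound (@polN_zero m N) (@polN_addZ m N) p1 p2 (polN_gen_polN N).
  move=> v vl /= v0; have pv := in_span_sub (@polN_zero m N) (@polN_addZ m N) (polN_gen_polN N) vl.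
  have [_ _ pMp] := pM; have pos k : 0 <= vol_int ref (fun x => 1 * (pderiv k v x * pderiv k v x)).
    by apply: vol_int_ge0 => x _; rewrite mul1r -expr2 sqr_ge0.
  have sum0 : 0 <= \sum_k vol_int ref (fun x => 1 * (pderiv k v x * pderiv k v x)).
    by apply: sumr_ge0 => k _; exact: pos.
  move: v0 => /eqP; rewrite paddr_eq0//; last exact: pMp.
  rewrite psumr_eq0// => /andP[/allP dv0 /eqP Mv0].
  have d0 x k : ref_simplex x -> pderiv k v x = 0.
    move=> rx; have /eqP h := dv0 k (mem_index_enum _).
    have := vol_int_ref_eq0 _ _ h rx; rewrite mul1r => /(_ _ _)/eqP.
    rewrite mulf_eq0 orbb => h'; apply/eqP; apply: h'.
      move=> z _; apply: continuous_forM; first exact: continuous_for_cst.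
      by apply: continuous_forM; exact: polN_continuous (polN_pderiv k pv) z.
    by move=> z _; rewrite mul1r -expr2 sqr_ge0.
  have cst := derive_zero_ref_const (fun x _ => polN_differentiable pv x) d0.
  have [c rc _] := @ref_simplex_center m.
  have vc0 : v c = 0.
    have : vol_int ref v = v c * fine (lebesgue_rV R m ref).
      by rewrite -vol_int_cst//; apply: eq_vol_int => x rx; exact: cst.
    move/eqP: Mv0; rewrite /M mulf_eq0 orbb => /eqP ->.
    move=> /esym/eqP; rewrite mulf_eq0 (gt_eqF (vol_ref_simplex_gt0 _)) orbF.
    by move/eqP.
  rewrite -[RHS](@vol_int0 R m ref); apply: eq_vol_int => x rx.
  by rewrite (cst x c)// vc0 mulr0 mulr0.
exists C => // q pq q0; have := CP _ (polN_in_span pq).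
rewrite /M q0 mulr0 addr0 => h.
rewrite (eq_vol_int (g := fun x => 1 * (q x * q x))); last by move=> x _; rewrite mul1r expr2.
apply: le_trans h _; rewrite ler_pM2l// le_eqVlt; apply/orP; left; apply/eqP.
by apply: eq_bigr => k _; apply: eq_vol_int => x _; rewrite mul1r expr2.
Qed.

End reference_inequalities.

Section polynomial_spaces.
Import -(notations) mpoly.
Context {R : realType} {d : nat}.

Lemma polN_coordX (k N : nat) (i : 'I_d) (f : 'rV[R]_d -> R) : polN N f ->
  polN (k + N) (fun x => x ord0 i ^+ k * f x).
Proof.
move=> pf; elim: k => [|k IH].
  by rewrite (_ : (fun x => _) = f)//; apply/funext => x; rewrite expr0 mul1r.
rewrite (_ : (fun x => _) = fun x : 'rV[R]_d => x ord0 i * (x ord0 i ^+ k * f x)).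
  exact: (@polN_coordM _ _ (k + N)).
by apply/funext => x; rewrite exprS mulrA.
Qed.

Lemma polN_monomial (e : 'I_d -> nat) :
  polN (\sum_i e i)%N (fun x : 'rV[R]_d => \prod_i x ord0 i ^+ e i).
Proof.
rewrite (_ : (fun x : 'rV[R]_d => _) =
  fun x : 'rV[R]_d => \prod_(i <- index_enum 'I_d) x ord0 i ^+ e i)//.
rewrite [X in polN X](_ : _ = (\sum_(i <- index_enum 'I_d) e i)%N)//.
elim: (index_enum 'I_d) => [|i r IH].
  rewrite big_nil; exists 1; apply/funext => x; exact: big_nil.
rewrite big_cons (_ : (fun x => _) =
  fun x : 'rV[R]_d => x ord0 i ^+ e i * \prod_(j <- r) x ord0 j ^+ e j).
  exact: polN_coordX.
by apply/funext => x; rewrite big_cons.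
Qed.

Lemma polN_leq (N M : nat) (f : 'rV[R]_d -> R) : (N <= M)%N -> polN N f -> polN M f.
Proof.
move=> NM pf; rewrite -(subnK NM); elim: (M - N)%N => // k IH.
exact: (@polNS _ _ (k + N)).
Qed.

(** One direction expands in monomials, the other assembles a multivariate polynomial from the
    Horner form. *)
Lemma PN_polN N (f : 'rV[R]_d -> R) : PN N f <-> polN N f.
Proof.
split=> [[q qN fE]|].
  (* The guard [m \in msupp q], always true on the range of the sum, gives a summand of bounded
     degree for every [m], as [polN_sum] requires. *)
  rewrite (_ : f = fun x => \sum_(m <- msupp q)
     (if m \in msupp q then mcoeff m q else 0) * \prod_i x ord0 i ^+ (m : multinom _) i); last first.
    apply/funext => x; rewrite fE mevalE big_seq [RHS]big_seq.
    by apply: eq_bigr => m ->.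
  apply: polN_sum => m; case: ifPn => mq; last first.
    rewrite (_ : (fun x => _) = fun=> 0); first exact: polN_cst.
    by apply/funext => x; rewrite mul0r.
  apply: polNZ; apply: (@polN_leq (\sum_i (m : multinom _) i)%N); last exact: polN_monomial.
  by rewrite -mdegE -ltnS; apply: leq_trans (mmeasure_mnm_lt mdeg mq) qN.
elim: N f => [|N IH] f /=.
  move=> [c ->]; exists (mpolyC d c); first by rewrite mmeasureC leq_b1.
  by move=> x; rewrite mevalC.
move=> [f0 [fi [pf0 pfi ->]]].
have [q0 q0N q0E] := IH _ pf0.
have /choice[q qE] : forall i, exists q : mpoly d R, (mmeasure mdeg q <= N.+1)%N /\
    forall x, fi i x = meval (x ord0) q.
  by move=> i; have [q ? ?] := IH _ (pfi i); exists q.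
exists (q0 + \sum_i mpolyX R (mnm1 i) * q i).
  apply: leq_trans (mmeasureD_le _ _ _) _; rewrite geq_max (leq_trans q0N)//=.
  apply: leq_trans (mmeasure_sum _ _ _ _) _; apply/bigmax_leqP_seq => i _ _.
  (* The size of a product is governed by those of its factors only when these are nonzero. *)
  have [->|qi0] := eqVneq (q i) 0; first by rewrite mulr0 mmeasure0.
  have [X0|X0] := eqVneq (mpolyX R (mnm1 i)) 0; first by rewrite X0 mul0r mmeasure0.
  by rewrite msizeM// msizeX mdeg1; have [h _] := qE i.
move=> x; rewrite mevalD q0E; congr (_ + _).
rewrite (big_morph _ (mevalD _) (meval0 _)); apply: eq_bigr => i _.
by rewrite mevalM mevalXU; have [_ ->] := qE i.
Qed.

End polynomial_spaces.

(** * Inequalities on shape-regular simplices *)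

Section simplex_inequalities.
Context {R : realType}.

Lemma polN_simplex_param m n N (p : 'I_m.+1 -> 'rV[R]_n) f :
  polN N f -> polN N (f \o simplex_param p).
Proof. exact: polN_affine. Qed.

Lemma vol_int_simplex_cont n (p : 'I_n.+1 -> 'rV[R]_n) g : edges p \in unitmx ->
  continuous_at_points (simplex p) g ->
  vol_int (simplex p) g =
  `|\det (edges p)| * vol_int (ref_simplex (m := n)) (g \o simplex_param p).
Proof.
move=> uE cg; apply: vol_int_simplex => //.
by apply: continuous_integrable_rV => //; exact: simplex_compact.
Qed.

(** The same determinant appears on both sides, so the reference constants serve every simplex;
    their sum over the vertices is independent of [j]. *)
Lemma weighted_mass_simplex n N : exists2 C : R, 0 < C &
  forall (p : 'I_n.+1 -> 'rV[R]_n) (j : 'I_n.+1) q, edges p \in unitmx -> polN N q ->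
    vol_int (simplex p) (fun x => q x ^+ 2) <=
    C * vol_int (simplex p) (fun x => bary_coord p j x * q x ^+ 2).
Proof.
have /choice[c cP] : forall j : 'I_n.+1, exists c : R, 0 < c /\
    forall q, polN N q -> vol_int (ref_simplex (m := n)) (fun x => q x ^+ 2) <=
      c * vol_int (ref_simplex (m := n)) (fun x => bary x j * q x ^+ 2).
  by move=> j; have [c c0 cP] := @weighted_mass R n N j; exists c.
have cj j : 0 < c j by have [] := cP j.
exists (\sum_j c j).
  by rewrite (bigD1 ord0)//= ltr_wpDr// sumr_ge0// => j _; exact: ltW.
move=> p j q uE pq.
have cq x : {for x, continuous (fun y => q y ^+ 2)}.
  by apply: continuous_forM; exact: polN_continuous pq x.
rewrite !vol_int_simplex_cont//; last first.
  by move=> x _; apply: continuous_forM => //; exact: continuous_bary_coord.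
rewrite mulrCA ler_wpM2l//.
have [_ /(_ _ (polN_simplex_param p pq)) h] := cP j.
apply: le_trans h _.
rewrite [leRHS](_ : _ = (\sum_j c j) *
   vol_int (ref_simplex (m := n)) (fun x => bary x j * (q \o simplex_param p) x ^+ 2)).
  apply: ler_wpM2r; last by rewrite (bigD1 j)//= lerDl sumr_ge0// => i _; exact: ltW.
  by apply: vol_int_ge0 => x rx; rewrite mulr_ge0 ?sqr_ge0// ?(ref_simplexP x).1.
by congr (_ * _); apply: eq_vol_int => x _; rewrite /= bary_coord_param.
Qed.

(** Derivatives along the edges are the partial derivatives on the reference simplex. In this form
    the inequality is affine invariant, hence a constant independent of [p]. *)
Lemma poincare_simplex n N : exists2 C : R, 0 < C &
  forall (p : 'I_n.+1 -> 'rV[R]_n) q, edges p \in unitmx -> polN N q ->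
    vol_int (simplex p) q = 0 ->
    vol_int (simplex p) (fun x => q x ^+ 2) <=
    C * \sum_k vol_int (simplex p) (fun x => 'D_(row k (edges p)) q x ^+ 2).
Proof.
have [C C0 CP] := @poincare_ref R n N; exists C => // p q uE pq q0.
have cq x : {for x, continuous q} by exact: polN_continuous pq x.
have cd v x : {for x, continuous ('D_v q)} by exact: polN_continuous (polN_derive v pq) x.
have J0 : 0 < `|\det (edges p)| by rewrite normr_gt0 -unitfE -unitmxE.
have q0' : vol_int (ref_simplex (m := n)) (q \o simplex_param p) = 0.
  move: q0; rewrite vol_int_simplex_cont// => /eqP.
  by rewrite mulf_eq0 gt_eqF//= => /eqP.
have h := CP _ (polN_simplex_param p pq) q0'.
rewrite (vol_int_simplex_cont uE (g := fun x => q x ^+ 2)); last first.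
  by move=> x _; exact: continuous_forM.
rewrite (eq_bigr (fun k => `|\det (edges p)| * vol_int (ref_simplex (m := n))
    (fun x => 'D_(row k (edges p)) q (simplex_param p x) ^+ 2))); last first.
  move=> k _; rewrite (vol_int_simplex_cont uE (g := fun x => 'D_(row k (edges p)) q x ^+ 2))//.
  by move=> x _; exact: continuous_forM.
rewrite -mulr_sumr mulrCA (ler_pM2l J0).
have E : \sum_k vol_int (ref_simplex (m := n)) (fun x => pderiv k (q \o simplex_param p) x ^+ 2) =
  \sum_k vol_int (ref_simplex (m := n))
    (fun x => 'D_(row k (edges p)) q (simplex_param p x) ^+ 2).
  apply: eq_bigr => k _; apply: eq_vol_int => x _.
  by rewrite (congr1 (@^~ x) (pderiv_simplex_param p q k)).
by rewrite -E; exact: h.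
Qed.

Lemma simplex_vertex m n (p : 'I_m.+1 -> 'rV[R]_n) j : simplex p (p j).
Proof.
rewrite -(simplex_param_vertex p j); apply: simplex_param_in.
rewrite /ref_vertex; case: unliftP => [i _|_]; last first.
  by split=> [k|]; [rewrite mxE|rewrite big1// => k _; rewrite mxE].
split=> [k|]; first by rewrite mxE; case: (_ && _).
rewrite (bigD1 i)//= mxE !eqxx big1 ?addr0// => k ki.
by rewrite mxE (negbTE ki) andbF.
Qed.

(** Makes the supremum in [diam] an actual upper bound. *)
Lemma simplex_bounded m n (p : 'I_m.+1 -> 'rV[R]_n) :
  exists M : R, forall x y, simplex p x -> simplex p y -> enorm (x - y) <= M.
Proof.
have [M [Mr hM]] := compact_bounded (@simplex_compact R m n p).
have M1 : `|M| + 1 > M by apply: le_lt_trans (ler_norm M) _; rewrite ltrDl.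
pose K : R := `|M| + 1.
have K0 : 0 <= K by rewrite addr_ge0.
exists (Num.sqrt (\sum_(i < n) (2 * K) ^+ 2)) => x y Dx Dy.
rewrite /enorm ler_wsqrtr// /dot; apply: ler_sum => i _.
rewrite -expr2 -[leLHS]real_normK ?num_real// lerXn2r ?nnegrE ?mulr_ge0//.
rewrite !mxE (le_trans (ler_normB _ _))// mulr_natl mulr2n lerD//.
  exact: le_trans (coord_le_norm _ _) (hM _ M1 _ Dx).
exact: le_trans (coord_le_norm _ _) (hM _ M1 _ Dy).
Qed.

Lemma enorm_le_diam m n (p : 'I_m.+1 -> 'rV[R]_n) x y :
  simplex p x -> simplex p y -> enorm (x - y) <= diam (simplex p).
Proof.
move=> Dx Dy; have [M MP] := simplex_bounded p.
apply: ub_le_sup; first by exists M => _ [[a b] [/= Da Db] <-]; exact: MP.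
by exists (x, y).
Qed.

Lemma diam_ge0 m n (p : 'I_m.+1 -> 'rV[R]_n) : 0 <= diam (simplex p).
Proof.
by have := enorm_le_diam (simplex_vertex p ord0) (simplex_vertex p ord0); rewrite subrr enorm0.
Qed.

(* A ball of radius r in the simplex sees bary_coord p j vary by 2 r |bary_grad p j| <= 1. *)
Lemma inradius_bary_grad n (p : 'I_n.+2 -> 'rV[R]_n.+1) j : edges p \in unitmx ->
  0 <= inradius (simplex p) /\ inradius (simplex p) * enorm (bary_grad p j) <= 1.
Proof.
move=> uE; set A := [set r | 0 <= r /\ exists c, [set y | enorm (y - c) <= r] `<=` simplex p].
have A0 : A 0.
  split=> //; exists (p ord0) => y /= y0.
  have e0 : enorm (y - p ord0) = 0 by apply/le_anti; rewrite y0 enorm_ge0.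
  have := sqr_enorm (y - p ord0); rewrite e0 expr0n /= => /esym/eqP.
  by rewrite dot_eq0 subr_eq0 => /eqP ->; exact: simplex_vertex.
have gr r : A r -> r * enorm (bary_grad p j) <= 1.
  move=> [r0 [c cD]]; set g := bary_grad p j.
  have [->|g0] := eqVneq g 0; first by rewrite enorm0 mulr0.
  have gp : 0 < enorm g.
    by rewrite lt_neqAle enorm_ge0 andbT eq_sym -sqrf_eq0 sqr_enorm dot_eq0.
  have D1 : simplex p (c + (r / enorm g) *: g).
    apply: cD; rewrite /= addrAC subrr add0r enormZ ger0_norm ?divr_ge0 ?(ltW gp)//.
    by rewrite divfK// gt_eqF.
  have Dc : simplex p c by apply: cD; rewrite /= subrr enorm0.
  have /andP[_ h1] := bary_coord_simplex uE j D1.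
  have /andP[h2 _] := bary_coord_simplex uE j Dc.
  move: h1; rewrite bary_coordD// dotZr -/g -sqr_enorm expr2 mulrA divfK ?gt_eqF//.
  by move=> h1; lra.
have gp : 0 < enorm (bary_grad p j).
  rewrite lt_neqAle enorm_ge0 andbT eq_sym -sqrf_eq0 sqr_enorm dot_eq0.
  apply/eqP => g0; have := dot_bary_grad_edge uE j j (lift j ord0).
  rewrite g0 dot0l eqxx (negbTE (neq_lift _ _)) subr0 => /esym/eqP.
  by rewrite oner_eq0.
(* Boundedness of the admissible radii, without which [inradius] would be a default value. *)
have ubA : ubound A (enorm (bary_grad p j))^-1.
  by move=> r /gr h; rewrite -[leRHS]mul1r ler_pdivlMr.
split; first by apply: ub_le_sup => //; exists (enorm (bary_grad p j))^-1.
rewrite -ler_pdivlMr// mul1r.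
by apply: ge_sup => //; exists 0.
Qed.

(** The scale-invariant quantity through which shape regularity enters. The absolute value is there
    because [sigma] is an arbitrary real. *)
Lemma diam_bary_grad n (p : 'I_n.+2 -> 'rV[R]_n.+1) j (sigma : R) : edges p \in unitmx ->
  diam (simplex p) <= sigma * inradius (simplex p) ->
  diam (simplex p) * enorm (bary_grad p j) <= `|sigma|.
Proof.
move=> uE h; have [r0 r1] := inradius_bary_grad j uE.
apply: (@le_trans _ _ (`|sigma| * (inradius (simplex p) * enorm (bary_grad p j)))).
  rewrite mulrA ler_wpM2r ?enorm_ge0//; apply: le_trans h _.
  by rewrite ler_wpM2r// ler_norm.
by rewrite -[leRHS]mulr1 ler_wpM2l.
Qed.

Lemma sqr_sum_le (I : finType) (a : I -> R) :
  (\sum_i a i) ^+ 2 <= #|I|%:R * \sum_i a i ^+ 2.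
Proof.
have := @cauchy_schwarz R #|I| (const_mx 1) (\row_k a (enum_val k)).
have E (F : I -> R) : \sum_(k < #|I|) F (enum_val k) = \sum_i F i.
  by rewrite [RHS](reindex _ (onW_bij _ (enum_val_bij I))).
rewrite /dot; under eq_bigr do rewrite !mxE mul1r.
rewrite (E a).
under [X in _ <= X * _]eq_bigr do rewrite !mxE mul1r.
rewrite sumr_const card_ord.
under [X in _ <= _ * X]eq_bigr do rewrite !mxE -expr2.
by rewrite (E (fun i => a i ^+ 2)).
Qed.

Lemma sqr_derive_le n (q : 'rV[R]_n -> R) v x : differentiable q x ->
  'D_v q x ^+ 2 <= dot v v * \sum_i pderiv i q x ^+ 2.
Proof.
move=> dq; have := cauchy_schwarz v (gradient q x).
rewrite derive_pderiv// /dot.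
under eq_bigr do rewrite mxE.
by under [X in _ <= _ * X]eq_bigr do rewrite mxE -expr2.
Qed.

(** Each coordinate vector is expanded in the edges from [p j0], with barycentric gradients as
    coefficients; [n.+1] counts the vertices in the Cauchy-Schwarz inequality. *)
Lemma sum_sqr_pderiv_le n (p : 'I_n.+1 -> 'rV[R]_n) (q : 'rV[R]_n -> R) j0 x :
  edges p \in unitmx -> differentiable q x ->
  \sum_i pderiv i q x ^+ 2 <=
  n.+1%:R * \sum_j dot (bary_grad p j) (bary_grad p j) * 'D_(p j - p j0) q x ^+ 2.
Proof.
move=> uE dq.
have dE i : pderiv i q x = \sum_j bary_grad p j ord0 i * 'D_(p j - p j0) q x.
  rewrite /pderiv deriveE// {1}(bary_grad_expand uE j0 (delta_mx ord0 i)) linear_sum.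
  by apply: eq_bigr => j _; rewrite linearZ deriveE// dot_delta.
apply: (@le_trans _ _ (\sum_i n.+1%:R *
    \sum_j (bary_grad p j ord0 i * 'D_(p j - p j0) q x) ^+ 2)).
  apply: ler_sum => i _; rewrite dE; apply: le_trans (sqr_sum_le _) _.
  by rewrite card_ord.
rewrite -mulr_sumr ler_wpM2l// exchange_big/= le_eqVlt; apply/orP; left; apply/eqP.
apply: eq_bigr => j _; rewrite /dot mulr_suml; apply: eq_bigr => i _.
by rewrite exprMn -expr2.
Qed.

End simplex_inequalities.

(** * The LDG gradient *)

Section ldg.
Context {R : realType} {n : nat} (N : nat) (p : 'I_n.+2 -> 'rV[R]_n.+1).
Variable nu : 'I_n.+2 -> 'rV[R]_n.+1.
Hypothesis uE : edges p \in unitmx.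
Hypothesis hnu : forall j, outward_unit_normal p j (nu j).
Notation D := (simplex p).

Lemma eq_surf_int m k (q : 'I_m.+1 -> 'rV[R]_k) g g' :
  (forall s, ref_simplex s -> g (simplex_param q s) = g' (simplex_param q s)) ->
  surf_int q g = surf_int q g'.
Proof. by move=> gg'; congr (_ * _); apply: eq_vol_int => s rs; exact: gg'. Qed.

Lemma surf_intZr m k (q : 'I_m.+1 -> 'rV[R]_k) g c : surf_integrable q g ->
  surf_int q (fun x => g x * c) = surf_int q g * c.
Proof.
move=> ig; rewrite /surf_int -mulrA; congr (_ * _).
apply: RintegralZr => //; apply: compact_measurable_rV; exact: ref_simplex_compact.
Qed.

Lemma surf_integrableM m k (q : 'I_m.+1 -> 'rV[R]_k) g h : surf_integrable q g ->
  (forall x, {for x, continuous h}) -> surf_integrable q (fun x => g x * h x).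
Proof.
move=> ig ch; have cref := @ref_simplex_compact R m.
have mref := compact_measurable_rV cref.
have chq : continuous_at_points (ref_simplex (m := m)) (h \o simplex_param q).
  by move=> s _; apply: continuous_for_comp; [exact: continuous_simplex_param|exact: ch].
have := integrableMl mref ig (measurable_fun_continuous_rV chq) (continuous_bounded_rV cref chq).
by apply: eq_integrable.
Qed.

(** Facet areas times normals sum to zero. If no product with [v0] were positive, all would vanish,
    [v0] would be orthogonal to every barycentric gradient, and its expansion in the edges would be
    zero. *)
Lemma exists_outflow_face (v0 : 'rV[R]_n.+1) : v0 != 0 -> exists j, 0 < dot v0 (nu j).
Proof.
move=> v00; pose A j := Num.sqrt (\det (edges (facet p j) *m (edges (facet p j))^T)).
have J0 : `|\det (edges p)| != 0 by rewrite normr_eq0 -unitfE -unitmxE.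
have nuE j : A j * dot v0 (nu j) = - `|\det (edges p)| * dot (bary_grad p j) v0.
  by rewrite -dotZr surface_normal// dotZr dotC.
have sum0 : \sum_j A j * dot v0 (nu j) = 0.
  by under eq_bigr do rewrite nuE; rewrite -mulr_sumr -dot_suml sum_bary_grad// dot0l mulr0.
apply/existsP; rewrite -[X in is_true X]negbK negb_exists; apply/negP => /forallP h.
have g0 j : dot (bary_grad p j) v0 = 0.
  have : A j * dot v0 (nu j) == 0.
    rewrite -oppr_eq0; move: sum0 => /eqP; rewrite -oppr_eq0 -sumrN psumr_eq0 => [/allP H|i _].
      by apply: H; rewrite mem_index_enum.
    by rewrite -mulrN mulr_ge0 ?sqrtr_ge0// oppr_ge0 leNgt h.
  by rewrite nuE mulf_eq0 oppr_eq0 (negbTE J0) => /eqP.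
move: v00; rewrite (bary_grad_expand uE ord0 v0) big1 ?eqxx// => j _.
by rewrite g0 scale0r.
Qed.

Lemma dot_normal_facet j a b : a != j -> b != j -> dot (nu j) (p a - p b) = 0.
Proof.
have [_ nuE _] := hnu j.
have E a' : a' != j -> dot (nu j) (p a' - facet p j ord0) = 0.
  move=> a'j; case: (unliftP j a') a'j => [i ->|->]; last by rewrite eqxx.
  move=> _; case: (unliftP ord0 i) => [k ->|->]; last by rewrite subrr dot0r.
  by rewrite -(nuE k) rowK.
move=> aj bj; rewrite -(subrK (facet p j ord0) (p a)) -addrA dotDr E// add0r.
by rewrite -opprB dotNr E// oppr0.
Qed.

Lemma bary_coord_facet j s : bary_coord p j (simplex_param (facet p j) s) = 0.
Proof.
by rewrite simplex_param_facet bary_coord_param// bary_facet unlift_none.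
Qed.

Lemma polN_bary_derive v e j : polN N v ->
  polN N (fun x => bary_coord p j x * 'D_e v x).
Proof.
move=> pv; rewrite (_ : (fun x => _) = fun x => bary_coord p j 0 * 'D_e v x +
   \sum_i bary_grad p j ord0 i *
     \sum_k e ord0 k * (x ord0 i * pderiv k v x)).
  apply: polND; first by apply: polNZ; exact: polN_derive.
  apply: polN_sum => i; apply: polNZ; apply: polN_sum => k; apply: polNZ.
  exact: polN_coord_pderiv.
apply/funext => x; rewrite {1}(bary_coord_affine p j) mulrDl; congr (_ + _).
rewrite /dot mulr_suml; apply: eq_bigr => i _.
rewrite derive_pderiv; last exact: polN_differentiable pv x.
rewrite !mulr_sumr; apply: eq_bigr => k _; ring.
Qed.

Variables (theta : 'I_n.+1 -> 'rV[R]_n.+1 -> R) (v : 'rV[R]_n.+1 -> R).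
Variables (flux : 'I_n.+2 -> 'rV[R]_n.+1 -> R) (j0 : 'I_n.+2).
Hypothesis pv : polN N v.
Hypothesis ptheta : forall i, polN N (theta i).
Hypothesis iflux : forall j, surf_integrable (facet p j) (flux j).
Hypothesis flux0 : forall x, flux j0 x = v x.
Hypothesis ldg : forall i phi, polN N phi ->
  vol_int D (fun x => theta i x * phi x) =
  vol_int D (fun x => - (v x * pderiv i phi x)) +
  bdry_int p (fun j x => flux j x * phi x * nu j ord0 i).

(* The flux terms of faces other than j0 vanish, either because the direction
   p r - p j0 is tangent to the face or because bary_coord p r vanishes there. *)
Lemma ldg_identity r : r != j0 ->
  let e := p r - p j0 in
  let phi := fun x => bary_coord p r x * 'D_e v x in
  vol_int D (fun x => (\sum_i e ord0 i * theta i x) * phi x) =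
  vol_int D (fun x => 'D_e v x * phi x).
Proof.
move=> rj0 e phi; have cD := @simplex_compact R _ _ p.
have pphi : polN N phi by exact: polN_bary_derive.
have c_v x : {for x, continuous v} by exact: polN_continuous pv x.
have c_th i x : {for x, continuous (theta i)} by exact: polN_continuous (ptheta i) x.
have c_phi x : {for x, continuous phi} by exact: polN_continuous pphi x.
have c_dphi w x : {for x, continuous ('D_w phi)}.
  by exact: polN_continuous (polN_derive w pphi) x.
have c_dv w x : {for x, continuous ('D_w v)}.
  by exact: polN_continuous (polN_derive w pv) x.
have cst a x : {for x, continuous (fun _ : 'rV[R]_n.+1 => a : R)} by exact: continuous_for_cst.
transitivity (\sum_i e ord0 i * vol_int D (fun x => theta i x * phi x)).
  rewrite (eq_vol_int (g := fun x => \sum_i e ord0 i * (theta i x * phi x))); last first.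
    by move=> x _; rewrite mulr_suml; apply: eq_bigr => i _; rewrite mulrA.
  rewrite (vol_int_sum _ _ (F := fun i x => e ord0 i * (theta i x * phi x)) cD); last first.
    by move=> i x _; apply: continuous_forM => //; exact: continuous_forM.
  apply: eq_bigr => i _; rewrite (vol_intZ _ cD (f := fun x => theta i x * phi x))//.
  by move=> x _; exact: continuous_forM.
under eq_bigr do rewrite ldg// mulrDr.
rewrite big_split/=.
have -> : \sum_i e ord0 i * bdry_int p (fun j x => flux j x * phi x * nu j ord0 i) =
    \sum_j dot (nu j) e * surf_int (facet p j) (fun x => flux j x * phi x).
  rewrite /bdry_int; under eq_bigr do rewrite mulr_sumr.
  rewrite exchange_big/=; apply: eq_bigr => j _; rewrite /dot mulr_suml.
  apply: eq_bigr => i _; rewrite surf_intZr; last exact: surf_integrableM.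
  ring.
have -> : \sum_i e ord0 i * vol_int D (fun x => - (v x * pderiv i phi x)) =
    - vol_int D (fun x => v x * 'D_e phi x).
  rewrite -mulN1r -(vol_intZ (-1) cD (f := fun x => v x * 'D_e phi x)); last first.
    by move=> x _; exact: continuous_forM.
  rewrite (eq_vol_int (f := fun x => -1 * (v x * 'D_e phi x))
    (g := fun x => \sum_i e ord0 i * (- (v x * pderiv i phi x)))); last first.
    move=> x _; rewrite derive_pderiv; last exact: polN_differentiable pphi x.
    rewrite mulN1r mulr_sumr -sumrN; apply: eq_bigr => i _; ring.
  rewrite (vol_int_sum _ _ (F := fun i x => e ord0 i * (- (v x * pderiv i phi x))) cD); last first.
    move=> i x _; apply: continuous_forM => //; apply: continuous_forN.
    by apply: continuous_forM => //; exact: c_dphi.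
  apply: eq_bigr => i _; rewrite (vol_intZ _ cD (f := fun x => - (v x * pderiv i phi x)))//.
  by move=> x _; apply: continuous_forN; apply: continuous_forM => //; exact: c_dphi.
have C1vphi : C1_on D (fun x => v x * phi x).
  move=> x _; split.
    by apply: differentiableM; [exact: polN_differentiable pv x|exact: polN_differentiable pphi x].
  move=> w; have -> : (fun z => 'D_w (fun x => v x * phi x) z) =
      fun z => v z * 'D_w phi z + phi z * 'D_w v z; last first.
    by apply: (@continuous_forD R _ (fun z => v z * 'D_w phi z)); exact: continuous_forM.
  apply/funext => z; rewrite (_ : (fun x => v x * phi x) = v * phi)// deriveM//.
    by apply: diff_derivable; exact: polN_differentiable pv z.
  by apply: diff_derivable; exact: polN_differentiable pphi z.
(* Gauss applied to [v * phi] undoes the integration by parts once [flux] may be replaced by [v] in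
   all boundary terms. *)
have G := gauss_simplex uE e hnu C1vphi.
have -> : \sum_j dot (nu j) e * surf_int (facet p j) (fun x => flux j x * phi x) =
    \sum_j dot (nu j) e * surf_int (facet p j) (fun x => v x * phi x).
  apply: eq_bigr => j _; have [->|jj0] := eqVneq j j0.
    by congr (_ * _); apply: eq_surf_int => s _; rewrite flux0.
  have [->|jr] := eqVneq j r.
    congr (_ * _); apply: eq_surf_int => s _.
    by rewrite /phi bary_coord_facet mul0r !mulr0.
  by rewrite /e dot_normal_facet ?mul0r// eq_sym.
rewrite -G.
have dE x : 'D_e (fun x => v x * phi x) x = v x * 'D_e phi x + 'D_e v x * phi x.
  rewrite (_ : (fun x => v x * phi x) = v * phi)// deriveM; last 2 first.
  - by apply: diff_derivable; exact: polN_differentiable pv x.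
  - by apply: diff_derivable; exact: polN_differentiable pphi x.
  by rewrite /GRing.scale /= [phi x * _]mulrC.
rewrite (eq_vol_int (f := 'D_e _) (g := fun x => v x * 'D_e phi x + 'D_e v x * phi x)); last first.
  by move=> x _; exact: dE.
rewrite (vol_intD cD (f := fun x => v x * 'D_e phi x) (g := fun x => 'D_e v x * phi x)).
- by rewrite addrA addNr add0r.
- by move=> x _; exact: continuous_forM.
- by move=> x _; exact: continuous_forM.
Qed.

Lemma dot_edge_le_diam a b : dot (p a - p b) (p a - p b) <= diam D ^+ 2.
Proof.
rewrite -sqr_enorm lerXn2r ?nnegrE ?enorm_ge0 ?diam_ge0//.
by apply: enorm_le_diam; exact: simplex_vertex.
Qed.

Variable C : R.
Hypothesis C0 : 0 < C.
Hypothesis CP : forall j q, polN N q ->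
  vol_int D (fun x => q x ^+ 2) <= C * vol_int D (fun x => bary_coord p j x * q x ^+ 2).

(** [CP] inserts the weight, [ldg_identity] replaces one factor ['D_e v] by the edge component of
    the LDG gradient, and Young's inequality leaves half of the left-hand side to be absorbed. The
    length of the edge accounts for [diam]. *)
Lemma ldg_edge_bound r :
  vol_int D (fun x => 'D_(p r - p j0) v x ^+ 2) <=
  C ^+ 2 * (diam D ^+ 2 * \sum_i vol_int D (fun x => theta i x ^+ 2)).
Proof.
have cD := @simplex_compact R _ _ p.
have sum_ge0 : 0 <= \sum_i vol_int D (fun x => theta i x ^+ 2).
  by apply: sumr_ge0 => i _; apply: vol_int_ge0 => x _; exact: sqr_ge0.
have [->|rj0] := eqVneq r j0.
  rewrite subrr (eq_vol_int (g := fun=> 0)); last by move=> x _; rewrite derive0 expr0n.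
  by rewrite vol_int0 mulr_ge0 ?sqr_ge0// mulr_ge0 ?sqr_ge0.
set e := p r - p j0.
have c_th i x : {for x, continuous (theta i)} by exact: polN_continuous (ptheta i) x.
have c_dv x : {for x, continuous ('D_e v)}.
  by exact: polN_continuous (polN_derive e pv) x.
have c_b x : {for x, continuous (bary_coord p r)} by exact: continuous_bary_coord.
have cst a x : {for x, continuous (fun _ : 'rV[R]_n.+1 => a : R)} by exact: continuous_for_cst.
pose T x := \sum_i e ord0 i * theta i x.
have c_T x : {for x, continuous T}.
  by apply: continuous_for_sum => i; exact: continuous_forM.
have h1 := CP r (polN_derive e pv).
have E := ldg_identity rj0; cbv zeta in E; rewrite -/e in E.
set X := vol_int D (fun x => 'D_e v x ^+ 2) in h1 *.
have hY : C * vol_int D (fun x => bary_coord p r x * 'D_e v x ^+ 2) <=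
    C ^+ 2 / 2 * vol_int D (fun x => T x ^+ 2) + 2^-1 * X.
  rewrite (eq_vol_int (g := fun x => 'D_e v x * (bary_coord p r x * 'D_e v x))); last first.
    by move=> x _; ring.
  rewrite -E -(vol_intZ C cD (f := fun x => T x * (bary_coord p r x * 'D_e v x))); last first.
    by move=> x _; apply: continuous_forM => //; exact: continuous_forM.
  rewrite /X -(vol_intZ _ cD (f := fun x => T x ^+ 2)); last first.
    by move=> x _; exact: continuous_forM.
  rewrite -(vol_intZ _ cD (f := fun x => 'D_e v x ^+ 2)); last first.
    by move=> x _; exact: continuous_forM.
  rewrite -(vol_intD cD (f := fun x => C ^+ 2 / 2 * T x ^+ 2)
      (g := fun x => 2^-1 * 'D_e v x ^+ 2)); last 2 first.
  - by move=> x _; apply: continuous_forM => //; exact: continuous_forM.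
  - by move=> x _; apply: continuous_forM => //; exact: continuous_forM.
  apply: vol_int_le => //.
  - move=> x _; apply: continuous_forM => //; apply: continuous_forM => //.
    exact: continuous_forM.
  - by move=> x _; apply: continuous_forD; apply: continuous_forM => //; exact: continuous_forM.
  - move=> x Dx; have /andP[b0 b1] := bary_coord_simplex uE r Dx.
    move: (T x) (bary_coord p r x) ('D_e v x) b0 b1 => t b w b0 b1.
    have h2 := sqr_ge0 (C * t - b * w).
    have h3 : 0 <= (1 - b) * w ^+ 2 by rewrite mulr_ge0 ?sqr_ge0// subr_ge0.
    have h4 : 0 <= b * ((1 - b) * w ^+ 2) by rewrite mulr_ge0.
    have -> : C * (t * (b * w)) = (C * t) * (b * w) by ring.
    have -> : C ^+ 2 / 2 * t ^+ 2 = (C * t) ^+ 2 / 2 by field.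
    rewrite -subr_ge0.
    (* The gap in Young's inequality, written as terms that are nonnegative because [b] lies between
       0 and 1. *)
    have -> : (C * t) ^+ 2 / 2 + 2^-1 * w ^+ 2 - C * t * (b * w) =
       ((C * t - b * w) ^+ 2 + (1 - b) * w ^+ 2 + b * ((1 - b) * w ^+ 2)) / 2 by field.
    by rewrite divr_ge0// addr_ge0// addr_ge0.
have hT : vol_int D (fun x => T x ^+ 2) <=
    diam D ^+ 2 * \sum_i vol_int D (fun x => theta i x ^+ 2).
  rewrite -(vol_int_sum _ _ (F := fun i x => theta i x ^+ 2) cD); last first.
    by move=> i x _; exact: continuous_forM.
  have c_s x : {for x, continuous (fun x => \sum_i theta i x ^+ 2)}.
    by apply: continuous_for_sum => i; exact: continuous_forM.
  rewrite -(vol_intZ _ cD (f := fun x => \sum_i theta i x ^+ 2))//.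
  apply: vol_int_le => //.
  - by move=> x _; exact: continuous_forM.
  - by move=> x _; exact: continuous_forM.
  - move=> x _; have := cauchy_schwarz e (\row_i theta i x).
    have -> : dot e (\row_i theta i x) = T x by apply: eq_bigr => i _; rewrite mxE.
    have -> : dot (\row_i theta i x) (\row_i theta i x) = \sum_i theta i x ^+ 2.
      by apply: eq_bigr => i _; rewrite !mxE expr2.
    move=> h; apply: le_trans h _; apply: ler_wpM2r; last exact: dot_edge_le_diam.
    by apply: sumr_ge0 => i _; exact: sqr_ge0.
have C2 : 0 <= C ^+ 2 / 2 by rewrite divr_ge0 ?sqr_ge0.
have := ler_wpM2l C2 hT; have := le_trans h1 hY.
set S := diam D ^+ 2 * _; set Z := vol_int D (fun x => T x ^+ 2); lra.
Qed.

(** One factor [n.+2] comes from Cauchy-Schwarz over the vertices, the other from the sum over them.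
    In each term [diam] meets a barycentric gradient, so only [sigma] survives. *)
Lemma ldg_gradient_bound (sigma : R) :
  diam D <= sigma * inradius D ->
  \sum_i vol_int D (fun x => pderiv i v x ^+ 2) <=
  (n.+2%:R * C * sigma) ^+ 2 * \sum_i vol_int D (fun x => theta i x ^+ 2).
Proof.
move=> hs; have cD := @simplex_compact R _ _ p.
set S := \sum_i vol_int D (fun x => theta i x ^+ 2).
have S0 : 0 <= S by apply: sumr_ge0 => i _; apply: vol_int_ge0 => x _; exact: sqr_ge0.
have c_dv w x : {for x, continuous ('D_w v)}.
  by exact: polN_continuous (polN_derive w pv) x.
have c_dv2 w x : {for x, continuous (fun x => 'D_w v x ^+ 2)}.
  exact: continuous_forM.
have cst a x : {for x, continuous (fun _ : 'rV[R]_n.+1 => a : R)} by exact: continuous_for_cst.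
pose g2 j := dot (bary_grad p j) (bary_grad p j).
rewrite -(vol_int_sum _ _ (F := fun i x => pderiv i v x ^+ 2) cD); last first.
  by move=> i x _; exact: c_dv2.
apply: (@le_trans _ _ (vol_int D (fun x => n.+2%:R * \sum_j g2 j * 'D_(p j - p j0) v x ^+ 2))).
  apply: vol_int_le => //.
  - by move=> x _; apply: continuous_for_sum => i; exact: c_dv2.
  - move=> x _; apply: continuous_forM => //; apply: continuous_for_sum => j.
    by apply: continuous_forM => //; exact: c_dv2.
  - by move=> x _; apply: sum_sqr_pderiv_le => //; exact: polN_differentiable pv x.
rewrite (vol_intZ _ cD (f := fun x => \sum_j g2 j * 'D_(p j - p j0) v x ^+ 2)); last first.
  move=> x _; apply: continuous_for_sum => j.
  by apply: continuous_forM => //; exact: c_dv2.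
rewrite (vol_int_sum _ _ (F := fun j x => g2 j * 'D_(p j - p j0) v x ^+ 2) cD); last first.
  by move=> j x _; apply: continuous_forM => //; exact: c_dv2.
apply: (@le_trans _ _ (n.+2%:R * \sum_(j < n.+2) (C * sigma) ^+ 2 * S)); last first.
  rewrite sumr_const card_ord -mulr_natl le_eqVlt; apply/orP; left; apply/eqP; ring.
rewrite ler_wpM2l//; apply: ler_sum => j _.
rewrite (vol_intZ _ cD (f := fun x => 'D_(p j - p j0) v x ^+ 2)); last first.
  by move=> x _; exact: c_dv2.
have g20 : 0 <= g2 j by exact: dot_ge0.
apply: le_trans (ler_wpM2l g20 (ldg_edge_bound j)) _.
have -> : g2 j * (C ^+ 2 * (diam D ^+ 2 * S)) = C ^+ 2 * S * (diam D * enorm (bary_grad p j)) ^+ 2.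
  by rewrite exprMn sqr_enorm /g2; ring.
have -> : (C * sigma) ^+ 2 * S = C ^+ 2 * S * `|sigma| ^+ 2.
  by rewrite real_normK ?num_real//; ring.
apply: ler_wpM2l; first by rewrite mulr_ge0 ?sqr_ge0.
rewrite lerXn2r ?nnegrE ?mulr_ge0 ?diam_ge0 ?enorm_ge0//.
exact: diam_bary_grad.
Qed.

(** An edge derivative is at most [diam] times the gradient: here the element size enters. The
    factor [n.+1] counts the edges from [p ord0]. *)
Lemma poincare_gradient (Cp : R) q : 0 < Cp ->
  vol_int D (fun x => q x ^+ 2) <=
    Cp * \sum_k vol_int D (fun x => 'D_(row k (edges p)) q x ^+ 2) ->
  polN N q ->
  vol_int D (fun x => q x ^+ 2) <=
    Cp * n.+1%:R * diam D ^+ 2 * \sum_i vol_int D (fun x => pderiv i q x ^+ 2).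
Proof.
move=> Cp0 hq pq; have cD := @simplex_compact R _ _ p.
have c_d2 w x : {for x, continuous (fun x => 'D_w q x ^+ 2)}.
  by apply: continuous_forM; exact: polN_continuous (polN_derive w pq) x.
set S := \sum_i _.
have -> : Cp * n.+1%:R * diam D ^+ 2 * S = Cp * (n.+1%:R * (diam D ^+ 2 * S)) by ring.
have -> : S = vol_int D (fun x => \sum_i pderiv i q x ^+ 2).
  rewrite (vol_int_sum _ _ (F := fun i x => pderiv i q x ^+ 2) cD)//.
  by move=> i x _; exact: c_d2.
apply: le_trans hq _; rewrite ler_pM2l//.
apply: (@le_trans _ _ (\sum_(k < n.+1) diam D ^+ 2 *
    vol_int D (fun x => \sum_i pderiv i q x ^+ 2))); last first.
  by rewrite sumr_const card_ord -[leLHS]mulr_natl.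
have c_s x : {for x, continuous (fun x => \sum_i pderiv i q x ^+ 2)}.
  by apply: continuous_for_sum => i; exact: c_d2.
apply: ler_sum => k _; rewrite -(vol_intZ _ cD (f := fun x => \sum_i pderiv i q x ^+ 2))//.
apply: vol_int_le => // [x _|x _].
- by apply: continuous_forM => //; exact: continuous_for_cst.
- apply: le_trans (sqr_derive_le _ (polN_differentiable pq x)) _.
  rewrite ler_wpM2r//; first by apply: sumr_ge0 => i _; exact: sqr_ge0.
  by rewrite rowK; exact: dot_edge_le_diam.
Qed.

End ldg.

(** * Jacobians along segments *)

Section operator_norm.
Context {R : realType} {n : nat}.

(** The squared Frobenius norm. It bounds [opnorm] and is continuous in the entries, which shows
    that the suprema in [opnorm] and [jacobian_sup] are taken over bounded sets. *)
Definition frob2 (A : 'M[R]_n) : R := \sum_i \sum_j A i j ^+ 2.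

Lemma frob2_ge0 A : 0 <= frob2 A.
Proof. by apply: sumr_ge0 => i _; apply: sumr_ge0 => j _; exact: sqr_ge0. Qed.

Lemma enorm_mulmx_frob (x : 'rV[R]_n) (A : 'M[R]_n) :
  enorm (x *m A) <= enorm x * Num.sqrt (frob2 A).
Proof.
rewrite -(@ler_pXn2r _ 2)// ?nnegrE ?mulr_ge0 ?enorm_ge0 ?sqrtr_ge0//.
rewrite exprMn !sqr_enorm sqr_sqrtr ?frob2_ge0// /frob2 exchange_big/= mulr_sumr.
apply: ler_sum => j _.
have := cauchy_schwarz x (\row_i A i j).
have -> : dot x (\row_i A i j) = (x *m A) 0 j.
  by rewrite mxE; apply: eq_bigr => i _; rewrite mxE.
have -> : dot (\row_i A i j) (\row_i A i j) = \sum_i A i j ^+ 2.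
  by apply: eq_bigr => i _; rewrite !mxE expr2.
by rewrite -expr2.
Qed.

Lemma opnorm_ubound (A : 'M[R]_n) :
  ubound [set enorm (x *m A) | x in [set x : 'rV[R]_n | enorm x <= 1]] (Num.sqrt (frob2 A)).
Proof.
move=> _ [x /= x1 <-]; apply: le_trans (enorm_mulmx_frob x A) _.
by rewrite -[leRHS]mul1r ler_wpM2r ?sqrtr_ge0.
Qed.

Lemma opnorm_le_frob (A : 'M[R]_n) : opnorm A <= Num.sqrt (frob2 A).
Proof.
apply: ge_sup; last exact: opnorm_ubound.
by exists (enorm (0 *m A)); exists 0 => //=; rewrite enorm0.
Qed.

Lemma enorm_mulmx (x : 'rV[R]_n) (A : 'M[R]_n) : enorm (x *m A) <= opnorm A * enorm x.
Proof.
have [x0|x0] := eqVneq (enorm x) 0.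
  by rewrite x0 mulr0 (le_trans (enorm_mulmx_frob x A))// x0 mul0r.
have xp : 0 < enorm x by rewrite lt_neqAle eq_sym x0 enorm_ge0.
rewrite -ler_pdivrMr//; apply: ub_le_sup; first by exists (Num.sqrt (frob2 A)); exact: opnorm_ubound.
exists ((enorm x)^-1 *: x).
  by rewrite /= enormZ ger0_norm ?invr_ge0 ?enorm_ge0// mulVf.
by rewrite -scalemxAl enormZ ger0_norm ?invr_ge0 ?enorm_ge0// mulrC.
Qed.

Lemma opnorm_ge0 (A : 'M[R]_n) : 0 <= opnorm A.
Proof.
apply: ub_le_sup; first by exists (Num.sqrt (frob2 A)); exact: opnorm_ubound.
by exists 0; rewrite /= ?mul0mx enorm0.
Qed.

End operator_norm.

Section jacobian_bound.
Context {R : realType} {m n : nat}.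
Variables (D : set 'rV[R]_m) (a b : 'rV[R]_m -> 'rV[R]_n) (V : set 'rV[R]_n).
Variable g : 'rV[R]_n -> 'rV[R]_n.
Hypothesis cD : compact D.
Hypothesis ca : forall x, D x -> {for x, continuous a}.
Hypothesis cb : forall x, D x -> {for x, continuous b}.
Hypothesis abV : segments D a b `<=` V.
Hypothesis C1g : C1_on V g.

Lemma jacobian_entry w i j : V w -> 'J g w i j = 'D_(delta_mx ord0 i) g w ord0 j.
Proof.
by move=> Vw; have [dg _] := C1g Vw; rewrite deriveEjacobian// -rowE [RHS]mxE.
Qed.

Lemma continuous_frob2_jacobian w : V w ->
  {for w, continuous (fun z => \sum_i \sum_j 'D_(delta_mx ord0 i) g z ord0 j ^+ 2)}.
Proof.
move=> Vw; have [_ cg] := C1g Vw.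
apply: continuous_for_sum => i; apply: continuous_for_sum => j.
have c1 : {for w, continuous (fun z => 'D_(delta_mx ord0 i) g z ord0 j)}.
  apply: (@continuous_for_comp _ _ _ ('D_(delta_mx ord0 i) g) (fun N : 'rV[R]_n => N ord0 j)).
    exact: cg.
  exact: coord_continuous.
exact: continuous_forM.
Qed.

(** The segments form the continuous image of the product of [D] with the unit interval, on which
    the Frobenius norm of the Jacobian is bounded by compactness. This makes [jacobian_sup] an
    actual bound. *)
Lemma jacobian_sup_bounded :
  has_ubound [set opnorm ('J g w) | w in segments D a b].
Proof.
pose phi (z : 'rV[R]_m * R) : 'rV[R]_n := (1 - z.2) *: a z.1 + z.2 *: b z.1.
pose h w := \sum_i \sum_j 'D_(delta_mx ord0 i) g w ord0 j ^+ 2.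
pose K := D `*` (`[0, 1]%classic : set R).
have cK : compact K by apply: compact_setX => //; exact: segment_compact.
have VK z : K z -> V (phi z).
  move=> [Dz z01]; apply: abV; exists z.1, z.2; split; [exact: Dz| |by []].
  by move: z01; rewrite /= in_itv.
have cphi z : K z -> {for z, continuous phi}.
  move=> [Dz _].
  have c2 : {for z, continuous (fun z : 'rV[R]_m * R => z.2)} by exact: cvg_snd.
  have c1 : {for z, continuous (fun z : 'rV[R]_m * R => z.1)} by exact: cvg_fst.
  have cza : {for z, continuous (fun z : 'rV[R]_m * R => a z.1)}.
    by apply: continuous_for_comp => //; exact: ca.
  have czb : {for z, continuous (fun z : 'rV[R]_m * R => b z.1)}.
    by apply: continuous_for_comp => //; exact: cb.
  apply: cvgD; apply: cvgZ => //.
  by apply: cvgB => //; exact: cvg_cst.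
have : compact ((h \o phi) @` K).
  apply: continuous_compact => //; apply: continuous_in_subspaceT => z; rewrite inE => Kz.
  apply: (@continuous_for_comp _ _ _ phi h); first exact: (cphi _ Kz).
  by apply: continuous_frob2_jacobian; exact: VK.
move/compact_bounded => [M [Mr hM]].
exists (Num.sqrt (`|M| + 1)) => _ [w [x [t [Dx t01 wE]]] <-].
have Kxt : K (x, t) by split => //=; rewrite in_itv.
have -> : w = phi (x, t) by exact: wE.
apply: le_trans (opnorm_le_frob _) _; rewrite ler_wsqrtr//.
have -> : frob2 ('J g (phi (x, t))) = h (phi (x, t)).
  apply: eq_bigr => i _; apply: eq_bigr => j _.
  by rewrite jacobian_entry//; exact: VK.
apply: le_trans (ler_norm _) _; apply: (hM (`|M| + 1)).
  by apply: le_lt_trans (ler_norm M) _; rewrite ltrDl.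
by exists (x, t).
Qed.

Lemma jacobian_sup_ge0 x : D x -> 0 <= jacobian_sup (segments D a b) g.
Proof.
move=> Dx; apply: (@le_trans _ _ (opnorm ('J g (a x)))); first exact: opnorm_ge0.
apply: ub_le_sup; first exact: jacobian_sup_bounded.
exists (a x) => //; exists x, 0; split => //; first by rewrite lexx ler01.
by rewrite subr0 scale1r scale0r addr0.
Qed.

(** The mean value theorem is scalar: it is applied to the product of [g] with its own increment
    [z], and one factor [enorm z] is divided out. *)
Lemma lipschitz_segment x : D x ->
  enorm (g (b x) - g (a x)) <= jacobian_sup (segments D a b) g * enorm (b x - a x).
Proof.
move=> Dx; set L := jacobian_sup _ _.
have L0 : 0 <= L by exact: jacobian_sup_ge0 Dx.
have seg t : 0 <= t <= 1 -> segments D a b (a x + t *: (b x - a x)).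
  move=> t01; exists x, t; split => //.
  by rewrite scalerBr scalerBl scale1r addrA addrAC.
pose z := g (b x) - g (a x).
pose l (w : 'rV[R]_n) := dot z (g w).
have dl w : V w -> forall v, is_derive w v l (dot z (v *m 'J g w)).
  move=> Vw v; have [dg _] := C1g Vw.
  have dgj j : differentiable (fun y => g y ord0 j) w by exact: differentiable_rV_coord.
  have -> : l = \sum_j (fun y => z ord0 j * g y ord0 j) by apply/funext => y; rewrite fct_sumE.
  have -> : dot z (v *m 'J g w) = \sum_j z ord0 j * 'D_v (fun y => g y ord0 j) w.
    apply: eq_bigr => j _; rewrite -deriveEjacobian// derive_mx ?mxE//.
    exact: diff_derivable.
  apply: is_derive_sum => j.
  apply: is_deriveZ; apply: derivableP; exact: diff_derivable.
pose F t := l (a x + t *: (b x - a x)).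
have [||c c01 E] := @MVT_segment R F
  (fun t => dot z ((b x - a x) *m 'J g (a x + t *: (b x - a x)))) 0 1 ler01.
- move=> t; rewrite in_itv/= => /andP[t0 t1].
  have Vt : V (a x + t *: (b x - a x)) by apply/abV/seg; rewrite !ltW.
  have [dv dE] := dl _ Vt (b x - a x).
  rewrite -dE -derive_line; apply: derivableP; exact: derivable_line.
- apply: continuous_in_subspaceT => t; rewrite inE/= in_itv/= => t01.
  apply: (@continuous_for_comp _ _ _ (fun t : R => a x + t *: (b x - a x)) l).
    exact: continuous_line.
  have Vt : V (a x + t *: (b x - a x)) by exact/abV/seg.
  apply: continuous_for_sum => j; apply: continuous_forM; first exact: continuous_for_cst.
  apply: differentiable_continuous; apply: differentiable_rV_coord.
  by have [] := C1g Vt.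
have zz : enorm z ^+ 2 <= enorm z * (L * enorm (b x - a x)).
  rewrite sqr_enorm {2}/z dotBr.
  have -> : dot z (g (b x)) - dot z (g (a x)) = F 1 - F 0.
    by rewrite /F /l scale1r scale0r addr0 [a x + _]addrC subrK.
  rewrite E subr0 mulr1; apply: le_trans (ler_norm _) _.
  apply: le_trans (dot_le_enorm _ _) _; rewrite ler_wpM2l ?enorm_ge0//.
  apply: le_trans (enorm_mulmx _ _) _; rewrite ler_wpM2r ?enorm_ge0//.
  apply: ub_le_sup; first exact: jacobian_sup_bounded.
  exists (a x + c *: (b x - a x)) => //; apply: seg.
  by move: c01; rewrite in_itv.
have [z0|z0] := eqVneq (enorm z) 0; first by rewrite -/z z0 mulr_ge0 ?enorm_ge0.
have zp : 0 < enorm z by rewrite lt_neqAle eq_sym z0 enorm_ge0.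
by move: zz; rewrite expr2 ler_pM2l.
Qed.

End jacobian_bound.

(** * Vector calculus and the chain rule for entropy potentials *)

Section vector_calculus.
Context {R : realType}.

Lemma derive_rV_coord m n (f : 'rV[R]_m -> 'rV[R]_n) x v j : differentiable f x ->
  'D_v f x ord0 j = 'D_v (fun y => f y ord0 j) x.
Proof. by move=> df; rewrite derive_mx ?mxE//; exact: diff_derivable. Qed.

Lemma derive_chain (V1 V2 V3 : normedModType R) (f : V1 -> V2) (g : V2 -> V3) x v :
  differentiable f x -> differentiable g (f x) ->
  'D_v (fun y => g (f y)) x = 'D_('D_v f x) g (f x).
Proof.
move=> df dg; have dgf := differentiable_comp df dg.
by rewrite (deriveE _ dgf) (deriveE _ dg) (deriveE _ df) (diff_comp df dg).
Qed.

Lemma derive_sumZ m (W : normedModType R) (g : 'rV[R]_m -> W) x v : differentiable g x ->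
  'D_v g x = \sum_i v ord0 i *: pderiv i g x.
Proof.
move=> dg; rewrite deriveE// [in LHS](row_sum_delta v) linear_sum.
by apply: eq_bigr => i _; rewrite linearZ /pderiv deriveE.
Qed.

Lemma differentiable_dot m n (a b : 'rV[R]_m -> 'rV[R]_n) x :
  differentiable a x -> differentiable b x -> differentiable (fun y => dot (a y) (b y)) x.
Proof.
move=> da db.
rewrite (_ : (fun y => _) = \sum_j ((fun y => a y ord0 j) * (fun y => b y ord0 j))).
  by apply: differentiable_sum => j; apply: differentiableM; exact: differentiable_rV_coord.
by apply/funext => y; rewrite fct_sumE.
Qed.

Lemma derive_dot m n (a b : 'rV[R]_m -> 'rV[R]_n) x v :
  differentiable a x -> differentiable b x ->
  'D_v (fun y => dot (a y) (b y)) x = dot ('D_v a x) (b x) + dot (a x) ('D_v b x).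
Proof.
move=> da db.
have dj (c : 'rV[R]_m -> 'rV[R]_n) j : differentiable c x -> derivable (fun y => c y ord0 j) x v.
  by move=> dc; apply: diff_derivable; exact: differentiable_rV_coord.
rewrite (_ : (fun y => _) = \sum_j ((fun y => a y ord0 j) * (fun y => b y ord0 j))); last first.
  by apply/funext => y; rewrite fct_sumE.
rewrite derive_sum => [|j]; last by apply: derivableM; exact: dj.
rewrite /dot -big_split/=; apply: eq_bigr => j _.
rewrite deriveM; [|exact: dj|exact: dj].
rewrite (derive_rV_coord v j da) (derive_rV_coord v j db) addrC /GRing.scale /=.
by rewrite [b x _ _ * _]mulrC.
Qed.

Lemma continuous_for_dot (T : topologicalType) n (a b : T -> 'rV[R]_n) x :
  {for x, continuous a} -> {for x, continuous b} ->
  {for x, continuous (fun y => dot (a y) (b y))}.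
Proof.
move=> ca cb; apply: continuous_for_sum => j.
have cj (c : T -> 'rV[R]_n) : {for x, continuous c} -> {for x, continuous (fun y => c y ord0 j)}.
  move=> cc; apply: (@continuous_for_comp _ _ _ c (fun N : 'rV[R]_n => N ord0 j)) => //.
  exact: coord_continuous.
by apply: continuous_forM; exact: cj.
Qed.

Lemma continuous_forB_vec (T : topologicalType) n (a b : T -> 'rV[R]_n) x :
  {for x, continuous a} -> {for x, continuous b} ->
  {for x, continuous (fun y => a y - b y)}.
Proof. by move=> ca cb; exact: cvgB. Qed.

Lemma PNvec_differentiable m n N (w : 'rV[R]_m -> 'rV[R]_n) x : PNvec N w -> differentiable w x.
Proof.
move=> pw; apply: differentiable_rV => j.
exact: polN_differentiable ((PN_polN N _).1 (pw j)) x.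
Qed.

Lemma PNvec_derive m n N (w : 'rV[R]_m -> 'rV[R]_n) e : PNvec N w -> PNvec N ('D_e w).
Proof.
move=> pw j; apply/PN_polN.
rewrite (_ : (fun x => _) = 'D_e (fun y => w y ord0 j)).
  by apply: polN_derive; exact/PN_polN.
by apply/funext => x; rewrite derive_rV_coord//; exact: PNvec_differentiable pw.
Qed.

Lemma PNvec_continuous m n N (w : 'rV[R]_m -> 'rV[R]_n) x : PNvec N w ->
  {for x, continuous w}.
Proof. by move=> pw; apply: differentiable_continuous; exact: PNvec_differentiable pw. Qed.

End vector_calculus.

Section entropy_potential_gradient.
Context {R : realType} {d n : nat} (U V : set 'rV[R]_n).
Variables (f : 'I_d -> 'rV[R]_n -> 'rV[R]_n) (S : 'rV[R]_n -> R).
Variables (F : 'I_d -> 'rV[R]_n -> R) (uofv : 'rV[R]_n -> 'rV[R]_n).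
Notation v := (gradient S).
Hypothesis hS : entropy_pair U f S F.
Hypothesis hI : entropy_inverse U V f v uofv.

Lemma differentiable_potential i u : U u -> differentiable (entropy_potential v (f i) (F i)) u.
Proof.
move=> Uu; have [dv _] := entropy_C2 hS Uu; have [df _] := flux_C1 hS i Uu.
have dF := entropy_flux_diff hS i Uu.
by apply: differentiableB => //; exact: differentiable_dot.
Qed.

(** In the product rule, compatibility cancels the derivatives of [f i] against those of [F i]; only
    the derivative of the entropy variables remains. *)
Lemma derive_potential i u h : U u ->
  'D_h (entropy_potential v (f i) (F i)) u = dot ('D_h v u) (f i u).
Proof.
move=> Uu; have [dv _] := entropy_C2 hS Uu; have [df _] := flux_C1 hS i Uu.
have dF := entropy_flux_diff hS i Uu.
have ddot := differentiable_dot dv df.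
rewrite (_ : entropy_potential v (f i) (F i) = (fun y => dot (v y) (f i y)) - F i)//.
rewrite deriveB; [|exact: diff_derivable|exact: diff_derivable].
rewrite derive_dot// (derive_sumZ h df) (derive_sumZ h dF) dot_sumr.
rewrite -addrA -[RHS]addr0; congr (_ + _); apply/eqP; rewrite subr_eq0; apply/eqP.
by apply: eq_bigr => c _; rewrite dotZr (entropy_compat hS).
Qed.

Variables (m : nat) (w : 'rV[R]_m -> 'rV[R]_n).
Hypothesis dw : forall x, differentiable w x.

Lemma near_preimage x : V (w x) -> \forall y \near x, V (w y).
Proof.
move=> Vx; have cw := differentiable_continuous (dw x).
by apply: cw; apply: open_nbhs_nbhs; split => //; exact: inverse_open hI.
Qed.

(** The identity [v (uofv (w y)) = w y] holds near [x] because [V] is open, so the entropy variables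
    of the composite have derivative ['D_e w x]. *)
Lemma derive_potential_comp i x e : V (w x) ->
  differentiable (fun y => entropy_potential v (f i) (F i) (uofv (w y))) x /\
  'D_e (fun y => entropy_potential v (f i) (F i) (uofv (w y))) x =
  dot ('D_e w x) (f i (uofv (w x))).
Proof.
move=> Vx; have [Ux vx] := inverse_uK hI Vx.
have [du _] := inverse_C1 hI Vx.
have duw : differentiable (fun y => uofv (w y)) x by exact: (differentiable_comp (dw x) du).
have [dv _] := entropy_C2 hS Ux.
have dp := differentiable_potential i Ux.
split; first exact: (differentiable_comp duw dp).
rewrite (derive_chain e duw dp) derive_potential//; congr (dot _ _).
rewrite -(derive_chain e duw dv); apply: near_eq_derive.
by apply: filterS (near_preimage Vx) => y Vy; have [_ ->] := inverse_uK hI Vy.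
Qed.

(** The formula for the derivative holds on a neighbourhood of each point, and its right-hand side
    is continuous there. *)
Lemma C1_on_potential_comp i (D : set 'rV[R]_m) : (forall x, D x -> V (w x)) ->
  (forall x e, {for x, continuous ('D_e w)}) ->
  C1_on D (fun y => entropy_potential v (f i) (F i) (uofv (w y))).
Proof.
move=> DV cdw x Dx; have Vx := DV x Dx; split; first by have [] := derive_potential_comp i 0 Vx.
move=> e.
pose h := 'D_e (fun y => entropy_potential v (f i) (F i) (uofv (w y))).
suff : {for x, continuous h} by [].
have hE : {near x, (fun y => dot ('D_e w y) (f i (uofv (w y)))) =1 h}.
  apply: filterS (near_preimage Vx) => y Vy.
  by have [_ E] := derive_potential_comp i e Vy; exact/esym.
have ch : {for x, continuous (fun y => dot ('D_e w y) (f i (uofv (w y))))}.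
  apply: continuous_for_dot; first exact: cdw.
  have [dfu _] := inverse_flux_C1 hI i Vx.
  apply: (@continuous_for_comp _ _ _ w (f i \o uofv)).
    exact: differentiable_continuous.
  exact: differentiable_continuous.
have hx : h x = dot ('D_e w x) (f i (uofv (w x))).
  by have [_ E] := derive_potential_comp i e Vx; exact: E.
rewrite /prop_for /continuous_at hx.
by apply: cvg_trans ch; exact: near_eq_cvg hE.
Qed.

End entropy_potential_gradient.

(** * The entropy residual *)

Section entropy_correction.
Context {R : realType} {d n : nat} (N : nat) (U V : set 'rV[R]_n).
Variables (f : 'I_d.+1 -> 'rV[R]_n -> 'rV[R]_n) (S : 'rV[R]_n -> R).
Variables (F : 'I_d.+1 -> 'rV[R]_n -> R) (uofv : 'rV[R]_n -> 'rV[R]_n).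
Notation v := (gradient S).
Hypothesis hS : entropy_pair U f S F.
Hypothesis hI : entropy_inverse U V f v uofv.
Variables (p : 'I_d.+2 -> 'rV[R]_d.+1) (nu : 'I_d.+2 -> 'rV[R]_d.+1).
Notation D := (simplex p).
Hypothesis uE : edges p \in unitmx.
Hypothesis hnu : forall j, outward_unit_normal p j (nu j).
Variables uh vh : 'rV[R]_d.+1 -> 'rV[R]_n.
Hypothesis puh : PNvec N uh.
Hypothesis pvh : PNvec N vh.
Hypothesis uhU : forall x, D x -> U (uh x).
Hypothesis segV : segments D (v \o uh) vh `<=` V.

Lemma vh_in_V x : D x -> V (vh x).
Proof.
move=> Dx; apply: segV; exists x, 1; split => //; first by rewrite ler01 lexx.
by rewrite subrr scale0r add0r scale1r.
Qed.

Lemma continuous_v_uh x : D x -> {for x, continuous (v \o uh)}.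
Proof.
move=> Dx; apply: continuous_for_comp; first exact: PNvec_continuous puh.
by apply: differentiable_continuous; have [] := entropy_C2 hS (uhU Dx).
Qed.

Lemma continuous_flux_uh i x : D x -> {for x, continuous (fun y => f i (uh y))}.
Proof.
move=> Dx; apply: continuous_for_comp; first exact: PNvec_continuous puh.
by apply: differentiable_continuous; have [] := flux_C1 hS i (uhU Dx).
Qed.

Lemma continuous_flux_vh i x : D x -> {for x, continuous (fun y => f i (uofv (vh y)))}.
Proof.
move=> Dx; apply: (@continuous_for_comp _ _ _ vh (f i \o uofv)).
  exact: PNvec_continuous pvh.
by apply: differentiable_continuous; have [] := inverse_flux_C1 hI i (vh_in_V Dx).
Qed.

Lemma continuous_pderiv_vh i x : {for x, continuous (pderiv i vh)}.
Proof. exact: PNvec_continuous (PNvec_derive _ pvh). Qed.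

Notation psi i := (entropy_potential v (f i) (F i)).

Lemma delta_kE :
  delta_k p nu f (fun i => psi i) uh vh (uofv \o vh) =
  vol_int D (fun x => \sum_i dot (f i (uofv (vh x)) - f i (uh x)) (pderiv i vh x)).
Proof.
have cD := @simplex_compact R _ _ p.
rewrite (vol_int_sum _ _ (F := fun i x => dot (f i (uofv (vh x)) - f i (uh x)) (pderiv i vh x)) cD).
  2: { move=> i x Dx; apply: continuous_for_dot; last exact: continuous_pderiv_vh.
       by apply: continuous_forB_vec; [exact: continuous_flux_vh|exact: continuous_flux_uh]. }
apply: eq_bigr => i _.
have dvh x : differentiable vh x by exact: PNvec_differentiable pvh.
have C1psi : C1_on D (fun y => psi i (uofv (vh y))).
  apply: (C1_on_potential_comp hS hI dvh i vh_in_V) => x e.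
  exact: PNvec_continuous (PNvec_derive _ pvh).
have -> : bdry_int p (fun j x => psi i ((uofv \o vh) x) * nu j ord0 i) =
    vol_int D (fun x => dot (f i (uofv (vh x))) (pderiv i vh x)).
  rewrite (eq_vol_int (g := 'D_(delta_mx ord0 i) (fun y => psi i (uofv (vh y))))); last first.
    move=> x Dx; have [_ ->] := derive_potential_comp hS hI dvh i (delta_mx ord0 i) (vh_in_V Dx).
    exact: dotC.
  rewrite (gauss_simplex uE _ hnu C1psi) /bdry_int; apply: eq_bigr => j _.
  rewrite dot_delta mulrC -surf_intZr//.
  apply: continuous_integrable_rV; first exact: ref_simplex_compact.
  move=> s rs; apply: (@continuous_for_comp _ _ _ _ (fun y => psi i (uofv (vh y)))).
    exact: continuous_simplex_param.
  apply: differentiable_continuous.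
  by have [] := C1psi (simplex_param (facet p j) s) (simplex_facet _ _ rs).
rewrite addrC; rewrite -(vol_intD cD (f := fun x => dot (f i (uofv (vh x))) (pderiv i vh x))
  (g := fun x => - dot (f i (uh x)) (pderiv i vh x))).
- by apply: eq_vol_int => x _; rewrite dotBl.
- move=> x Dx; apply: continuous_for_dot; last exact: continuous_pderiv_vh.
  exact: continuous_flux_vh.
- move=> x Dx; apply: continuous_forN; apply: continuous_for_dot; last exact: continuous_pderiv_vh.
  exact: continuous_flux_uh.
Qed.

Let L i := jacobian_sup (segments D (v \o uh) vh) (f i \o uofv).
Let err x := v (uh x) - vh x.
Let E := vol_int D (fun x => dot (err x) (err x)).
Let G := vol_int D (fun x => \sum_i dot (pderiv i vh x) (pderiv i vh x)).

Lemma flux_error_le i x : D x ->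
  enorm (f i (uofv (vh x)) - f i (uh x)) <= L i * enorm (err x).
Proof.
move=> Dx.
have cvh y : D y -> {for y, continuous vh} by move=> _; exact: PNvec_continuous pvh.
have := lipschitz_segment (@simplex_compact R _ _ p) continuous_v_uh cvh segV
  (inverse_flux_C1 hI i) Dx.
have [_ uK] := inverse_vK hI (uhU Dx).
by rewrite /= uK /err -(enormN (vh x - _)) opprB.
Qed.

Lemma continuous_err x : D x -> {for x, continuous err}.
Proof.
move=> Dx; apply: continuous_forB_vec; first exact: continuous_v_uh.
exact: PNvec_continuous pvh.
Qed.

(** Young's inequality with a free parameter is pointwise and can be integrated directly; optimizing
    [tau] in [amgm_inf] then recovers the Cauchy-Schwarz bound. *)
Lemma delta_k_ge tau : 0 < tau ->
  - delta_k p nu f (fun i => psi i) uh vh (uofv \o vh) <=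
  (tau * ((\sum_i L i ^+ 2) * E) + G / tau) / 2.
Proof.
move=> tau0; have cD := @simplex_compact R _ _ p.
have cst a x : {for x, continuous (fun _ : 'rV[R]_d.+1 => a : R)} by exact: continuous_for_cst.
have cE : continuous_at_points D (fun x => dot (err x) (err x)).
  by move=> x Dx; apply: continuous_for_dot; exact: continuous_err.
have cG : continuous_at_points D (fun x => \sum_i dot (pderiv i vh x) (pderiv i vh x)).
  move=> x Dx; apply: continuous_for_sum => i; apply: continuous_for_dot; exact: continuous_pderiv_vh.
have cdel : continuous_at_points D
    (fun x => \sum_i dot (f i (uofv (vh x)) - f i (uh x)) (pderiv i vh x)).
  move=> x Dx; apply: continuous_for_sum => i.
  apply: continuous_for_dot; last exact: continuous_pderiv_vh.
  by apply: continuous_forB_vec; [exact: continuous_flux_vh|exact: continuous_flux_uh].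
rewrite delta_kE -mulN1r -(vol_intZ _ cD cdel).
pose A := tau * (\sum_i L i ^+ 2) / 2; pose B := (tau * 2)^-1.
have -> : (tau * ((\sum_i L i ^+ 2) * E) + G / tau) / 2 = A * E + B * G.
  by rewrite /A /B; field; lra.
rewrite /E /G -(vol_intZ _ cD cE) -(vol_intZ _ cD cG).
rewrite -(vol_intD cD (f := fun x => A * dot (err x) (err x))); last 2 first.
- by move=> x Dx; apply: continuous_forM => //; exact: cE.
- by move=> x Dx; apply: continuous_forM => //; exact: cG.
apply: vol_int_le => //.
- by move=> x Dx; apply: continuous_forM => //; exact: cdel.
- move=> x Dx; apply: continuous_forD; apply: continuous_forM => //; [exact: cE|exact: cG].
move=> x Dx.
have -> : A * dot (err x) (err x) = \sum_i tau * L i ^+ 2 * dot (err x) (err x) / 2.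
  move: (dot _ _) => c; rewrite /A mulr_sumr !mulr_suml; apply: eq_bigr => i _; ring.
rewrite mulN1r -sumrN mulr_sumr -big_split/=.
apply: ler_sum => i _.
set b := pderiv i vh x; set a := enorm (err x).
have h1 : - dot (f i (uofv (vh x)) - f i (uh x)) b <= L i * a * enorm b.
  apply: le_trans (ler_norm _) _; rewrite normrN; apply: le_trans (dot_le_enorm _ _) _.
  by apply: ler_wpM2r; [exact: enorm_ge0|exact: flux_error_le].
apply: le_trans h1 _; rewrite -!sqr_enorm -/a.
have h2 := sqr_ge0 (tau * (L i * a) - enorm b).
have t2 : 0 < tau * 2 by lra.
rewrite -subr_ge0.
have -> : tau * L i ^+ 2 * a ^+ 2 / 2 + B * enorm b ^+ 2 - L i * a * enorm b =
   (tau * (L i * a) - enorm b) ^+ 2 / (tau * 2) by rewrite /B; field; lra.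
by rewrite divr_ge0// ltW.
Qed.

End entropy_correction.

(** The optimal parameter is [sqrt B / sqrt A]. For [A = 0] there is none, and [tau = B / x]
    contradicts [x > 0] instead. *)
Lemma amgm_inf (R : realType) (A B x : R) : 0 <= A -> 0 < B ->
  (forall tau, 0 < tau -> x <= (tau * A + B / tau) / 2) ->
  x <= Num.sqrt A * Num.sqrt B.
Proof.
move=> A0 B0 h; have sB : 0 < Num.sqrt B by rewrite sqrtr_gt0.
have BE : B = Num.sqrt B ^+ 2 by rewrite sqr_sqrtr// ltW.
have AE : A = Num.sqrt A ^+ 2 by rewrite sqr_sqrtr.
have [A00|An0] := eqVneq A 0.
  rewrite A00 sqrtr0 mul0r leNgt; apply/negP => x0.
  have := h (B / x) (divr_gt0 B0 x0); rewrite A00 mulr0 add0r invf_div.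
  have -> : B * (x / B) = x by field; lra.
  lra.
have sA : 0 < Num.sqrt A by rewrite sqrtr_gt0 lt_neqAle eq_sym An0.
have := h (Num.sqrt B / Num.sqrt A) (divr_gt0 sB sA).
move: sA sB AE BE; move: (Num.sqrt A) (Num.sqrt B) => a b sA sB -> ->.
by have -> : (b / a * a ^+ 2 + b ^+ 2 / (b / a)) / 2 = a * b by field; lra.
Qed.

Lemma row_coord_continuous (T : topologicalType) (R : realType) n (w : T -> 'rV[R]_n) c x :
  {for x, continuous w} -> {for x, continuous (fun y => w y ord0 c)}.
Proof.
move=> cw; apply: (@continuous_for_comp _ _ _ w (fun z : 'rV[R]_n => z ord0 c)) => //.
exact: coord_continuous.
Qed.

(** Reduces vector fields to scalar components, on which the polynomial inequalities hold with
    constants independent of the number of components. *)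
Lemma vol_int_sum_dot (R : realType) m n k (K : set 'rV[R]_m)
    (w : 'I_k -> 'rV[R]_m -> 'rV[R]_n) : compact K ->
  (forall i x, K x -> {for x, continuous (w i)}) ->
  vol_int K (fun x => \sum_i dot (w i x) (w i x)) =
  \sum_c \sum_i vol_int K (fun x => w i x ord0 c ^+ 2).
Proof.
move=> cK cw; rewrite exchange_big/=.
rewrite (vol_int_sum _ _ (F := fun i x => dot (w i x) (w i x)) cK); last first.
  by move=> i x Kx; apply: continuous_for_dot; exact: cw.
apply: eq_bigr => i _.
rewrite -(vol_int_sum _ _ (F := fun c x => w i x ord0 c ^+ 2) cK).
  by apply: eq_vol_int => x _; apply: eq_bigr => c _; rewrite expr2.
by move=> c x Kx; have h := row_coord_continuous (c := c) (cw i x Kx); exact: (continuous_forM h h).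
Qed.

Lemma vol_int_dot (R : realType) m n (K : set 'rV[R]_m) (w : 'rV[R]_m -> 'rV[R]_n) :
  compact K -> (forall x, K x -> {for x, continuous w}) ->
  vol_int K (fun x => dot (w x) (w x)) = \sum_c vol_int K (fun x => w x ord0 c ^+ 2).
Proof.
move=> cK cw.
rewrite -(vol_int_sum _ _ (F := fun c x => w x ord0 c ^+ 2) cK).
  by apply: eq_vol_int => x _; apply: eq_bigr => c _; rewrite expr2.
by move=> c x Kx; have h := row_coord_continuous (c := c) (cw x Kx); exact: (continuous_forM h h).
Qed.

Lemma PNvec_polN (R : realType) m n N (w : 'rV[R]_m -> 'rV[R]_n) c :
  PNvec N w -> polN N (fun x => w x ord0 c).
Proof. by move=> /(_ c) /PN_polN. Qed.

Lemma pderiv_coord_PNvec (R : realType) m n N (w : 'rV[R]_m -> 'rV[R]_n) i c x :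
  PNvec N w -> pderiv i w x ord0 c = pderiv i (fun y => w y ord0 c) x.
Proof. by move=> pw; apply: derive_rV_coord; exact: PNvec_differentiable pw. Qed.

(** * The LDG gradient of vector-valued polynomials *)

Section ldg_vector.
Context {R : realType} {d n : nat} (N : nat) (p : 'I_d.+2 -> 'rV[R]_d.+1).
Variables (nu : 'I_d.+2 -> 'rV[R]_d.+1) (v0 : 'rV[R]_d.+1).
Hypothesis uE : edges p \in unitmx.
Hypothesis hnu : forall j, outward_unit_normal p j (nu j).
Hypothesis v00 : v0 != 0.
Notation D := (simplex p).
Variables (vh : 'rV[R]_d.+1 -> 'rV[R]_n) (vp : 'I_d.+2 -> 'rV[R]_d.+1 -> 'rV[R]_n).
Variable Theta : 'I_d.+1 -> 'rV[R]_d.+1 -> 'rV[R]_n.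
Hypothesis pvh : PNvec N vh.
Hypothesis ivp : forall j c, surf_integrable (facet p j) (fun x => vp j x ord0 c).
Hypothesis hTheta : forall i, LDG_derivative N p nu v0 vh vp i (Theta i).

Let flux j x := avg (vp j x) (vh x) - (Num.sg (dot v0 (nu j)) / 2) *: jump (vp j x) (vh x).

Let surf_integrable_flux j c : surf_integrable (facet p j) (fun x => flux j x ord0 c).
Proof.
have cref := @ref_simplex_compact R d.
set s := Num.sg (dot v0 (nu j)).
(* The flux is [1/2 - s/2] times the exterior trace plus [1/2 + s/2] times the interior one. *)
have i1 := surf_integrableM (h := fun=> 2^-1 - s / 2) (ivp j c) (fun x => @continuous_for_cst R _ _ x).
have i2 : surf_integrable (facet p j) (fun x => (2^-1 + s / 2) * vh x ord0 c).
  apply: continuous_integrable_rV => // t _.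
  apply: (@continuous_for_comp _ _ _ _ (fun y => (2^-1 + s / 2) * vh y ord0 c)).
    exact: continuous_simplex_param.
  by exact: polN_continuous (polNZ (2^-1 + s / 2) (PNvec_polN c pvh)) _.
have := integrableD (compact_measurable_rV cref) i1 i2.
by apply: eq_integrable => [|t _]; [exact: compact_measurable_rV|
  rewrite /flux/= !mxE -/s; congr (_%:E); ring].
Qed.

(** Testing with a scalar polynomial times a unit vector decouples the components. *)
Let ldg_coord c i phi : polN N phi ->
  vol_int D (fun x => Theta i x ord0 c * phi x) =
  vol_int D (fun x => - (vh x ord0 c * pderiv i phi x)) +
  bdry_int p (fun j x => flux j x ord0 c * phi x * nu j ord0 i).
Proof.
move=> pphi; pose w x := phi x *: (delta_mx ord0 c : 'rV[R]_n).
have wE x e : w x ord0 e = (e == c)%:R * phi x by rewrite /w mxE mxE eqxx/= mulrC.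
have pw : PNvec N w.
  move=> e; apply/PN_polN; rewrite (_ : (fun x => _) = fun x => (e == c)%:R * phi x).
    exact: polNZ.
  by apply/funext => x; rewrite wE.
have dotw a x : dot a (w x) = a ord0 c * phi x by rewrite dotZr dot_delta mulrC.
have := (hTheta i).2 w pw.
rewrite (eq_vol_int (g := fun x => Theta i x ord0 c * phi x)); last by move=> x _; rewrite dotw.
move=> ->; congr (_ + _).
  apply: eq_vol_int => x _.
  have -> : pderiv i w x = pderiv i phi x *: delta_mx ord0 c; last by rewrite dotZr dot_delta mulrC.
  apply/rowP => e; rewrite (pderiv_coord_PNvec _ _ _ pw) !mxE eqxx/=.
  have -> : (fun y => w y ord0 e) = ((e == c)%:R *: phi) by apply/funext => y; rewrite wE.
  have dphi : derivable phi x (delta_mx ord0 i).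
    by apply: diff_derivable; exact: polN_differentiable pphi x.
  rewrite /pderiv (deriveZ _ dphi); exact: mulrC.
by apply: eq_bigr => j _; congr (_ * _); apply: eq_vol_int => t _; rewrite /= dotw.
Qed.

Lemma LDG_gradient_bound (C sigma : R) :
  (forall j q, polN N q -> vol_int D (fun x => q x ^+ 2) <=
     C * vol_int D (fun x => bary_coord p j x * q x ^+ 2)) ->
  diam D <= sigma * inradius D ->
  vol_int D (fun x => \sum_i dot (pderiv i vh x) (pderiv i vh x)) <=
  (d.+2%:R * C * sigma) ^+ 2 * vol_int D (fun x => \sum_i dot (Theta i x) (Theta i x)).
Proof.
move=> CP hs; have cD := @simplex_compact R _ _ p.
rewrite (vol_int_sum_dot (w := fun i => pderiv i vh) cD); last first.
  by move=> i x _; exact: PNvec_continuous (PNvec_derive _ pvh).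
rewrite (vol_int_sum_dot (w := Theta) cD); last first.
  by move=> i x _; exact: PNvec_continuous (hTheta i).1.
rewrite mulr_sumr; apply: ler_sum => c _.
have [j0 j0P] := exists_outflow_face uE hnu v00.
have := @ldg_gradient_bound R d N p nu uE hnu (fun i x => Theta i x ord0 c)
  (fun x => vh x ord0 c) (fun j x => flux j x ord0 c) j0 (PNvec_polN c pvh)
  (fun i => PNvec_polN c (hTheta i).1) (fun j => surf_integrable_flux j c) _
  (ldg_coord c) C CP sigma hs.
under [X in _ -> X <= _]eq_bigr => i _.
  rewrite (eq_vol_int (g := fun x => pderiv i (fun y => vh y ord0 c) x ^+ 2)); last first.
    by move=> x _; rewrite (pderiv_coord_PNvec _ _ _ pvh).
  over.
(* On the face [j0] the sign is 1, and the average minus half the jump is the interior trace. *)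
by apply => x; rewrite /flux gtr0_sg// !mxE; field.
Qed.

End ldg_vector.

Lemma L2normE (R : realType) m n (K : set 'rV[R]_m) (g : 'rV[R]_m -> 'rV[R]_n) :
  L2norm K g ^+ 2 = vol_int K (fun x => dot (g x) (g x)).
Proof.
rewrite /L2norm sqr_sqrtr; first by apply: eq_vol_int => x _; exact: sqr_enorm.
by apply: vol_int_ge0 => x _; exact: sqr_ge0.
Qed.

(** * The projected entropy variables *)

Section projection.
Context {R : realType} {d n : nat} (N : nat) (p : 'I_d.+2 -> 'rV[R]_d.+1).
Hypothesis uE : edges p \in unitmx.
Notation D := (simplex p).

Lemma simplex_volume_neq0 : fine (lebesgue_rV R d.+1 D) != 0.
Proof.
have cD := @simplex_compact R _ _ p.
have := vol_int_cst 1 cD; rewrite mul1r => <-.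
rewrite vol_int_simplex_cont//; last by move=> x _; exact: continuous_for_cst.
rewrite mulf_neq0//; first by rewrite normr_eq0 -unitfE -unitmxE.
rewrite (eq_vol_int (g := fun=> 1))// vol_int_cst; last exact: ref_simplex_compact.
by rewrite mul1r gt_eqF// vol_ref_simplex_gt0.
Qed.

Lemma vol_int_simplex_eq0 g : continuous_at_points D g -> (forall x, D x -> 0 <= g x) ->
  vol_int D g = 0 -> forall x, D x -> g x = 0.
Proof.
move=> cg g0; rewrite vol_int_simplex_cont// => /eqP; rewrite mulf_eq0 normr_eq0.
rewrite -[_ == 0]negbK -unitfE -unitmxE uE/= => /eqP ig x.
rewrite simplex_param_image => -[s rs <-].
apply: (vol_int_ref_eq0 (f := g \o simplex_param p)) => // t rt.
  apply: (@continuous_for_comp _ _ _ _ g); first exact: continuous_simplex_param.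
  by apply: cg; exact: simplex_param_in.
by apply: g0; exact: simplex_param_in.
Qed.

Variables w vh : 'rV[R]_d.+1 -> 'rV[R]_n.
Hypothesis cw : forall x, D x -> {for x, continuous w}.
Hypothesis hvh : L2_projection N D w vh.
Notation mean := (integral_mean D w).
Notation dv := (fun x => w x - mean).

Let cD := @simplex_compact R _ _ p.
Let pvhc c : polN N (fun x => vh x ord0 c - mean ord0 c).
Proof. by apply: polND; [exact: PNvec_polN hvh.1|exact: polN_cst]. Qed.

Let cwc c x : D x -> {for x, continuous (fun y => w y ord0 c)}.
Proof. by move=> Dx; apply: row_coord_continuous; exact: cw. Qed.

Let cvhc c x : {for x, continuous (fun y => vh y ord0 c)}.
Proof. exact: polN_continuous (PNvec_polN c hvh.1) x. Qed.

(** [L2_projection] is a relation, so the projection of [dv] has to be identified. Constants are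
    polynomials, so [vh - mean] is a projection too; the difference of two projections is orthogonal
    to itself, and a continuous square of integral zero vanishes on [D]. *)
Lemma L2_projection_sub_mean pdv : L2_projection N D dv pdv ->
  forall x, D x -> pdv x = vh x - mean.
Proof.
move=> hpdv x Dx; apply/rowP => c.
pose q y := vh y ord0 c - mean ord0 c - pdv y ord0 c.
have ppc : polN N (fun y => pdv y ord0 c) by exact: PNvec_polN hpdv.1.
have pq : polN N q.
  apply: polND; first exact: pvhc.
  by have := polNZ (-1) ppc; congr polN; apply/funext => y; rewrite mulN1r.
have cq y : {for y, continuous q} by exact: polN_continuous pq y.
have cp y : {for y, continuous (fun y => pdv y ord0 c)} by exact: polN_continuous ppc y.
have /PN_polN pq' := pq.
have h1 := hvh.2 c q pq'; have h2 := hpdv.2 c q pq'.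
have i2 : vol_int D (fun y => q y ^+ 2) = 0.
  rewrite -[RHS]subr0 -{1}h2 -h1 -vol_intB//.
  - by apply: eq_vol_int => y _; rewrite /q !mxE; ring.
  - move=> y Dy; apply: continuous_forM; last exact: cq.
    apply: continuous_forB; last exact: cp.
    rewrite (_ : (fun y => _) = fun y => w y ord0 c - mean ord0 c).
      by apply: continuous_forB; [exact: cwc|exact: continuous_for_cst].
    by apply/funext => z; rewrite !mxE.
  - move=> y Dy; apply: continuous_forM; last exact: cq.
    by apply: continuous_forB; [exact: cwc|exact: cvhc].
have cq2 : continuous_at_points D (fun y => q y ^+ 2).
  by move=> y _; exact: (continuous_forM (cq y) (cq y)).
have /eqP := vol_int_simplex_eq0 cq2 (fun y _ => sqr_ge0 (q y)) i2 Dx.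
by rewrite sqrf_eq0 subr_eq0 !mxE => /eqP <-.
Qed.

(** The constant 1 is a test polynomial, so projecting preserves the mean. *)
Lemma vol_int_projection_mean0 c : vol_int D (fun x => vh x ord0 c - mean ord0 c) = 0.
Proof.
have P1 : PN N (fun _ : 'rV[R]_d.+1 => 1) by apply/PN_polN; exact: polN_cst.
have := hvh.2 c _ P1.
rewrite (eq_vol_int (g := fun x => w x ord0 c - vh x ord0 c)); last by move=> x _; rewrite mulr1.
rewrite (vol_intB (f := fun x => w x ord0 c) (g := fun x => vh x ord0 c) cD);
  [|by move=> x; exact: cwc|by move=> x _; exact: cvhc].
move/subr0_eq => wE.
rewrite (vol_intB (f := fun x => vh x ord0 c) (g := fun=> mean ord0 c) cD);
  [|by move=> x _; exact: cvhc|by move=> x _; exact: continuous_for_cst].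
rewrite vol_int_cst// -wE !mxE mulrAC mulVf ?mul1r ?subrr//.
exact: simplex_volume_neq0.
Qed.

(** The cross term vanishes because each component of [vh - mean] is a test polynomial. *)
Lemma projection_pythagoras :
  vol_int D (fun x => dot (w x - mean) (w x - mean)) =
  vol_int D (fun x => dot (w x - vh x) (w x - vh x)) +
  vol_int D (fun x => dot (vh x - mean) (vh x - mean)).
Proof.
have cm x : {for x, continuous (fun _ : 'rV[R]_d.+1 => mean)} by exact: cst_continuous.
have cv x : {for x, continuous vh} by exact: PNvec_continuous hvh.1.
rewrite (vol_int_dot (w := fun x => w x - mean) cD); last first.
  by move=> x Dx; apply: continuous_forB_vec; [exact: cw|exact: cm].
rewrite (vol_int_dot (w := fun x => w x - vh x) cD); last first.
  by move=> x Dx; apply: continuous_forB_vec; [exact: cw|exact: cv].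
rewrite (vol_int_dot (w := fun x => vh x - mean) cD); last first.
  by move=> x Dx; apply: continuous_forB_vec; [exact: cv|exact: cm].
rewrite -big_split/=; apply: eq_bigr => c _.
pose q x := vh x ord0 c - mean ord0 c; pose e x := w x ord0 c - vh x ord0 c.
have cq x : {for x, continuous q} by exact: polN_continuous (pvhc c) x.
have ce x : D x -> {for x, continuous e}.
  by move=> Dx; apply: continuous_forB; [exact: cwc|exact: cvhc].
have eq0 : vol_int D (fun x => e x * q x) = 0.
  by apply: hvh.2; apply/PN_polN; exact: pvhc.
transitivity (vol_int D (fun x => (e x ^+ 2 + q x ^+ 2) + 2 * (e x * q x))).
  by apply: eq_vol_int => x _; rewrite /e /q !mxE; ring.
have ce2 : continuous_at_points D (fun x => e x ^+ 2).
  by move=> x Dx; exact: (continuous_forM (ce x Dx) (ce x Dx)).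
have cq2 : continuous_at_points D (fun x => q x ^+ 2).
  by move=> x Dx; exact: (continuous_forM (cq x) (cq x)).
have ceq : continuous_at_points D (fun x => e x * q x).
  by move=> x Dx; exact: (continuous_forM (ce x Dx) (cq x)).
rewrite (vol_intD cD (f := fun x => e x ^+ 2 + q x ^+ 2) (g := fun x => 2 * (e x * q x))).
- rewrite (vol_intZ _ cD ceq) eq0 mulr0 addr0 (vol_intD cD ce2 cq2).
  by congr (_ + _); apply: eq_vol_int => x _; rewrite /e /q !mxE.
- by move=> x Dx; apply: continuous_forD; [exact: ce2|exact: cq2].
- by move=> x Dx; apply: continuous_forM; [exact: continuous_for_cst|exact: ceq].
Qed.

Lemma projection_poincare (Cp : R) : 0 < Cp ->
  (forall q, polN N q -> vol_int D q = 0 -> vol_int D (fun x => q x ^+ 2) <=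
     Cp * \sum_k vol_int D (fun x => 'D_(row k (edges p)) q x ^+ 2)) ->
  vol_int D (fun x => dot (vh x - mean) (vh x - mean)) <=
  Cp * d.+1%:R * diam D ^+ 2 *
    vol_int D (fun x => \sum_i dot (pderiv i vh x) (pderiv i vh x)).
Proof.
move=> Cp0 hC.
have cm x : {for x, continuous (fun _ : 'rV[R]_d.+1 => mean)} by exact: cst_continuous.
have cv x : {for x, continuous vh} by exact: PNvec_continuous hvh.1.
rewrite (vol_int_dot (w := fun x => vh x - mean) cD); last first.
  by move=> x Dx; apply: continuous_forB_vec; [exact: cv|exact: cm].
rewrite (vol_int_sum_dot (w := fun i => pderiv i vh) cD); last first.
  by move=> i x _; exact: PNvec_continuous (PNvec_derive _ hvh.1).
rewrite mulr_sumr; apply: ler_sum => c _.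
pose q x := vh x ord0 c - mean ord0 c.
have pq : polN N q by exact: pvhc.
have -> : vol_int D (fun x => (vh x - mean) ord0 c ^+ 2) = vol_int D (fun x => q x ^+ 2).
  by apply: eq_vol_int => x _; rewrite /q !mxE.
have -> : \sum_i vol_int D (fun x => pderiv i vh x ord0 c ^+ 2) =
    \sum_i vol_int D (fun x => pderiv i q x ^+ 2).
  apply: eq_bigr => i _; apply: eq_vol_int => x _.
  rewrite (pderiv_coord_PNvec _ _ _ hvh.1) /q /pderiv.
  have dv1 : derivable (fun y => vh y ord0 c) x (delta_mx ord0 i).
    by apply: diff_derivable; exact: polN_differentiable (PNvec_polN c hvh.1) x.
  by rewrite (deriveB dv1 (derivable_cst _ _ _)) derive_cst subr0.
apply: (poincare_gradient (N := N)) => //.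
by apply: hC => //; exact: vol_int_projection_mean0.
Qed.

End projection.

(** * The viscosity coefficient *)

Section coefficient_bound.
Context {R : realType} (del den E G P SL T K1 K2 diam h : R).
Hypothesis den0 : 0 < den.
Hypothesis E0 : 0 <= E.
Hypothesis G0 : 0 <= G.
Hypothesis P0 : 0 < P.
Hypothesis SL0 : 0 <= SL.
Hypothesis K10 : 0 <= K1.
Hypothesis K20 : 0 <= K2.
Hypothesis diam0 : 0 <= diam.
Hypothesis diamh : diam <= h.
Hypothesis delE : forall tau, 0 < tau -> - del <= (tau * (SL * E) + G / tau) / 2.
Hypothesis GT : G <= K1 * T.
Hypothesis PG : P <= K2 * diam ^+ 2 * G.

(** By the Poincare estimate, a nonzero projected fluctuation has a nonzero gradient. *)
Let Gp : 0 < G.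
Proof.
rewrite lt_neqAle G0 andbT eq_sym; apply/eqP => g0.
by move: PG; rewrite g0 mulr0 leNgt P0.
Qed.

Let min_del : - Num.min 0 del <= Num.sqrt SL * Num.sqrt E * Num.sqrt G.
Proof.
rewrite oppr_min oppr0 ge_max; apply/andP; split.
  by rewrite !mulr_ge0 ?sqrtr_ge0.
by rewrite -sqrtrM//; apply: amgm_inf => //; rewrite mulr_ge0.
Qed.

(** Serves the case where [1 / lambda] has infinite norm but is multiplied by zero. Then the
    Lipschitz factor or the projection error is zero, so [del] is nonnegative and the coefficient
    vanishes. *)
Lemma coefficient_bound0 : Num.sqrt SL * Num.sqrt (E / P) = 0 -> - Num.min 0 del / den <= 0.
Proof.
move=> st; rewrite pmulr_lle0 ?invr_gt0//; apply: le_trans min_del _.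
have /orP[|] : (Num.sqrt SL == 0) || (Num.sqrt (E / P) == 0) by rewrite -mulf_eq0 st.
  by move=> /eqP ->; rewrite !mul0r.
rewrite sqrtrM// mulf_eq0 => /orP[/eqP ->|]; first by rewrite mulr0 mul0r.
by rewrite sqrtr_eq0 leNgt invr_gt0 P0.
Qed.

(** The numerator is at most of order [sqrt G] and the denominator at least of order [G], so the
    quotient is of order [1 / sqrt G], which [PG] turns into [h / sqrt P]. The summand 1 keeps the
    constant positive even when [K1] is 0. *)
Lemma coefficient_bound (r : R) : T <= r * den ->
  - Num.min 0 del / den <=
  (K1 * Num.sqrt K2 + 1) * (r * Num.sqrt SL * Num.sqrt (E / P)) * h.
Proof.
move=> Tr; have gp : 0 < Num.sqrt G by rewrite sqrtr_gt0.
have pp : 0 < Num.sqrt P by rewrite sqrtr_gt0.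
have h0 : 0 <= h by exact: le_trans diamh.
have r0 : 0 <= r.
  rewrite -(pmulr_lge0 _ den0); apply: le_trans Tr.
  rewrite leNgt; apply/negP => T0; move: Gp; rewrite ltNge; apply/negP; rewrite negbK.
  by apply: le_trans GT _; apply: mulr_ge0_le0 => //; exact: ltW.
have pk : Num.sqrt P <= Num.sqrt K2 * diam * Num.sqrt G.
  rewrite -[X in Num.sqrt K2 * X](ger0_norm diam0) -sqrtr_sqr -!sqrtrM ?mulr_ge0 ?sqr_ge0//.
  exact: ler_wsqrtr.
have gd : Num.sqrt G ^+ 2 <= K1 * r * den.
  rewrite sqr_sqrtr//; apply: le_trans GT _; rewrite -mulrA.
  by apply: ler_wpM2l.
rewrite sqrtrM// sqrtrV; last exact: ltW.
set l := Num.sqrt SL; set e := Num.sqrt E.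
move: gp pp pk gd min_del; rewrite -/l -/e.
have l0 : 0 <= l by exact: sqrtr_ge0.
have e0 : 0 <= e by exact: sqrtr_ge0.
have k0 : 0 <= Num.sqrt K2 by exact: sqrtr_ge0.
move: l e l0 e0 k0 => l e l0 e0.
move: (Num.sqrt G) (Num.sqrt P) (Num.sqrt K2) => g q k k0 gp qp pk gd md.
have h1 : g / den <= K1 * r / g.
  by rewrite ler_pdivrMr// mulrAC ler_pdivlMr// -expr2.
have h2 : g^-1 <= k * h / q.
  rewrite -(ler_pM2r gp) mulVf ?gt_eqF// mulrAC ler_pdivlMr// mul1r.
  by apply: le_trans pk _; rewrite ler_pM2r// ler_wpM2l.
apply: (@le_trans _ _ (l * e * g / den)); first by rewrite ler_pM2r ?invr_gt0.
apply: (@le_trans _ _ (l * e * (K1 * r * (k * h / q)))).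
  rewrite -mulrA; apply: ler_wpM2l; first exact: mulr_ge0.
  apply: le_trans h1 _; apply: ler_wpM2l => //; exact: mulr_ge0.
rewrite -subr_ge0.
have -> : (K1 * k + 1) * (r * l * (e / q)) * h - l * e * (K1 * r * (k * h / q)) =
  r * l * e * h * q^-1 by ring.
by rewrite !mulr_ge0// invr_ge0 ltW.
Qed.

End coefficient_bound.

(** * From pointwise coercivity to an integral bound *)

Section weighted_bound.
Context {R : realType} {m : nat} (D : set 'rV[R]_m) (a b lambda : 'rV[R]_m -> R).
Notation mu := (lebesgue_rV R m).
Hypothesis cD : compact D.
Hypothesis ca : continuous_at_points D a.
Hypothesis a0 : forall x, D x -> 0 <= a x.
Hypothesis mb : measurable_fun D b.
Hypothesis lambda0 : forall x, D x -> 0 < lambda x.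
Hypothesis ab : forall x, D x -> lambda x * a x <= b x.
Hypothesis b_neq0 : vol_int D b != 0.

Let b0 x : D x -> 0 <= b x.
Proof.
by move=> Dx; apply: le_trans (ab Dx); rewrite mulr_ge0 ?a0// ltW ?lambda0.
Qed.

Lemma vol_int_weighted_le (r : R) :
  Linfnorm D (fun x => (lambda x)^-1) = r%:E -> vol_int D a <= r * vol_int D b.
Proof.
have mD := compact_measurable_rV cD.
have mbE : measurable_fun D (EFin \o b) by exact/measurable_EFinP.
(* [fine] would turn an infinite integral into 0, so the nonzero value yields integrability of
   [b]. *)
have ibE : (\int[mu]_(x in D) (b x)%:E \is a fin_num)%E.
  rewrite ge0_fin_numE; last by apply: integral_ge0 => x Dx; rewrite lee_fin b0.
  rewrite ltey; apply/eqP => boo; move: b_neq0.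
  by rewrite /vol_int /Rintegral boo eqxx.
have ib : mu.-integrable D (EFin \o b).
  apply/integrableP; split => //.
  under eq_integral => x /set_mem Dx do rewrite /= ger0_norm ?b0//.
  by rewrite ltey_eq ibE.
(* The norm of index [+oo] is an essential supremum only on a space of positive measure. *)
have mu0 : (0 < mu setT)%E.
  rewrite lt_neqAle measure_ge0 andbT eq_sym; apply/eqP => muT; move: b_neq0.
  have muD : mu D = 0%E.
    by apply/eqP; rewrite -measure_le0 -muT; apply: le_measure; rewrite ?inE.
  by rewrite /vol_int /Rintegral (null_set_integral mD mbE muD) eqxx.
move=> Lr; have r0 : 0 <= r by rewrite -lee_fin -Lr; exact: Lnorm_ge0.
have aeL : {ae mu, forall x, D x -> (lambda x)^-1 <= r}.
  have := ess_sup_ge mu (abse \o (EFin \o ((fun x => (lambda x)^-1) \_ D))).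
  move: Lr; rewrite /Linfnorm unlock mu0 => ->.
  apply: filterS => x /= h Dx; move: h; rewrite patchE mem_set//= lee_fin.
  by apply: le_trans; exact: ler_norm.
have : (\int[mu]_(x in D) (a x)%:E <= \int[mu]_(x in D) (r%:E * (b x)%:E))%E.
  apply: ae_ge0_le_integral => //.
  - by apply/measurable_EFinP; exact: measurable_fun_continuous_rV.
  - by move=> x Dx; rewrite -EFinM lee_fin mulr_ge0// b0.
  - by apply: measurable_funeM.
  - apply: filterS aeL => x h Dx; rewrite -EFinM lee_fin.
    have l0 := lambda0 Dx.
    have -> : a x = (lambda x)^-1 * (lambda x * a x) by rewrite mulKf// gt_eqF.
    apply: le_trans (_ : (lambda x)^-1 * b x <= _); first by rewrite ler_pM2l ?invr_gt0// ab.
    by rewrite ler_wpM2r ?b0// h.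
rewrite integralZl// => h; rewrite /vol_int /Rintegral -[r in leRHS]/(fine r%:E) -fineM//.
apply: fine_le => //.
  rewrite ge0_fin_numE; last by apply: integral_ge0 => x Dx; rewrite lee_fin a0.
  apply: le_lt_trans h _; rewrite -ge0_fin_numE ?fin_numM//.
  by apply: mule_ge0 => //; apply: integral_ge0 => x Dx; rewrite lee_fin b0.
by rewrite fin_numM.
Qed.

End weighted_bound.

(** The constant is chosen before [n], the conservation law, the mesh and the discrete solution: the
    reference constants depend on [d] and [N], the geometry enters through [sigma], and components
    are treated one by one. *)
Theorem lemma4 (R : realType) (d N : nat) (sigma : R) :
  exists2 C : R, 0 < C &
  forall (n : nat)
    (U V : set 'rV[R]_n)
    (f : 'I_d.+1 -> 'rV[R]_n -> 'rV[R]_n)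
    (S : 'rV[R]_n -> R) (F : 'I_d.+1 -> 'rV[R]_n -> R)
    (uofv : 'rV[R]_n -> 'rV[R]_n),
  let v := gradient S in
  let psi := fun i => entropy_potential v (f i) (F i) in
  entropy_pair U f S F ->
  entropy_inverse U V f v uofv ->
  forall (M : finType) (vtx : M -> 'I_d.+2 -> 'rV[R]_d.+1),
  triangulation vtx ->
  shape_regular vtx sigma ->
  forall uh vh : M -> 'rV[R]_d.+1 -> 'rV[R]_n,
  (forall l, PNvec N (uh l)) ->
  (forall l x, simplex (vtx l) x -> U (uh l x)) ->
  (forall l, L2_projection N (simplex (vtx l)) (v \o uh l) (vh l)) ->
  forall k : M,
  let D := simplex (vtx k) in
  segments D (v \o uh k) (vh k) `<=` V ->
  forall (nu : 'I_d.+2 -> 'rV[R]_d.+1) (v0 : 'rV[R]_d.+1),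
  (forall j, outward_unit_normal (vtx k) j (nu j)) ->
  v0 != 0 ->
  forall vp : 'I_d.+2 -> 'rV[R]_d.+1 -> 'rV[R]_n,
  (forall j l x, neighbor vtx k j l -> simplex (facet (vtx k) j) x ->
     vp j x = vh l x) ->
  (forall j c, surf_integrable (facet (vtx k) j) (fun x => vp j x ord0 c)) ->
  forall Theta : 'I_d.+1 -> 'rV[R]_d.+1 -> 'rV[R]_n,
  (forall i, LDG_derivative N (vtx k) nu v0 (vh k) vp i (Theta i)) ->
  forall (K : 'I_d.+1 -> 'I_d.+1 -> 'rV[R]_d.+1 -> 'M[R]_n)
    (lambda : 'rV[R]_d.+1 -> R),
  (forall i j a b, measurable_fun D (fun x => K i j x a b)) ->
  (forall x, D x -> sym_psd (\mxblock_(i < d.+1, j < d.+1) K i j x)) ->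
  measurable_fun D lambda ->
  (forall x, D x -> 0 < lambda x) ->
  (forall x, D x ->
     lambda x * (\sum_i dot (Theta i x) (Theta i x)) <=
     viscous_form K Theta x) ->
  let ut := uofv \o vh k in
  (forall x, D x -> differentiable ut x) ->
  (forall m x, D x -> differentiable (f m \o ut) x) ->
  let dv := fun x => v (uh k x) - integral_mean D (v \o uh k) in
  forall pdv : 'rV[R]_d.+1 -> 'rV[R]_n,
  L2_projection N D dv pdv ->
  vol_int D (viscous_form K Theta) != 0 ->
  L2norm D pdv ^+ 2 != 0 ->
  let L := fun i =>
    jacobian_sup (segments D (v \o uh k) (vh k)) (f i \o uofv) in
  ((eps_k (vtx k) K Theta (delta_k (vtx k) nu f psi (uh k) (vh k) ut))%:E
   <= C%:E * C_uh D lambda L dv pdv * (mesh_size vtx)%:E)%E.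
Proof.
have [C1 C10 C1P] := @weighted_mass_simplex R d.+1 N.
have [C2 C20 C2P] := @poincare_simplex R d.+1 N.
(* [K1] bounds the gradient of the projection by the LDG gradient; [K2] is the Poincare constant
   times the number of edges at a vertex. *)
pose K1 := (d.+2%:R * C1 * sigma) ^+ 2; pose K2 := C2 * d.+1%:R.
have K20 : 0 <= K2 by rewrite mulr_ge0// ltW.
exists (K1 * Num.sqrt K2 + 1); first by rewrite ltr_wpDl// mulr_ge0 ?sqr_ge0 ?sqrtr_ge0.
move=> n U V f S F uofv v psi hS hI M vtx tri reg uh vh puh uhU hproj k D segV nu v0 hnu v00.
move=> vp _ ivp Theta hTheta K lambda mK _ mlam lam0 coer ut _ _ dv pdv hpdv den0 pdv0; lazy zeta.
set L := fun i => jacobian_sup _ _.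
have uE : edges (vtx k) \in unitmx by have [] := tri.
have cD : compact D := @simplex_compact R _ _ (vtx k).
have pvh : PNvec N (vh k) by have [] := hproj k.
have cw x : D x -> {for x, continuous (v \o uh k)}.
  by move=> Dx; exact: (continuous_v_uh hS (puh k) (uhU k) Dx).
have cTheta i x : {for x, continuous (Theta i)} by exact: PNvec_continuous (hTheta i).1.
pose G := vol_int D (fun x => \sum_i dot (pderiv i (vh k) x) (pderiv i (vh k) x)).
pose T := vol_int D (fun x => \sum_i dot (Theta i x) (Theta i x)).
pose err x := v (uh k x) - vh k x.
pose E := vol_int D (fun x => dot (err x) (err x)).
pose P := L2norm D pdv ^+ 2.
pose delta := delta_k (vtx k) nu f psi (uh k) (vh k) ut.
pose den := vol_int D (viscous_form K Theta).
have theta0 x : 0 <= \sum_i dot (Theta i x) (Theta i x) by apply: sumr_ge0 => i _; exact: dot_ge0.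
have visc0 x : D x -> 0 <= viscous_form K Theta x.
  by move=> Dx; apply: le_trans (coer x Dx); rewrite mulr_ge0// ltW// lam0.
have denp : 0 < den by rewrite lt_neqAle eq_sym den0/=; exact: vol_int_ge0.
have E0 : 0 <= E by apply: vol_int_ge0 => x _; exact: dot_ge0.
have G0 : 0 <= G by apply: vol_int_ge0 => x _; apply: sumr_ge0 => i _; exact: dot_ge0.
have P0 : 0 < P by rewrite lt_neqAle eq_sym pdv0 sqr_ge0.
have SL0 : 0 <= \sum_i L i ^+ 2 by apply: sumr_ge0 => i _; exact: sqr_ge0.
have PE : P = vol_int D (fun x => dot (vh k x - integral_mean D (v \o uh k))
    (vh k x - integral_mean D (v \o uh k))).
  rewrite /P L2normE; apply: eq_vol_int => x Dx.
  by rewrite (L2_projection_sub_mean uE cw (hproj k) hpdv Dx).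
have GT : G <= K1 * T.
  exact: (LDG_gradient_bound uE hnu v00 pvh ivp hTheta (fun j q => C1P _ j q uE) (reg k)).
have PG : P <= K2 * diam D ^+ 2 * G.
  by rewrite PE; exact: (projection_poincare uE cw (hproj k) C20 (fun q => C2P _ q uE)).
(* Pythagoras turns the last root in [C_uh] into the ratio of projection error to projected
   fluctuation. *)
have ratio : L2norm D dv ^+ 2 / L2norm D pdv ^+ 2 - 1 = E / P.
  rewrite -/P L2normE (projection_pythagoras cw (hproj k)) -PE -/E mulrDl divff ?addrK//.
have delE tau : 0 < tau -> - delta <= (tau * ((\sum_i L i ^+ 2) * E) + G / tau) / 2.
  exact: (delta_k_ge hS hI uE hnu (puh k) pvh (uhU k) segV).
have diamh : diam D <= mesh_size vtx by exact: le_bigmax.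
have diam0 : 0 <= diam D by exact: diam_ge0.
(* A vanishing diameter would force [P = 0]. Positivity of [h] keeps an infinite right-hand side
   infinite. *)
have h0 : 0 < mesh_size vtx.
  apply: lt_le_trans diamh; rewrite lt_neqAle diam0 andbT eq_sym; apply/eqP => dm0.
  by move: PG; rewrite dm0 expr0n mulr0 mul0r leNgt P0.
have mTheta i c : measurable_fun D (fun x => Theta i x ord0 c).
  apply: measurable_fun_continuous_rV => // x _.
  exact: row_coord_continuous (cTheta i x).
have mvisc : measurable_fun D (viscous_form K Theta).
  apply: measurable_sum => i; apply: measurable_sum => j; apply: measurable_sum => c.
  apply: measurable_funM => //; under eq_fun do rewrite mxE.
  by apply: measurable_sum => e; exact: measurable_funM.
rewrite /eps_k /C_uh ratio -/delta -/den -/D.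
have := Lnorm_ge0 (lebesgue_rV R d.+1) +oo (EFin \o ((fun x => (lambda x)^-1) \_ D)).
rewrite -/(Linfnorm D _).
(* The norm is nonnegative, so it is either finite or [+oo]. *)
case Lr : (Linfnorm D _) => [r| |]// r0.
  have Tr : T <= r * den.
    apply: (vol_int_weighted_le cD _ _ mvisc lam0 coer den0 Lr) => // x Dx.
    by apply: continuous_for_sum => i; exact: continuous_for_dot.
  rewrite -!EFinM lee_fin.
  exact: (coefficient_bound denp E0 G0 P0 SL0 (sqr_ge0 _) K20 diam0 diamh delE GT PG Tr).
(* For an infinite norm the convention [+oo * 0 = 0] leaves a nontrivial claim exactly when the
   product of the two roots vanishes. *)
have [st|st] := eqVneq (Num.sqrt (\sum_i L i ^+ 2) * Num.sqrt (E / P)) 0.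
  rewrite -(muleA +oo%E) -EFinM st mule0 mule0 mul0e lee_fin.
  exact: (coefficient_bound0 denp E0 G0 P0 SL0 delE PG st).
have stp : 0 < Num.sqrt (\sum_i L i ^+ 2) * Num.sqrt (E / P).
  by rewrite lt_neqAle eq_sym st mulr_ge0 ?sqrtr_ge0.
rewrite -(muleA +oo%E) -EFinM gt0_mulye ?lte_fin// gt0_muley ?gt0_mulye ?leey ?lte_fin//.
by rewrite ltr_wpDl// mulr_ge0 ?sqr_ge0 ?sqrtr_ge0.
Qed.
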